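(* Let $H$ be a semisimple Hopf algebra over an algebraically closed field $K$ of characteristic zero, $D=D(H)$ its Drinfel'd double with Drinfel'd element $u_D$, and $V,W$ two $H$-modules. Let $b_1,\dots,b_n$ be a basis of $H$ with dual basis $b_1^*,\dots,b_n^*$, and define $$\beta_{V,W}:\mathrm{Ind}(V\otimes W)\to\mathrm{Ind}(W\otimes V),\qquad \varphi\otimes v\otimes w\mapsto\sum_{i=1}^n\varphi b_i^*\otimes w\otimes b_i.v .$$ Then $\beta_{V,W}$ is a $D$-linear isomorphism, with inverse $$\beta_{V,W}^{-1}(\varphi\otimes w\otimes v)=\sum_{i=1}^n\varphi b_i^*\otimes S(b_i).v\otimes w .$$ Furthermore, $(\beta_{W,V}\circ\beta_{V,W})(x)=u_D^{-1}.x$ for all $x\in\mathrm{Ind}(V\otimes W)$.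
   Context: Sweedler notation; modules are left modules; $H$ is finite-dimensional with counit $\varepsilon$ and antipode $S$. $H^*$ carries the product $(\varphi\psi)(h)=\varphi(h_{(1)})\psi(h_{(2)})$ and the coproduct determined by $\varphi(hh')=\varphi_{(1)}(h)\varphi_{(2)}(h')$. The Drinfel'd double $D(H)$ is $H^*\otimes H$ with product $(\varphi\otimes h)(\varphi'\otimes h')=\varphi'_{(1)}(S^{-1}(h_{(3)}))\,\varphi'_{(3)}(h_{(1)})\;\varphi\varphi'_{(2)}\otimes h_{(2)}h'$ and unit $\varepsilon\otimes1$; its Drinfel'd element is $u_D=\sum_iS^{-1*}(b_i^* )\otimes b_i$, with inverse $u_D^{-1}=\sum_iS^{2*}(b_i^* )\otimes b_i$. For an $H$-module $U$, the induced module $\mathrm{Ind}(U)=D\otimes_HU$ is realized on the vector space $H^*\otimes U$ with the $D$-action $(\varphi\otimes h).(\varphi'\otimes u)=\varphi'_{(1)}(S(h_{(3)}))\,\varphi'_{(3)}(h_{(1)})\;\varphi\varphi'_{(2)}\otimes h_{(2)}.u$. Tensor products of $H$-modules carry the diagonal action via the coproduct. *)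

(* Defs.v *)
From HB Require Import structures.
From mathcomp Require Import all_boot all_algebra falgebra boolp.

Set Implicit Arguments.
Unset Strict Implicit.
Unset Printing Implicit Defensive.

Import GRing.Theory.
Local Open Scope ring_scope.
Local Open Scope quotient_scope.

Reserved Notation "u \otimes v" (at level 40, left associativity).
Reserved Notation "\tsum_ ( u \otimes v <- t ) F"
  (at level 41, F at level 41, u name, v name, t at level 50,
   format "'[' \tsum_ ( u  \otimes  v  <-  t ) '/  '  F ']'").

Notation is_bilinear f := (bilinear_for *:%R *:%R f).

(* The tensor product of two vector spaces of arbitrary dimension: formal sums
   of pairs, two of them being identified when every bilinear map takes the
   same value on them.  Its universal property is given by tmul_bilinear,
   tens_span, tsum_linear and tsum_tmul below. *)
Section TensorType.
Variables (K : fieldType) (U V : lmodType K).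
Implicit Types s t : seq (U * V).

Definition tens_eq s t : bool :=
  `[< forall (W : lmodType K) (f : U -> V -> W), is_bilinear f ->
      \sum_(p <- s) f p.1 p.2 = \sum_(p <- t) f p.1 p.2 >].

Fact tens_eq_refl : reflexive tens_eq.
Proof. by move=> s; apply/asboolP. Qed.
Fact tens_eq_sym : symmetric tens_eq.
Proof. by move=> s t; apply/asboolP/asboolP=> h W f bf; rewrite h. Qed.
Fact tens_eq_trans : transitive tens_eq.
Proof.
move=> t s r /asboolP h1 /asboolP h2; apply/asboolP=> W f bf.
by rewrite h1 // h2.
Qed.

Canonical tens_equiv := EquivRel tens_eq tens_eq_refl tens_eq_sym tens_eq_trans.

Definition tens := {eq_quot tens_equiv}.
HB.instance Definition _ := EqQuotient.on tens.
HB.instance Definition _ := Choice.on tens.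

Definition tmul (u : U) (v : V) : tens := \pi_tens [:: (u, v)].

(* Sweedler-style summation over a representation of t as a sum of pure
   tensors; by tsum_pi the value does not depend on the representation as soon
   as f is bilinear. *)
Definition tsum (W : lmodType K) (t : tens) (f : U -> V -> W) : W :=
  \sum_(p <- repr t) f p.1 p.2.

Lemma tsum_pi (W : lmodType K) (f : U -> V -> W) s :
  is_bilinear f -> tsum (\pi_tens s) f = \sum_(p <- s) f p.1 p.2.
Proof.
move=> bf; rewrite /tsum.
have /eqmodP/asboolP h : repr (\pi_tens s) = s %[mod tens] by rewrite reprK.
exact: h.
Qed.

Lemma tensP (x y : tens) :
  (forall (W : lmodType K) (f : U -> V -> W), is_bilinear f ->
     tsum x f = tsum y f) -> x = y.
Proof.
move=> h; rewrite -[x]reprK -[y]reprK; apply/eqmodP/asboolP => W f bf.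
exact: h.
Qed.

Definition tens0 : tens := \pi_tens [::].
Definition tens_add (x y : tens) : tens := \pi_tens (repr x ++ repr y).
Definition tens_scale (a : K) (x : tens) : tens :=
  \pi_tens [seq (a *: p.1, p.2) | p <- repr x].
Definition tens_opp (x : tens) : tens := tens_scale (-1) x.

Section Calc.
Variables (W : lmodType K) (f : U -> V -> W).
Hypothesis bf : is_bilinear f.

Lemma bilZl a u v : f (a *: u) v = a *: f u v.
Proof. exact: (scalable_linear (bf.1 v)). Qed.

Lemma tsum0 : tsum tens0 f = 0.
Proof. by rewrite tsum_pi // big_nil. Qed.
Lemma tsum_add x y : tsum (tens_add x y) f = tsum x f + tsum y f.
Proof. by rewrite tsum_pi // big_cat. Qed.
Lemma tsum_scale a x : tsum (tens_scale a x) f = a *: tsum x f.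
Proof.
rewrite tsum_pi // big_map /= /tsum scaler_sumr; apply: eq_bigr => p _.
exact: bilZl.
Qed.
End Calc.

Fact tens_addA : associative tens_add.
Proof. by move=> x y z; apply: tensP => W f bf; rewrite !tsum_add // addrA. Qed.
Fact tens_addC : commutative tens_add.
Proof. by move=> x y; apply: tensP => W f bf; rewrite !tsum_add // addrC. Qed.
Fact tens_add0 : left_id tens0 tens_add.
Proof.
by move=> x; apply: tensP => W f bf; rewrite tsum_add // tsum0 // add0r.
Qed.
Fact tens_addN : left_inverse tens0 tens_opp tens_add.
Proof.
move=> x; apply: tensP => W f bf.
by rewrite tsum_add // tsum_scale // tsum0 // scaleN1r addNr.
Qed.

HB.instance Definition _ :=
  GRing.isZmodule.Build tens tens_addA tens_addC tens_add0 tens_addN.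

Fact tens_scaleA a b x : tens_scale a (tens_scale b x) = tens_scale (a * b) x.
Proof. by apply: tensP => W f bf; rewrite !tsum_scale // scalerA. Qed.
Fact tens_scale1 : left_id 1 tens_scale.
Proof. by move=> x; apply: tensP => W f bf; rewrite tsum_scale // scale1r. Qed.
Fact tens_scaleDr : right_distributive tens_scale +%R.
Proof.
move=> a x y; apply: tensP => W f bf.
by rewrite tsum_scale // !tsum_add // !tsum_scale // scalerDr.
Qed.
Fact tens_scaleDl x : {morph tens_scale^~ x : a b / a + b}.
Proof.
move=> a b; apply: tensP => W f bf.
by rewrite tsum_add // !tsum_scale // scalerDl.
Qed.

HB.instance Definition _ := GRing.Zmodule_isLmodule.Build K tens
  tens_scaleA tens_scale1 tens_scaleDr tens_scaleDl.

End TensorType.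

Notation "u \otimes v" := (tmul u v) : ring_scope.
Notation "\tsum_ ( u \otimes v <- t ) F" := (tsum t (fun u v => F)) : ring_scope.

Section TensorTheory.
Variables (K : fieldType) (U V : lmodType K).

Lemma tsum_linear (W : lmodType K) (f : U -> V -> W) :
  is_bilinear f -> linear (fun t : tens U V => tsum t f).
Proof.
move=> bf a x y.
by rewrite -(tsum_scale bf) -(tsum_add bf).
Qed.

Lemma tsum_tmul (W : lmodType K) (f : U -> V -> W) u v :
  is_bilinear f -> tsum (u \otimes v) f = f u v.
Proof. by move=> bf; rewrite tsum_pi // big_seq1. Qed.

Lemma tmul_bilinear : is_bilinear (@tmul K U V).
Proof.
split=> [v a x y | u a x y]; apply: tensP => X f bf.
  rewrite (tsum_linear bf) !tsum_tmul //; exact: bf.1.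
rewrite (tsum_linear bf) !tsum_tmul //; exact: bf.2.
Qed.

Lemma tens_span (t : tens U V) : t = \tsum_(u \otimes v <- t) (u \otimes v).
Proof.
apply: tensP => X f bf; rewrite [in RHS]/tsum [in LHS]/tsum.
elim: (repr t) => [|p s IH]; first by rewrite !big_nil -/(tsum 0 f) (tsum0 bf).
by rewrite !big_cons IH -!/(tsum _ f) (tsum_add bf) tsum_tmul.
Qed.

Lemma tens_eq_linear (W : lmodType K) (f g : tens U V -> W) :
  linear f -> linear g -> (forall u v, f (u \otimes v) = g (u \otimes v)) ->
  f =1 g.
Proof.
move=> lf lg fg t.
pose F := GRing.isLinear.Build K _ _ _ f lf.
pose G := GRing.isLinear.Build K _ _ _ g lg.
pose f' : {linear tens U V -> W} := HB.pack f F.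
pose g' : {linear tens U V -> W} := HB.pack g G.
rewrite [t]tens_span -[f _]/(f' _) -[g _]/(g' _) /tsum !linear_sum.
by apply: eq_bigr => p _; apply: fg.
Qed.

End TensorTheory.

Section LinearCombinators.
Variables (K : fieldType) (X U V W : lmodType K).

Lemma lin_id : linear (fun x : X => x). Proof. by []. Qed.

Lemma lin_app (f : {linear U -> V}) (g : X -> U) :
  linear g -> linear (fun x => f (g x)).
Proof. by move=> lg a x y; rewrite lg linearP. Qed.

Lemma lin_tmul_l (g : X -> U) (v : V) :
  linear g -> linear (fun x => g x \otimes v).
Proof. by move=> lg a x y; rewrite lg (tmul_bilinear U V).1. Qed.

Lemma lin_tmul_r (g : X -> V) (u : U) :
  linear g -> linear (fun x => u \otimes g x).
Proof. by move=> lg a x y; rewrite lg (tmul_bilinear U V).2. Qed.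

Lemma lin_scale_l (g : X -> K^o) (u : U) :
  linear g -> linear (fun x => (g x : K) *: u).
Proof. by move=> lg a x y; rewrite lg scalerDl -scalerA. Qed.

Lemma lin_scale_r (c : K) (g : X -> U) :
  linear g -> linear (fun x => c *: g x).
Proof. by move=> lg a x y; rewrite lg scalerDr !scalerA mulrC. Qed.

Lemma lin_sum I (r : seq I) (F : I -> X -> U) :
  (forall i, linear (F i)) -> linear (fun x => \sum_(i <- r) F i x).
Proof.
move=> lF a x y; rewrite scaler_sumr -big_split.
by apply: eq_bigr => i _; apply: lF.
Qed.

Lemma lin_tsum_l (g : X -> tens U V) (F : U -> V -> W) :
  is_bilinear F -> linear g -> linear (fun x => tsum (g x) F).
Proof. by move=> bF lg a x y; rewrite lg (tsum_linear bF). Qed.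

Lemma lin_tsum_r (t : tens U V) (F : X -> U -> V -> W) :
  (forall u v, linear (fun x => F x u v)) -> linear (fun x => tsum t (F x)).
Proof.
move=> lF a x y; rewrite /tsum scaler_sumr -big_split.
by apply: eq_bigr => p _; apply: lF.
Qed.

Lemma lin_tsumE (f : W -> X) : linear f ->
  forall (t : tens U V) (F : U -> V -> W),
  f (tsum t F) = tsum t (fun u v => f (F u v)).
Proof.
move=> lf t F.
pose g : {linear W -> X} := HB.pack f (GRing.isLinear.Build K _ _ _ f lf).
by rewrite -[f _]/(g _) /tsum linear_sum.
Qed.

Lemma eq_tsum (F G : U -> V -> W) :
  (forall u v, F u v = G u v) -> forall t : tens U V, tsum t F = tsum t G.
Proof. by move=> FG t; apply: eq_bigr => p _; apply: FG. Qed.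

Lemma lin_eval (A : vectType K) (g : X -> 'Hom(A, K^o)) (a : A) :
  linear g -> linear (fun x => g x a : K^o).
Proof. by move=> lg k x y; rewrite lg add_lfunE scale_lfunE. Qed.

Lemma lin_mul_l (A : algType K) (g : X -> A) (a : A) :
  linear g -> linear (fun x => g x * a).
Proof. by move=> lg k x y; rewrite lg mulrDl scalerAl. Qed.

Lemma lin_mul_r (A : algType K) (g : X -> A) (a : A) :
  linear g -> linear (fun x => a * g x).
Proof. by move=> lg k x y; rewrite lg mulrDr scalerAr. Qed.

Lemma lin_kmul_l (g : X -> K^o) (a : K) :
  linear g -> linear (fun x => (g x : K) * a : K^o).
Proof. by move=> lg k x y; rewrite lg mulrDl -mulrA. Qed.

Lemma lin_kmul_r (g : X -> K^o) (a : K) :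
  linear g -> linear (fun x => a * (g x : K) : K^o).
Proof. by move=> lg k x y; rewrite lg mulrDr mulrCA. Qed.

End LinearCombinators.

Lemma tsum_exchange (K : fieldType) (U V U' V' W : lmodType K)
    (t : tens U V) (t' : tens U' V') (F : U -> V -> U' -> V' -> W) :
  \tsum_(u \otimes v <- t) \tsum_(u' \otimes v' <- t') F u v u' v'
  = \tsum_(u' \otimes v' <- t') \tsum_(u \otimes v <- t) F u v u' v'.
Proof. exact: exchange_big. Qed.

Lemma linfun_linE (K : fieldType) (A B : vectType K) (f : A -> B) :
  linear f -> linfun f =1 f.
Proof.
move=> lf.
pose g : {linear A -> B} := HB.pack f (GRing.isLinear.Build K _ _ _ f lf).
exact: (lfunE g).
Qed.

Lemma linear_of_sum (K : fieldType) (U V : lmodType K) (f : U -> V) :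
  linear f -> forall I (r : seq I) (c : I -> K) (F : I -> U),
  f (\sum_(i <- r) c i *: F i) = \sum_(i <- r) c i *: f (F i).
Proof.
move=> lf I r c F.
pose g : {linear U -> V} := HB.pack f (GRing.isLinear.Build K _ _ _ f lf).
rewrite -[f _]/(g _) linear_sum; apply: eq_bigr => i _.
by rewrite linearZ.
Qed.

HB.mixin Record isHopf (K : fieldType) H of Falgebra K H := {
  comul : {linear H -> tens H H};
  counit : {linear H -> K^o};
  antipode : {linear H -> H};
  comul_coassoc : forall h : H,
    \tsum_(h1 \otimes h2 <- comul h) \tsum_(h11 \otimes h12 <- comul h1)
      (h11 \otimes (h12 \otimes h2))
    = \tsum_(h1 \otimes h2 <- comul h) (h1 \otimes comul h2);
  counit_comul_l : forall h : H,
    \tsum_(h1 \otimes h2 <- comul h) (counit h1 *: h2) = h;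
  counit_comul_r : forall h : H,
    \tsum_(h1 \otimes h2 <- comul h) (counit h2 *: h1) = h;
  comul1 : comul 1 = 1 \otimes 1;
  comulM : forall g h : H,
    comul (g * h) =
    \tsum_(g1 \otimes g2 <- comul g) \tsum_(h1 \otimes h2 <- comul h)
      ((g1 * h1) \otimes (g2 * h2));
  counit1 : counit 1 = 1;
  counitM : forall g h : H, counit (g * h) = counit g * counit h;
  antipode_l : forall h : H,
    \tsum_(h1 \otimes h2 <- comul h) (antipode h1 * h2) = (counit h)%:A;
  antipode_r : forall h : H,
    \tsum_(h1 \otimes h2 <- comul h) (h1 * antipode h2) = (counit h)%:A
}.

(* Finite-dimensional Hopf algebras over K. *)
#[short(type="hopfType")]
HB.structure Definition HopfAlgebra (K : fieldType) :=
  {H of Falgebra K H & isHopf K H}.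

(* The left regular module is semisimple: every left ideal has a complementary
   left ideal. *)
Definition semisimple_alg (K : fieldType) (A : falgType K) : Prop :=
  forall I : {vspace A}, ({:A} * I <= I)%VS ->
  exists J : {vspace A},
    [/\ ({:A} * J <= J)%VS, (I + J)%VS = {:A}%VS & (I :&: J)%VS = 0%VS].

(* An A-module regarded as a vector space over K. *)
Definition restr (K : fieldType) (A : algType K) (V : lmodType A) : Type := V.

Section Restriction.
Variables (K : fieldType) (A : algType K) (V : lmodType A).

HB.instance Definition _ := GRing.Zmodule.on (restr V).

Definition restr_scale (k : K) (v : restr V) : restr V := (k%:A : A) *: (v : V).

Fact restr_scaleA a b v : restr_scale a (restr_scale b v) = restr_scale (a * b) v.
Proof. by rewrite /restr_scale scalerA -scalerAl mul1r scalerA. Qed.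
Fact restr_scale1 : left_id 1 restr_scale.
Proof. by move=> v; rewrite /restr_scale !scale1r. Qed.
Fact restr_scaleDr : right_distributive restr_scale +%R.
Proof. by move=> a x y; rewrite /restr_scale scalerDr. Qed.
Fact restr_scaleDl v : {morph restr_scale^~ v : a b / a + b}.
Proof. by move=> a b; rewrite /restr_scale !scalerDl. Qed.

HB.instance Definition _ := GRing.Zmodule_isLmodule.Build K (restr V)
  restr_scaleA restr_scale1 restr_scaleDr restr_scaleDl.

Definition hact (a : A) (v : restr V) : restr V := a *: (v : V).

Lemma restr_scaleE k (v : restr V) : k *: v = hact k%:A v.
Proof. by []. Qed.

Lemma lin_hact_l (X : lmodType K) (g : X -> A) (v : restr V) :
  linear g -> linear (fun x => hact (g x) v).
Proof.
move=> lg k x y; rewrite lg restr_scaleE /hact scalerDl scalerA.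
by rewrite -scalerAl mul1r.
Qed.

Lemma lin_hact_r (X : lmodType K) (g : X -> restr V) (a : A) :
  linear g -> linear (fun x => hact a (g x)).
Proof.
move=> lg k x y; rewrite lg !restr_scaleE /hact scalerDr !scalerA.
by rewrite -scalerAl -scalerAr mul1r mulr1.
Qed.

End Restriction.

Ltac lin_tac :=
  repeat first
  [ exact: lin_id
  | apply: lin_tsum_l; [split=> ? /= | ]
  | apply: lin_tsum_r => ? ? /=
  | apply: lin_sum => ? /=
  | apply: lin_tmul_l | apply: lin_tmul_r
  | apply: lin_scale_l | apply: lin_scale_r
  | apply: lin_hact_l | apply: lin_hact_r
  | apply: lin_kmul_l | apply: lin_kmul_r
  | apply: lin_mul_l | apply: lin_mul_r
  | apply: lin_app | apply: lin_eval ].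

Section ModuleTensor.
Variables (K : fieldType) (H : hopfType K) (V W : lmodType H).

(* V (x) W with the diagonal action. *)
Definition htens : Type := tens (restr V) (restr W).
HB.instance Definition _ := GRing.Zmodule.on htens.

Definition diag_act (h : H) (t : htens) : htens :=
  \tsum_(h1 \otimes h2 <- comul h) \tsum_(v \otimes w <- t)
    (hact h1 v \otimes hact h2 w).

Fact diag_act_linl t : linear (diag_act^~ t : H -> tens (restr V) (restr W)).
Proof. by rewrite /diag_act; lin_tac. Qed.

Fact diag_act_linr h :
  linear (diag_act h : tens (restr V) (restr W) -> tens (restr V) (restr W)).
Proof. by rewrite /diag_act; lin_tac. Qed.

Lemma diag_actE h (v : V) (w : W) :
  diag_act h ((v : restr V) \otimes (w : restr W)) =
  \tsum_(h1 \otimes h2 <- comul h)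
    ((h1 *: v : restr V) \otimes (h2 *: w : restr W)).
Proof. by apply: eq_bigr => p _; rewrite tsum_tmul //; split=> ?; lin_tac. Qed.

Fact diag_actA a b t : diag_act a (diag_act b t) = diag_act (a * b) t.
Proof.
move: t; apply: tens_eq_linear => [k x y|| v w]; last 2 first.
- exact: diag_act_linr.
- rewrite !diag_actE comulM (lin_tsumE (diag_act_linr a)).
  have lE : linear (fun t : tens H H =>
      \tsum_(h1 \otimes h2 <- t) ((hact h1 v) \otimes (hact h2 w))).
    by lin_tac.
  rewrite [RHS](lin_tsumE lE) [RHS](eq_tsum (fun a1 a2 => lin_tsumE lE _ _)).
  rewrite [LHS](eq_tsum (fun b1 b2 => diag_actE a _ _)) tsum_exchange.
  apply: eq_tsum => a1 a2; apply: eq_tsum => b1 b2.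
  by rewrite tsum_tmul /hact ?scalerA //; split=> ?; lin_tac.
by rewrite !diag_act_linr.
Qed.

Fact diag_act1 : left_id 1 diag_act.
Proof.
apply: tens_eq_linear => [||v w]; [exact: diag_act_linr| exact: lin_id|].
rewrite diag_actE comul1 tsum_tmul ?scale1r //.
by split=> ?; rewrite -/(hact _ _); lin_tac.
Qed.

Fact diag_actDr : right_distributive diag_act +%R.
Proof. by move=> h x y; have := diag_act_linr h 1 x y; rewrite !scale1r. Qed.

Fact diag_actDl t : {morph diag_act^~ t : g h / g + h}.
Proof. by move=> g h; have := diag_act_linl t 1 g h; rewrite !scale1r. Qed.

HB.instance Definition _ := GRing.Zmodule_isLmodule.Build H htens
  diag_actA diag_act1 diag_actDr diag_actDl.

End ModuleTensor.

Section Dual.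
Variables (K : fieldType) (H : hopfType K).
Local Notation dual := 'Hom(H, K^o).
Implicit Types phi psi : dual.

Definition dual_mul phi psi : dual :=
  linfun (fun h => \tsum_(h1 \otimes h2 <- comul h) (phi h1 * psi h2) : K^o).

Lemma dual_mulE phi psi h :
  dual_mul phi psi h = \tsum_(h1 \otimes h2 <- comul h) (phi h1 * psi h2 : K^o).
Proof.
by rewrite /dual_mul linfun_linE //; lin_tac.
Qed.

Definition dual_basis n (b : n.-tuple H) (i : 'I_n) : dual :=
  linfun (coord b i : H -> K^o).

Lemma dual_basisE n (b : n.-tuple H) i h : dual_basis b i h = coord b i h.
Proof. exact: lfunE. Qed.

Definition dual_one : dual := linfun counit.

(* The matrix form, in a fixed basis, of the coproduct determined by
   phi (g * h) = phi_1 g * phi_2 h: see dual_comulE and dual_comul_uniq. *)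
Definition dual_comul phi : tens dual dual :=
  let e := vbasis {:H} in
  \sum_(i < \dim {:H}) \sum_(j < \dim {:H}) (phi (e`_i * e`_j) : K) *:
    (dual_basis e i \otimes dual_basis e j).

Lemma dual_comul_linear : linear dual_comul.
Proof. by rewrite /dual_comul /=; lin_tac. Qed.

Lemma dual_comulE phi g h :
  \tsum_(phi1 \otimes phi2 <- dual_comul phi) (phi1 g * phi2 h : K^o)
  = phi (g * h).
Proof.
set e := vbasis {:H}.
have lE : linear (fun t : tens dual dual =>
    \tsum_(phi1 \otimes phi2 <- t) (phi1 g * phi2 h : K^o)) by lin_tac.
rewrite [in RHS](coord_vbasis (memvf g)) [in RHS](coord_vbasis (memvf h)).
rewrite mulr_suml linear_sum /dual_comul -/e.
under eq_bigr do rewrite -[\sum_j _]scale1r.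
rewrite (linear_of_sum lE); apply: eq_bigr => i _.
rewrite scale1r (linear_of_sum lE) mulr_sumr linear_sum.
apply: eq_bigr => j _; rewrite tsum_tmul; last by split=> ?; lin_tac.
rewrite !dual_basisE -scalerAl -scalerAr !linearZ /=.
by congr (_ *: _); apply: mulrC.
Qed.

Lemma dual_comul_uniq phi (t : tens dual dual) :
  (forall g h, \tsum_(phi1 \otimes phi2 <- t) (phi1 g * phi2 h : K^o)
               = phi (g * h)) ->
  t = dual_comul phi.
Proof.
move=> tE; set e := vbasis {:H}.
pose G (s : tens dual dual) := \sum_(i < \dim {:H}) \sum_(j < \dim {:H})
  ((\tsum_(phi1 \otimes phi2 <- s) (phi1 e`_i * phi2 e`_j : K^o)) : K) *:
    (dual_basis e i \otimes dual_basis e j).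
suff -> : t = G t.
  by apply: eq_bigr => i _; apply: eq_bigr => j _; rewrite tE.
move: t {tE}; apply: tens_eq_linear => [||f g]; [exact: lin_id| |].
  by rewrite /G; lin_tac.
have dE (p : dual) : p = \sum_(i < \dim {:H}) (p e`_i : K) *: dual_basis e i.
  apply/lfunP=> x; rewrite {1}(coord_vbasis (memvf x)) linear_sum sum_lfunE.
  by apply: eq_bigr => i _; rewrite linearZ scale_lfunE dual_basisE; apply: mulrC.
rewrite {1}(dE f) {1}(dE g).
rewrite (linear_of_sum (lin_tmul_l _ (@lin_id _ _))).
apply: eq_bigr => i _.
rewrite (linear_of_sum (lin_tmul_r _ (@lin_id _ _))) scaler_sumr.
apply: eq_bigr => j _; rewrite scalerA tsum_tmul //.
by split=> ?; lin_tac.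
Qed.

Fact lin_dual_mul_l (X : lmodType K) (g : X -> dual) psi :
  linear g -> linear (fun x => dual_mul (g x) psi).
Proof.
move=> lg a x y; rewrite lg; apply/lfunP=> h.
rewrite add_lfunE scale_lfunE !dual_mulE.
rewrite /tsum scaler_sumr -big_split; apply: eq_bigr => p _ /=.
by rewrite add_lfunE scale_lfunE mulrDl -mulrA.
Qed.

Fact lin_dual_mul_r (X : lmodType K) (g : X -> dual) phi :
  linear g -> linear (fun x => dual_mul phi (g x)).
Proof.
move=> lg a x y; rewrite lg; apply/lfunP=> h.
rewrite add_lfunE scale_lfunE !dual_mulE.
rewrite /tsum scaler_sumr -big_split; apply: eq_bigr => p _ /=.
by rewrite add_lfunE scale_lfunE mulrDr mulrCA.
Qed.

HB.instance Definition _ := GRing.isLinear.Build K dual (tens dual dual) _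
  dual_comul dual_comul_linear.

End Dual.

Section Double.
Variables (K : fieldType) (H : hopfType K).
Local Notation dual := 'Hom(H, K^o).

Definition double : lmodType K := tens dual H.

(* The antipode of a finite-dimensional Hopf algebra is bijective, so that this
   one-sided inverse is S^-1. *)
Definition antipode_inv : 'End(H) := (linfun antipode)^-1%VF.

Definition dbl_mul (d d' : double) : double :=
  \tsum_(phi \otimes h <- d) \tsum_(phi' \otimes h' <- d')
  \tsum_(h1 \otimes h23 <- comul h) \tsum_(h2 \otimes h3 <- comul h23)
  \tsum_(phi1 \otimes phi23 <- dual_comul phi')
  \tsum_(phi2 \otimes phi3 <- dual_comul phi23)
    (phi1 (antipode_inv h3) * phi3 h1 : K) *:
      (dual_mul phi phi2 \otimes (h2 * h')).

Definition dbl_one : double := dual_one H \otimes (1 : H).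

(* For b a basis, the Drinfel'd element and its inverse; see
   drinfeld_mulV and drinfeld_mulVl. *)
Definition drinfeld n (b : n.-tuple H) : double :=
  \sum_(i < n) ((dual_basis b i \o antipode_inv)%VF \otimes b`_i).

Definition drinfeld_inv n (b : n.-tuple H) : double :=
  \sum_(i < n)
    ((dual_basis b i \o (linfun antipode \o linfun antipode))%VF \otimes b`_i).

End Double.

Section Induced.
Variables (K : fieldType) (H : hopfType K) (U : lmodType H).
Local Notation dual := 'Hom(H, K^o).

Definition Ind : lmodType K := tens dual (restr U).

(* The D(H)-action on Ind(U).  It involves S where the product of D(H) involves
   S^-1: the two agree when S^2 = id, in particular for H semisimple in
   characteristic zero. *)
Definition ind_act (d : double H) (x : Ind) : Ind :=
  \tsum_(phi \otimes h <- d) \tsum_(phi' \otimes u <- x)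
  \tsum_(h1 \otimes h23 <- comul h) \tsum_(h2 \otimes h3 <- comul h23)
  \tsum_(phi1 \otimes phi23 <- dual_comul phi')
  \tsum_(phi2 \otimes phi3 <- dual_comul phi23)
    (phi1 (antipode h3) * phi3 h1 : K) *:
      (dual_mul phi phi2 \otimes hact h2 u).

End Induced.

Definition dbl_linear (K : fieldType) (H : hopfType K) (U U' : lmodType H)
    (f : Ind U -> Ind U') : Prop :=
  linear f /\ forall d x, f (ind_act d x) = ind_act d (f x).

Section Beta.
Variables (K : fieldType) (H : hopfType K) (n : nat) (b : n.-tuple H).
Variables (V W : lmodType H).

Definition beta (x : Ind (htens V W)) : Ind (htens W V) :=
  \tsum_(phi \otimes t <- x) \tsum_(v \otimes w <- (t : tens (restr V) (restr W)))
    \sum_(i < n) (dual_mul phi (dual_basis b i) \otimes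
      (w \otimes hact b`_i v : restr (htens W V))).

Definition beta_inv (x : Ind (htens W V)) : Ind (htens V W) :=
  \tsum_(phi \otimes t <- x) \tsum_(w \otimes v <- (t : tens (restr W) (restr V)))
    \sum_(i < n) (dual_mul phi (dual_basis b i) \otimes
      (hact (antipode b`_i) v \otimes w : restr (htens V W))).

End Beta.

Arguments beta {K H n} b V W x.
Arguments beta_inv {K H n} b V W x.

Lemma linear_of_scale (K : fieldType) (U V : lmodType K) (f : U -> V) :
  linear f -> forall k u, f (k *: u) = k *: f u.
Proof. by move=> lf k u; apply: (scalable_linear lf). Qed.

Lemma tsum_scaler (K : fieldType) (U V W : lmodType K) (k : K) (t : tens U V)
    (F : U -> V -> W) :
  k *: tsum t F = tsum t (fun u v => k *: F u v).
Proof. exact: scaler_sumr. Qed.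

Section DrinfeldInverse.
Variables (K : fieldType) (H : hopfType K).
Local Notation dual := 'Hom(H, K^o).
Local Notation S := antipode.

Lemma comul_assoc_sum (U : lmodType K) (F : H -> H -> H -> U) h :
  (forall y z, linear (fun x => F x y z)) ->
  (forall x z, linear (fun y => F x y z)) ->
  (forall x y, linear (fun z => F x y z)) ->
  \tsum_(h1 \otimes h2 <- comul h) \tsum_(h11 \otimes h12 <- comul h1) F h11 h12 h2
  = \tsum_(h1 \otimes h2 <- comul h) \tsum_(h21 \otimes h22 <- comul h2) F h1 h21 h22.
Proof.
move=> l1 l2 l3.
pose G (t : tens H (tens H H)) :=
  \tsum_(x \otimes s <- t) \tsum_(y \otimes z <- s) F x y z.
have bF x : is_bilinear (F x) by split=> ?; [exact: l2 | exact: l3].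
have bG : is_bilinear (fun x s => \tsum_(y \otimes z <- s) F x y z).
  split=> [s|x]; first by apply: lin_tsum_r => y z; exact: l1.
  by apply: lin_tsum_l; [exact: bF | exact: lin_id].
have lG : linear G by apply: lin_tsum_l; [exact: bG | exact: lin_id].
have := congr1 G (comul_coassoc h); rewrite [LHS](lin_tsumE lG) [RHS](lin_tsumE lG).
under eq_tsum => h1 h2.
  rewrite (lin_tsumE lG); under eq_tsum => h11 h12 do
    rewrite /G (tsum_tmul _ _ bG) (tsum_tmul _ _ (bF _)).
  over.
by move=> ->; apply: eq_tsum => h1 h2; rewrite /G (tsum_tmul _ _ bG).
Qed.

Lemma antipode1 : S (1 : H) = 1.
Proof.
have := antipode_l (1 : H); rewrite comul1 tsum_tmul; last by split=> ?; lin_tac.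
by rewrite mulr1 counit1 scale1r.
Qed.

Lemma antipodeM (g h : H) : S (g * h) = S h * S g.
Proof.
pose F (x y z x' y' z' : H) := S (x * x') * (y * y') * (S z' * S z).
have e1 : \tsum_(g1 \otimes g2 <- comul g) \tsum_(g11 \otimes g12 <- comul g1)
   \tsum_(h1 \otimes h2 <- comul h) \tsum_(h11 \otimes h12 <- comul h1)
    F g11 g12 g2 h11 h12 h2 = S h * S g.
  transitivity (\tsum_(g1 \otimes g2 <- comul g) \tsum_(h1 \otimes h2 <- comul h)
      (counit g1 * counit h1 : K) *: (S h2 * S g2 : H)).
    apply: eq_tsum => g1 g2; rewrite tsum_exchange; apply: eq_tsum => h1 h2.
    have lm : linear (fun x : H => x * (S h2 * S g2)) by lin_tac.
    rewrite -[RHS]mul1r -scalerAr scalerAl -counitM -antipode_l comulM.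
    have lE : linear (fun t : tens H H => \tsum_(x \otimes y <- t) (S x * y)).
      by lin_tac.
    rewrite (lin_tsumE lE) (lin_tsumE lm); apply: eq_tsum => a1 a2.
    rewrite (lin_tsumE lE) (lin_tsumE lm); apply: eq_tsum => c1 c2.
    by rewrite tsum_tmul //; split=> ?; lin_tac.
  have lm : linear (fun x : H => S h * S x) by lin_tac.
  rewrite -{2}(counit_comul_l g) (lin_tsumE lm); apply: eq_tsum => g1 g2.
  have lm' : linear (fun x : H => (counit g1 : K) *: (S x * S g2)) by lin_tac.
  rewrite linearZ -scalerAr -[in RHS](counit_comul_l h) (lin_tsumE lm').
  by apply: eq_tsum => h1 h2; rewrite linearZ -scalerAl scalerA.
rewrite -e1.
transitivity (\tsum_(g1 \otimes g2 <- comul g) \tsum_(g21 \otimes g22 <- comul g2)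
   \tsum_(h1 \otimes h2 <- comul h) \tsum_(h21 \otimes h22 <- comul h2)
    F g1 g21 g22 h1 h21 h22); last first.
  rewrite -comul_assoc_sum; try by move=> *; rewrite /F; lin_tac.
  apply: eq_tsum => g1 g2; apply: eq_tsum => g21 g22.
  by rewrite -comul_assoc_sum //; move=> *; rewrite /F; lin_tac.
rewrite -{1}(counit_comul_r g).
have lm : linear (fun x : H => S (x * h)) by lin_tac.
rewrite (lin_tsumE lm); apply: eq_tsum => g1 g2.
rewrite -scalerAl linearZ /= -{1}(counit_comul_r h).
have lm' : linear (fun x : H => (counit g2 : K) *: S (g1 * x)) by lin_tac.
rewrite (lin_tsumE lm').
rewrite tsum_exchange; apply: eq_tsum => h1 h2.
rewrite -scalerAr linearZ /= scalerA.
transitivity (\tsum_(g21 \otimes g22 <- comul g2)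
   (counit h2 : K) *: (S (g1 * h1) * (g21 * S g22) : H)).
  have lc : linear (fun x : H => (counit h2 : K) *: (S (g1 * h1) * x)) by lin_tac.
  by rewrite -(lin_tsumE lc) antipode_r -scalerAr mulr1 scalerA mulrC.
apply: eq_tsum => g21 g22.
have lc : linear (fun x : H => (S (g1 * h1) * (g21 * x * S g22))) by lin_tac.
have := lin_tsumE lc (comul h2) (fun x y => x * S y).
rewrite antipode_r /F => e.
transitivity (S (g1 * h1) * (g21 * (counit h2)%:A * S g22)).
  by rewrite -[in RHS]scalerAr mulr1 -scalerAl -scalerAr.
by rewrite e; apply: eq_tsum => x y; rewrite !mulrA.
Qed.

Definition dbl_ev (d : double H) (y : H) : H :=
  \tsum_(phi \otimes h <- d) (phi y : K) *: h.

Lemma dbl_ev_linear y : linear (dbl_ev^~ y).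
Proof. by rewrite /dbl_ev; lin_tac. Qed.

Lemma dbl_ev_lin d : linear (dbl_ev d).
Proof. by rewrite /dbl_ev; lin_tac. Qed.

Lemma dbl_ev_inj d d' : dbl_ev d =1 dbl_ev d' -> d = d'.
Proof.
set e := vbasis {:H}.
pose G (f : H -> H) : double H :=
  \sum_(i < \dim {:H}) (dual_basis e i \otimes f e`_i).
have GE x : G (dbl_ev x) = x.
  move: x; apply: tens_eq_linear => [||f h]; [ | exact: lin_id | ].
    rewrite /G; apply: lin_sum => i; apply: lin_tmul_r.
    exact: (dbl_ev_linear e`_i).
  have fE : f = \sum_(i < \dim {:H}) (f e`_i : K) *: dual_basis e i.
    apply/lfunP=> x; rewrite {1}(coord_vbasis (memvf x)) linear_sum sum_lfunE.
    apply: eq_bigr => i _; rewrite linearZ scale_lfunE dual_basisE.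
    exact: mulrC.
  rewrite [in RHS]fE (linear_of_sum (lin_tmul_l _ (@lin_id _ _))).
  apply: eq_bigr => i _; rewrite /dbl_ev tsum_tmul; last by split=> ?; lin_tac.
  by rewrite (linear_of_scale (lin_tmul_r _ (@lin_id _ _))).
move=> dd'; rewrite -[d]GE -[d']GE; apply: eq_bigr => i _; by rewrite dd'.
Qed.

Lemma dbl_ev_mul d d' y :
  dbl_ev (dbl_mul d d') y =
  \tsum_(y1 \otimes y2 <- comul y)
  \tsum_(h1 \otimes h23 <- comul (dbl_ev d y1))
  \tsum_(h2 \otimes h3 <- comul h23)
    h2 * dbl_ev d' (antipode_inv H h3 * (y2 * h1)).
Proof.
rewrite /dbl_mul (lin_tsumE (dbl_ev_linear y)).
transitivity (\tsum_(phi \otimes h <- d) \tsum_(y1 \otimes y2 <- comul y)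
  (phi y1 : K) *: \tsum_(h1 \otimes h23 <- comul h)
  \tsum_(h2 \otimes h3 <- comul h23)
    (h2 * dbl_ev d' (antipode_inv H h3 * (y2 * h1)))); last first.
  rewrite tsum_exchange; apply: eq_tsum => y1 y2.
  have lE : linear (fun h : H => \tsum_(h1 \otimes h23 <- comul h)
      \tsum_(h2 \otimes h3 <- comul h23)
        (h2 * dbl_ev d' (antipode_inv H h3 * (y2 * h1)))).
    apply: lin_tsum_l; last by lin_tac.
    split=> x; first by rewrite /dbl_ev; lin_tac.
    by rewrite /dbl_ev; lin_tac.
  rewrite [in RHS]/dbl_ev (lin_tsumE lE); apply: eq_tsum => phi h.
  by rewrite (linear_of_scale lE).
apply: eq_tsum => phi h; rewrite (lin_tsumE (dbl_ev_linear y)).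
transitivity (\tsum_(y1 \otimes y2 <- comul y) \tsum_(phi' \otimes h' <- d')
  (phi y1 : K) *: \tsum_(h1 \otimes h23 <- comul h)
  \tsum_(h2 \otimes h3 <- comul h23)
    (phi' (antipode_inv H h3 * (y2 * h1)) : K) *: (h2 * h')); last first.
  apply: eq_tsum => y1 y2; rewrite -tsum_scaler; congr (_ *: _).
  rewrite tsum_exchange; apply: eq_tsum => h1 h23.
  rewrite tsum_exchange; apply: eq_tsum => h2 h3.
  rewrite /dbl_ev.
  have lm : linear (fun x : H => h2 * x) by lin_tac.
  rewrite (lin_tsumE lm); apply: eq_tsum => phi' h'.
  by rewrite scalerAr.
rewrite tsum_exchange; apply: eq_tsum => phi' h'.
rewrite (lin_tsumE (dbl_ev_linear y)).
under [RHS]eq_tsum do rewrite tsum_scaler.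
rewrite [RHS]tsum_exchange; apply: eq_tsum => h1 h23.
rewrite (lin_tsumE (dbl_ev_linear y)).
under [RHS]eq_tsum do rewrite tsum_scaler.
rewrite [RHS]tsum_exchange; apply: eq_tsum => h2 h3.
rewrite (lin_tsumE (dbl_ev_linear y)).
transitivity (\tsum_(y1 \otimes y2 <- comul y)
  \tsum_(phi1 \otimes phi23 <- dual_comul phi')
   (phi y1 * (phi1 (antipode_inv H h3) * phi23 (y2 * h1)) : K) *: (h2 * h')).
  rewrite tsum_exchange; apply: eq_tsum => phi1 phi23.
  rewrite (lin_tsumE (dbl_ev_linear y)).
  transitivity (\tsum_(y1 \otimes y2 <- comul y)
    \tsum_(phi2 \otimes phi3 <- dual_comul phi23)
     (phi y1 * (phi1 (antipode_inv H h3) * (phi2 y2 * phi3 h1)) : K)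
        *: (h2 * h')); last first.
    apply: eq_tsum => y1 y2; rewrite -dual_comulE.
    have lc : linear (fun x : K^o =>
       (phi y1 * (phi1 (antipode_inv H h3) * (x : K)) : K) *: (h2 * h')).
      by apply: lin_scale_l; apply: lin_kmul_r; apply: lin_kmul_r; exact: lin_id.
    by rewrite (lin_tsumE lc).
  rewrite tsum_exchange; apply: eq_tsum => phi2 phi3.
  rewrite (linear_of_scale (dbl_ev_linear y)) /dbl_ev.
  rewrite tsum_tmul; last by split=> ?; lin_tac.
  rewrite dual_mulE.
  have lc : linear (fun x : K^o =>
    (phi1 (antipode_inv H h3) * phi3 h1) *: ((x : K) *: (h2 * h'))).
    by apply: lin_scale_r; apply: lin_scale_l; exact: lin_id.
  rewrite (lin_tsumE lc); apply: eq_tsum => y1 y2.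
  rewrite scalerA; congr (_ *: _).
  by rewrite mulrCA -!mulrA [phi3 _ * _]mulrC !mulrA [phi y1 * _]mulrC.
apply: eq_tsum => y1 y2.
have lc : linear (fun x : K^o => (phi y1 : K) *: ((x : K) *: (h2 * h'))).
  by apply: lin_scale_r; apply: lin_scale_l; exact: lin_id.
rewrite -dual_comulE (lin_tsumE lc); apply: eq_tsum => phi1 phi23.
by rewrite scalerA.
Qed.

Section Inverse.
Variables (n : nat) (b : n.-tuple H).
Hypothesis basis_b : basis_of {:H} b.

Lemma dbl_ev_basis (f : 'End(H)) y :
  dbl_ev (\sum_(i < n) ((dual_basis b i \o f)%VF \otimes b`_i)) y = f y.
Proof.
under eq_bigr do rewrite -[_ \otimes _]scale1r.
rewrite (linear_of_sum (dbl_ev_linear y)).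
rewrite [RHS](coord_basis basis_b (memvf _)); apply: eq_bigr => i _.
rewrite scale1r /dbl_ev tsum_tmul; last by split=> ?; lin_tac.
by rewrite comp_lfunE dual_basisE.
Qed.

Lemma dbl_ev_one y : dbl_ev (dbl_one H) y = (counit y : K) *: (1 : H).
Proof.
by rewrite /dbl_ev tsum_tmul; [rewrite lfunE | split=> ?; lin_tac].
Qed.

Hypothesis antipode_inj : lker (linfun (@antipode K H)) == 0%VS.

Let SK h : antipode_inv H (S h) = h.
Proof. by have := lker0_lfunK antipode_inj h; rewrite lfunE. Qed.

Let SVK h : S (antipode_inv H h) = h.
Proof. by have := lker0_lfunVK antipode_inj h; rewrite lfunE. Qed.

Let SVM g h :
  antipode_inv H (g * h) = antipode_inv H h * antipode_inv H g.
Proof. by rewrite -{1}[g]SVK -{1}[h]SVK -antipodeM SK. Qed.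

Let SV1 : antipode_inv H 1 = 1.
Proof. by rewrite -{1}antipode1 SK. Qed.

Lemma drinfeld_mulV : dbl_mul (drinfeld b) (drinfeld_inv b) = dbl_one H.
Proof.
apply: dbl_ev_inj => y; rewrite dbl_ev_mul dbl_ev_one.
transitivity (\tsum_(y1 \otimes y2 <- comul y) S (y1 * S y2)); last first.
  have lm : linear (fun x : H => S x) by lin_tac.
  by rewrite -(lin_tsumE lm) antipode_r linearZ /= antipode1.
apply: eq_tsum => y1 y2; rewrite dbl_ev_basis.
set h := antipode_inv H y1.
transitivity (\tsum_(h1 \otimes h23 <- comul h)
  \tsum_(h2 \otimes h3 <- comul h23) (h2 * S h3) * (S (S y2) * S (S h1))).
  apply: eq_tsum => h1 h23; apply: eq_tsum => h2 h3.
  by rewrite dbl_ev_basis comp_lfunE !lfunE /= !antipodeM SVK !mulrA.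
transitivity (\tsum_(h1 \otimes h2 <- comul h)
  (S (S y2) * S (S ((counit h2 : K) *: h1)))).
  apply: eq_tsum => h1 h23.
  have lm : linear (fun x : H => x * (S (S y2) * S (S h1))) by lin_tac.
  by rewrite -(lin_tsumE lm) antipode_r !linearZ /= -scalerAl mul1r -scalerAr.
have lm : linear (fun x : H => S (S y2) * S (S x)) by lin_tac.
by rewrite -(lin_tsumE lm) counit_comul_r /h SVK antipodeM.
Qed.

Lemma drinfeld_mulVl : dbl_mul (drinfeld_inv b) (drinfeld b) = dbl_one H.
Proof.
apply: dbl_ev_inj => y; rewrite dbl_ev_mul dbl_ev_one.
transitivity (\tsum_(y1 \otimes y2 <- comul y) antipode_inv H (S y1 * y2)); last first.
  have lm : linear (fun x : H => antipode_inv H x) by lin_tac.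
  by rewrite -(lin_tsumE lm) antipode_l linearZ /= SV1.
apply: eq_tsum => y1 y2; rewrite dbl_ev_basis comp_lfunE !lfunE /=.
set h := S (S y1).
pose T := antipode_inv H.
pose F (x y z : H) := y * (T x * (T y2 * T (T z))).
transitivity (\tsum_(h1 \otimes h23 <- comul h)
  \tsum_(h2 \otimes h3 <- comul h23) F h1 h2 h3).
  apply: eq_tsum => h1 h23; apply: eq_tsum => h2 h3.
  by rewrite dbl_ev_basis !SVM /F /T !mulrA.
rewrite -comul_assoc_sum; try by move=> *; rewrite /F; lin_tac.
transitivity (\tsum_(h1 \otimes h2 <- comul h)
  (T y2 * T (T ((counit h1 : K) *: h2)))).
  apply: eq_tsum => h12 h3.
  have lm : linear (fun x : H => T x * (T y2 * T (T h3))) by lin_tac.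
  rewrite !linearZ /= -scalerAr -[T y2 * _]mul1r scalerAl.
  rewrite -[in RHS]SV1 -[in RHS]linearZ -antipode_r.
  rewrite (lin_tsumE lm); apply: eq_tsum => x z.
  by rewrite SVM SK /F !mulrA.
have lm : linear (fun x : H => T y2 * T (T x)) by lin_tac.
by rewrite -(lin_tsumE lm) counit_comul_l /h /T !SK SVM SK.
Qed.

End Inverse.

End DrinfeldInverse.

Section HtensScale.
Variables (K : fieldType) (H : hopfType K) (V W : lmodType H).

(* The two K-structures on V (x) W agree. *)
Lemma restr_htens_scaleE (k : K) (t : tens (restr V) (restr W)) :
  k *: (t : restr (htens V W)) = k *: t.
Proof.
rewrite restr_scaleE -[LHS]/(diag_act k%:A t).
have -> : diag_act k%:A t = k *: diag_act 1 t.
  have := diag_act_linl t k 1 0.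
  have h0 : diag_act 0 t = 0.
    have := diag_act_linl t 1 0 0; rewrite !scale1r addr0 => h0.
    by apply: (addrI (diag_act 0 t)); rewrite -[LHS]h0 addr0.
  by rewrite addr0 h0 addr0.
by rewrite diag_act1.
Qed.

Lemma lin_to_restr_htens (X : lmodType K) (g : X -> tens (restr V) (restr W)) :
  linear g -> linear (g : X -> restr (htens V W)).
Proof. by move=> lg a x y; rewrite restr_htens_scaleE lg. Qed.

End HtensScale.

Section Beta.
Variables (K : fieldType) (H : hopfType K) (n : nat) (b : n.-tuple H).
Variables (V W : lmodType H).

Lemma betaE (phi : 'Hom(H, K^o)) (v : V) (w : W) :
  beta b V W (phi \otimes ((v : restr V) \otimes (w : restr W) : restr (htens V W)))
  = \sum_(i < n) (dual_mul phi (dual_basis b i) \otimes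
      ((w : restr W) \otimes (b`_i *: v : restr V) : restr (htens W V))).
Proof.
have bil (phi' : 'Hom(H, K^o)) : is_bilinear (fun (v : restr V) (w : restr W) =>
   \sum_(i < n) (dual_mul phi' (dual_basis b i) \otimes
      (w \otimes hact b`_i v : restr (htens W V)))).
  by split=> ? /=; apply: lin_sum => i; apply: lin_tmul_r;
    apply: lin_to_restr_htens; lin_tac.
rewrite /beta tsum_tmul; first by rewrite tsum_tmul.
split=> [t|p]; last first.
  move=> a x y; rewrite restr_htens_scaleE; apply: tsum_linear; exact: bil.
apply: lin_tsum_r => v' w'; apply: lin_sum => i; apply: lin_tmul_l.
by apply: lin_dual_mul_l; lin_tac.
Qed.

Lemma beta_invE (phi : 'Hom(H, K^o)) (w : W) (v : V) :
  beta_inv b V W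
    (phi \otimes ((w : restr W) \otimes (v : restr V) : restr (htens W V)))
  = \sum_(i < n) (dual_mul phi (dual_basis b i) \otimes
      ((antipode b`_i *: v : restr V) \otimes (w : restr W)
        : restr (htens V W))).
Proof.
have bil (phi' : 'Hom(H, K^o)) : is_bilinear (fun (w : restr W) (v : restr V) =>
   \sum_(i < n) (dual_mul phi' (dual_basis b i) \otimes
      (hact (antipode b`_i) v \otimes w : restr (htens V W)))).
  by split=> ? /=; apply: lin_sum => i; apply: lin_tmul_r;
    apply: lin_to_restr_htens; lin_tac.
rewrite /beta_inv tsum_tmul; first by rewrite tsum_tmul.
split=> [t|p]; last first.
  move=> a x y; rewrite restr_htens_scaleE; apply: tsum_linear; exact: bil.
apply: lin_tsum_r => v' w'; apply: lin_sum => i; apply: lin_tmul_l.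
by apply: lin_dual_mul_l; lin_tac.
Qed.

End Beta.

Ltac lin_dual_tac :=
  repeat first
  [ progress lin_tac | apply: lin_dual_mul_l | apply: lin_dual_mul_r ].

Lemma dbl_mulE (K : fieldType) (H : hopfType K) (phi phi' : 'Hom(H, K^o))
    (h h' : H) :
  dbl_mul (phi \otimes h : double H) (phi' \otimes h' : double H) =
  \tsum_(h1 \otimes h23 <- comul h) \tsum_(h2 \otimes h3 <- comul h23)
  \tsum_(phi1 \otimes phi23 <- dual_comul phi')
  \tsum_(phi2 \otimes phi3 <- dual_comul phi23)
    (phi1 (antipode_inv H h3) * phi3 h1 : K) *:
      (dual_mul phi phi2 \otimes (h2 * h')).
Proof.
rewrite /dbl_mul tsum_tmul; first rewrite tsum_tmul //.
  by split=> ? /=; lin_dual_tac.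
by split=> ? /=; lin_dual_tac.
Qed.

Lemma ind_actE (K : fieldType) (H : hopfType K) (U : lmodType H)
    (phi phi' : 'Hom(H, K^o)) (h : H) (u : U) :
  ind_act (phi \otimes h : double H) (phi' \otimes (u : restr U) : Ind U) =
  \tsum_(h1 \otimes h23 <- comul h) \tsum_(h2 \otimes h3 <- comul h23)
  \tsum_(phi1 \otimes phi23 <- dual_comul phi')
  \tsum_(phi2 \otimes phi3 <- dual_comul phi23)
    (phi1 (antipode h3) * phi3 h1 : K) *:
      (dual_mul phi phi2 \otimes (h2 *: u : restr U)).
Proof.
rewrite /ind_act tsum_tmul; first rewrite tsum_tmul //.
  by split=> ? /=; lin_dual_tac.
by split=> ? /=; lin_dual_tac.
Qed.

(* Main.v *)
Require Import Defs.
From HB Require Import structures.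
From mathcomp Require boolp.
From mathcomp Require Import all_boot all_order all_algebra all_field.
From mathcomp Require Import zify cyclic falgebra.
Import Order.TTheory GRing.Theory Num.Theory.
Local Open Scope ring_scope.

Set Implicit Arguments.
Unset Strict Implicit.
Unset Printing Implicit Defensive.

(* Identify x in Ind(U) with the map ev x : H -> U.  Then
     ev (beta x) y = tau ((y_2 (x) 1) . ev x y_1),
   and D-linearity holds because the factors h_4 S(h_5) produced by
   Delta(S h_3) cancel.  The formulas for the inverse and for beta o beta
   hold because S^2 = id, which is the theorem of Larson and Radford:

   Let L be the two-sided integral with eps L = 1 and
   lam h = Tr (x |-> h S^2 x).  Then lam is an integral with lam L = 1 and
   Nakayama automorphism S^2, and evaluating lam (S(h) L_1) L_2 in two ways
   shows that S^4 is conjugation by the group-like g = lam(L_1) L_2, which has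
   finite order.
   As the trace form of H is nondegenerate, Tr (h .) = lam (h w) for an
   invertible w; it induces S^2 by conjugation, z = w^2 g^-1 is central, and
   Tr (w x .) = Tr (x .) for central x.  Hence on each eigenspace of z, of
   dimension m and eigenvalue s, we have w = sqrt s * v with v of finite order
   and m = sqrt s * Tr v, so that Tr (w^-1) = Tr v * Tr (v^-1) / m is a
   positive multiple of a squared absolute value of a cyclotomic number.
   Summing up, lam 1 = Tr (w^-1) is nonzero; this forces g = 1 and S^4 = id.
   Finally the element c of H representing the regular character of H^*
   satisfies c^2 = n c, S^2 c = c and lam c = lam 1, i.e. with E = c / n,
   n Tr (E S^2) = Tr (S^2) <> 0.  Both traces are integers and
   |Tr (S^2)| <= n, hence S^2 = +1 or -1, and S^2 1 = 1. *)

(** * Sweedler calculus *)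

Ltac bil_tac := split=> ?; lin_dual_tac.

Lemma lin_comp (K : fieldType) (X U V : lmodType K) (f : U -> V) (g : X -> U) :
  linear f -> linear g -> linear (fun x => f (g x)).
Proof. by move=> lf lg a x y; rewrite lg lf. Qed.

Lemma tsum_tsum (K : fieldType) (U V U' V' W : lmodType K) (t : tens U V)
    (F : U -> V -> tens U' V') (G : U' -> V' -> W) : is_bilinear G ->
  tsum (tsum t F) G = tsum t (fun u v => tsum (F u v) G).
Proof. by move=> bG; exact: (lin_tsumE (f :=
  fun t => tsum t G) (tsum_linear bG)). Qed.

Section Sweedler.
Variables (K : fieldType) (H : hopfType K).
Local Notation S := (@antipode K H).
Implicit Types (U : lmodType K) (g h x y : H).

Lemma comul_counitl U (f : H -> U) h : linear f ->
  \tsum_(h1 \otimes h2 <- comul h) (counit h1 : K) *: f h2 = f h.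
Proof.
move=> lf; rewrite -[in RHS](counit_comul_l h) (lin_tsumE lf).
by apply: eq_tsum => h1 h2; rewrite (linear_of_scale lf).
Qed.

Lemma comul_counitr U (f : H -> U) h : linear f ->
  \tsum_(h1 \otimes h2 <- comul h) (counit h2 : K) *: f h1 = f h.
Proof.
move=> lf; rewrite -[in RHS](counit_comul_r h) (lin_tsumE lf).
by apply: eq_tsum => h1 h2; rewrite (linear_of_scale lf).
Qed.

Lemma comul_antipodel U (f : H -> U) h : linear f ->
  \tsum_(h1 \otimes h2 <- comul h) f (S h1 * h2) = (counit h : K) *: f 1.
Proof.
by move=> lf; rewrite -(lin_tsumE lf) antipode_l (linear_of_scale lf).
Qed.

Lemma comul_antipoder U (f : H -> U) h : linear f ->
  \tsum_(h1 \otimes h2 <- comul h) f (h1 * S h2) = (counit h : K) *: f 1.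
Proof.
by move=> lf; rewrite -(lin_tsumE lf) antipode_r (linear_of_scale lf).
Qed.

Lemma tsum_comulM U (F : H -> H -> U) g h : is_bilinear F ->
  \tsum_(x \otimes y <- comul (g * h)) F x y =
  \tsum_(g1 \otimes g2 <- comul g) \tsum_(h1 \otimes h2 <- comul h)
    F (g1 * h1) (g2 * h2).
Proof.
move=> bF; rewrite comulM.
have lF : linear (fun t : tens H H => tsum t F) by exact: tsum_linear.
rewrite (lin_tsumE lF); apply: eq_tsum => g1 g2.
by rewrite (lin_tsumE lF); apply: eq_tsum => h1 h2; rewrite tsum_tmul.
Qed.

(** Apply the counit to the antipode axiom: eps(S h_1) eps(h_2) = eps(h). *)
Lemma counit_antipode h : counit (S h) = counit h.
Proof.
have lc : linear (fun x : H => counit x : K^o) by lin_tac.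
rewrite -(comul_counitr h (f := fun x => counit (S x) : K^o)); last by lin_tac.
have := comul_antipodel h lc; rewrite counit1 => e.
transitivity ((counit h : K) *: (1 : K^o)); last exact: mulr1.
rewrite -e; apply: eq_tsum => h1 h2; rewrite counitM; exact: mulrC.
Qed.

(** Both sides are convolution inverses of [comul] among the linear maps from H to H (x) H, and a
    left inverse agrees with a right inverse. *)
Lemma comul_antipode h :
  comul (S h) = \tsum_(h1 \otimes h2 <- comul h) (S h2 \otimes S h1).
Proof.
pose rm (t : tens H H) (a b : H) : tens H H :=
  \tsum_(x \otimes y <- t) ((x * a) \otimes (y * b)).
have rmE x y a b : rm (x \otimes y) a b = (x * a) \otimes (y * b).
  by rewrite /rm tsum_tmul //; bil_tac.
have rml a b : linear (fun t => rm t a b) by rewrite /rm; lin_tac.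
have rmT (t : tens H H) (F : H -> H -> tens H H) a b : rm (tsum t F) a b =
  tsum t (fun u v : H => rm (F u v) a b).
  exact: (lin_tsumE (rml a b) t F).
pose G (x y z t : H) : tens H H := (x * S t) \otimes (y * S z).
(* The right-hand side is a right convolution inverse of [comul]: the inner pair k_2 S(k_3)
   contracts first, then k_1 S(k_2). *)
have E k : \tsum_(k1 \otimes k2 <- comul k)
    \tsum_(k11 \otimes k12 <- comul k1) \tsum_(k21 \otimes k22 <- comul k2)
     G k11 k12 k21 k22 = (counit k : K) *: (1 \otimes 1).
  have e1 : linear (fun x : H => x \otimes (1 : H)) by lin_tac.
  rewrite -(comul_antipoder k e1).
  rewrite (comul_assoc_sum (F :=
    fun k1 k2 k3 => \tsum_(k31 \otimes k32 <- comul k3) G k1 k2 k31 k32)); try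
    by move=> *; rewrite /G; lin_tac.
  apply: eq_tsum => k1 k2.
  rewrite -(comul_assoc_sum (F := fun x y z => G k1 x y z)); try by move=> *;
    rewrite /G; lin_tac.
  have e2 : linear (fun x : H => (k1 * S x) \otimes (1 : H)) by lin_tac.
  rewrite -(comul_counitl k2 e2); apply: eq_tsum => x y.
  have e3 : linear (fun z : H => (k1 * S y) \otimes z) by lin_tac.
  by rewrite -(comul_antipoder x e3).
have lS : linear (fun x : H => comul (S x)) by lin_tac.
rewrite -(comul_counitr h lS).
(* Multiply comul(S h_1) by the unit, written through [E]. Regrouping then exposes comul(S x_1)
   comul(x_2), which contracts because [comul] is multiplicative. *)
transitivity (\tsum_(h1 \otimes h2 <- comul h) \tsum_(k1 \otimes k2 <- comul h2)
    \tsum_(k11 \otimes k12 <- comul k1) \tsum_(k21 \otimes k22 <- comul k2)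
     rm (comul (S h1)) (k11 * S k22) (k12 * S k21)).
  apply: eq_tsum => h1 h2.
  pose L t : tens H H := \tsum_(a \otimes b <- t) rm (comul (S h1)) a b.
  have bL : is_bilinear (rm (comul (S h1))) by rewrite /rm; bil_tac.
  have lL : linear L by apply: tsum_linear.
  have <- : L ((counit h2 : K) *: (1 \otimes 1)) = (counit h2 : K) *: comul (S h1).
    rewrite (linear_of_scale lL) /L tsum_tmul //; congr (_ *: _).
    by rewrite /rm [RHS]tens_span; apply: eq_tsum => a b; rewrite !mulr1.
  rewrite -E (lin_tsumE lL); apply: eq_tsum => k1 k2.
  rewrite (lin_tsumE lL); apply: eq_tsum => k11 k12.
  rewrite (lin_tsumE lL); apply: eq_tsum => k21 k22.
  by rewrite /L tsum_tmul.
rewrite -(comul_assoc_sum (F := fun h1 k1 k2 => 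
    \tsum_(k11 \otimes k12 <- comul k1) \tsum_(k21 \otimes k22 <- comul k2)
     rm (comul (S h1)) (k11 * S k22) (k12 * S k21))); try by move=> *;
       rewrite /rm; lin_tac.
have lSS : linear (fun k :
  H => \tsum_(k1 \otimes k2 <- comul k) (S k2 \otimes S k1)) by lin_tac.
rewrite -(comul_counitl h lSS); apply: eq_tsum => x y.
transitivity (\tsum_(y1 \otimes y2 <- comul y) \tsum_(x1 \otimes x2 <- comul x)
   rm (comul (S x1 * x2)) (S y2) (S y1)).
  rewrite tsum_exchange; apply: eq_tsum => x1 x2.
  rewrite tsum_exchange; apply: eq_tsum => y1 y2.
  rewrite comulM rmT.
  transitivity (\tsum_(c \otimes d <- comul x2) \tsum_(a \otimes b <- comul (S x1))
     ((a * (c * S y2)) \otimes (b * (d * S y1)))); first by [].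
  rewrite tsum_exchange; apply: eq_tsum => a b.
  by rewrite rmT; apply: eq_tsum => c d; rewrite rmE !mulrA.
rewrite tsum_scaler; apply: eq_tsum => y1 y2.
have lr : linear (fun x : H => rm (comul x) (S y2) (S y1)) by rewrite /rm; lin_tac.
by rewrite (comul_antipodel x lr) comul1 rmE !mul1r.
Qed.

Lemma tsum_comul_antipode U (F : H -> H -> U) h : is_bilinear F ->
  \tsum_(x \otimes y <- comul (S h)) F x y =
  \tsum_(h1 \otimes h2 <- comul h) F (S h2) (S h1).
Proof.
move=> bF; rewrite comul_antipode.
have lF : linear (fun t : tens H H => tsum t F) by exact: tsum_linear.
by rewrite (lin_tsumE lF); apply: eq_tsum => h1 h2; rewrite tsum_tmul.
Qed.

Lemma tsum_comul_antipode2 U (F : H -> H -> U) h : is_bilinear F ->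
  \tsum_(x \otimes y <- comul (S (S h))) F x y =
  \tsum_(h1 \otimes h2 <- comul h) F (S (S h1)) (S (S h2)).
Proof.
move=> bF; rewrite tsum_comul_antipode // tsum_comul_antipode //.
by split=> u; [apply: (lin_comp (bF.2 _)) | apply: (lin_comp (bF.1 _))];
  exact: linearP.
Qed.

End Sweedler.

(** * Traces *)

Section Trace.
Variables (K : fieldType) (A : vectType K).
Local Notation n := (\dim {:A}).
Local Notation e := (vbasis {:A}).

(** The rows are the images of basis vectors, so composition reverses the order of matrix products.
    Linearity of [f] is left to the lemmas, so that Sweedler sums can be plugged in as plain
    functions. *)
Definition lmx (f : A -> A) : 'M[K]_n := \matrix_(i, j) coord e j (f e`_i).
Definition ltrace (f : A -> A) : K := \tr (lmx f).

Lemma ltraceE f : ltrace f = \sum_(i < n) coord e i (f e`_i).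
Proof. by apply: eq_bigr => i _; rewrite mxE. Qed.

Lemma eq_lmx f g : f =1 g -> lmx f = lmx g.
Proof. by move=> fg; apply/matrixP=> i j; rewrite !mxE fg. Qed.

Lemma eq_ltrace f g : f =1 g -> ltrace f = ltrace g.
Proof. by move=> fg; rewrite /ltrace (eq_lmx fg). Qed.

Lemma linear_coordE (U : lmodType K) (f : A -> U) x : linear f ->
  f x = \sum_(i < n) coord e i x *: f e`_i.
Proof.
by move=> lf; rewrite [in LHS](coord_vbasis (memvf x)) (linear_of_sum lf).
Qed.

Lemma lmx_comp f g : linear f -> lmx (fun x => f (g x)) = lmx g *m lmx f.
Proof.
move=> lf; apply/matrixP=> i j; rewrite !mxE.
by rewrite (linear_coordE _ lf) linear_sum; apply: eq_bigr => k _;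
  rewrite linearZ !mxE.
Qed.

Lemma lmx_id : lmx id = 1%:M.
Proof.
apply/matrixP=> i j; rewrite !mxE coord_free 1?eq_sym //.
exact: (basis_free (vbasisP _)).
Qed.

Lemma lmx_linear a f g : lmx (fun x => a *: f x + g x) = a *: lmx f + lmx g.
Proof. by apply/matrixP=> i j; rewrite !mxE linearD linearZ. Qed.

Lemma lmxZ a f : lmx (fun x => a *: f x) = a *: lmx f.
Proof. by apply/matrixP=> i j; rewrite !mxE linearZ. Qed.

Lemma lmx_inj f g : linear f -> linear g -> lmx f = lmx g -> f =1 g.
Proof.
move=> lf lg fg x; rewrite (linear_coordE x lf) (linear_coordE x lg).
apply: eq_bigr => i _; congr (_ *: _).
rewrite (coord_vbasis (memvf (f _))) (coord_vbasis (memvf (g _))).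
by apply: eq_bigr => j _; have /matrixP/(_ i j) := fg; rewrite !mxE => ->.
Qed.

Lemma ltraceC f g : linear f -> linear g ->
  ltrace (fun x => f (g x)) = ltrace (fun x => g (f x)).
Proof. by move=> lf lg;
  rewrite /ltrace (lmx_comp g lf) (lmx_comp f lg) mxtrace_mulC. Qed.

Lemma ltrace_linear a f g :
  ltrace (fun x => a *: f x + g x) = a * ltrace f + ltrace g.
Proof. by rewrite /ltrace lmx_linear mxtraceD mxtraceZ. Qed.

Lemma lin_ltrace (X : lmodType K) (f : X -> A -> A) :
  (forall z, linear (f^~ z)) -> linear (fun x => ltrace (f x) : K^o).
Proof.
move=> lf a x y; transitivity (ltrace (fun z => a *: f x z + f y z)); last first.
  by rewrite ltrace_linear.
by apply: eq_ltrace => z; apply: lf.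
Qed.

Lemma ltrace_tsum (U V : lmodType K) (t : tens U V) (f : U -> V -> A -> A) :
  ltrace (fun x => \tsum_(u \otimes v <- t) f u v x) =
  \tsum_(u \otimes v <- t) (ltrace (f u v) : K^o).
Proof.
rewrite ltraceE /tsum; under eq_bigr do rewrite linear_sum.
by rewrite exchange_big; apply: eq_bigr => p _; rewrite ltraceE.
Qed.

Lemma ltrace_rank1 (p : A -> K^o) u : linear p ->
  ltrace (fun x => (p x : K) *: u) = p u.
Proof.
move=> lp; rewrite ltraceE (linear_coordE _ lp); apply: eq_bigr => i _.
by rewrite linearZ /= mulrC.
Qed.

(** Cyclicity of the trace for endomorphisms with coefficients in [B]. Expanding the intermediate
    vector in the basis makes either side a double sum over matrix entries, the coefficients being
    combined in the order f, g on both sides. *)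
Lemma ltrace_cyc (B U : lmodType K) (f g : A -> tens A B) (m : B -> B -> U) :
  linear f -> linear g -> is_bilinear m ->
  \sum_(i < n) \tsum_(x \otimes k <- f e`_i) \tsum_(y \otimes l <- g x)
    coord e i y *: m k l =
  \sum_(i < n) \tsum_(y \otimes l <- g e`_i) \tsum_(x \otimes k <- f y)
    coord e i x *: m k l.
Proof.
move=> lf lg bm.
have lm1 l : linear (m^~ l) by exact: bm.1.
have lm2 k : linear (m k) by exact: bm.2.
have lci i : linear (fun y : A => coord e i y : K^o) by move=> a x y;
  rewrite linearD linearZ.
transitivity (\sum_(i < n) \sum_(j < n) 
   \tsum_(x \otimes k <- f e`_i) \tsum_(y \otimes l <- g e`_j)
    (coord e j x * coord e i y : K) *: m k l).
  apply: eq_bigr => i _; rewrite /tsum exchange_big; apply: eq_bigr => p _ /=.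
  pose G x := \tsum_(y \otimes l <- g x) coord e i y *: m p.2 l.
  have lG : linear G.
    apply: lin_tsum_l => //; split=> z.
      by apply: (lin_scale_l (g := fun y : A => coord e i y : K^o)).
    by apply: lin_scale_r.
  rewrite -[LHS]/(G p.1) (linear_coordE p.1 lG); apply: eq_bigr => j _.
  rewrite /G tsum_scaler /tsum; apply: eq_bigr => q _ /=; by rewrite scalerA.
rewrite [LHS]exchange_big /=; apply: eq_bigr => i _.
transitivity (\tsum_(y \otimes l <- g e`_i) \sum_(j < n) \tsum_(x \otimes k <- f e`_j)
    (coord e i x * coord e j y) *: m k l).
  rewrite [in RHS]/tsum [RHS]exchange_big; apply: eq_bigr => j _;
    by rewrite tsum_exchange.
apply: eq_tsum => y l.
pose G y := \tsum_(x \otimes k <- f y) coord e i x *: m k l.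
have lG : linear G.
  apply: lin_tsum_l => //; split=> z; last by apply: lin_scale_r.
  by apply: (lin_scale_l (g := fun y : A => coord e i y : K^o)).
rewrite -[RHS]/(G y) (linear_coordE y lG); apply: eq_bigr => j _.
by rewrite /G tsum_scaler; apply: eq_tsum => x k; rewrite scalerA mulrC.
Qed.

End Trace.

(** A full-rank factorisation E = C R of an idempotent satisfies R C = 1, an identity matrix whose
    size is the rank. *)
Lemma idempotent_mxtrace (K : fieldType) n (E : 'M[K]_n) :
  E *m E = E -> \tr E = (\rank E)%:R.
Proof.
move=> EE.
have e1 : row_base E *m col_base E = 1%:M.
  have h : col_base E *m row_base E *m (col_base E *m row_base E) =
    col_base E *m row_base E by rewrite !mulmx_base.
  apply: (row_free_inj (row_base_free E)); rewrite /= mul1mx.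
  apply/trmx_inj; apply: (row_free_inj (A := (col_base E)^T)).
    by rewrite /row_free mxrank_tr; exact: col_base_full.
  by rewrite /= -!trmx_mul -h !mulmxA.
by rewrite -{1}(mulmx_base E) mxtrace_mulC e1 mxtrace1.
Qed.

(** * Semisimple algebras *)

Section Semisimple.
Variables (K : fieldType) (A : falgType K).
Hypothesis ssA : semisimple_alg A.

(** Split 1 = e + f along a complementary left ideal J. For x in I the element x - x e = x f lies in
    both I and J. *)
Lemma left_ideal_idem (I : {vspace A}) : ({:A} * I <= I)%VS ->
  exists2 e, e \in I & forall x, x \in I -> x * e = x.
Proof.
move=> lI; have [J [lJ IJ IJ0]] := ssA lI.
have /memv_addP[e eI [f fJ ef]] : 1 \in (I + J)%VS by rewrite IJ memvf.
exists e => // x xI; apply/esym/eqP; rewrite -subr_eq0 -memv0 -IJ0 memv_cap.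
have xf : x - x * e = x * f by rewrite -{1}[x]mulr1 ef mulrDr addrC addKr.
apply/andP; split; last first.
  by rewrite xf; apply: (subvP lJ); apply: memv_mul => //; apply: memvf.
rewrite rpredB //; apply: (subvP lI); apply: memv_mul => //; exact: memvf.
Qed.

(** Von Neumann regularity: the right identity of the left ideal A c has the form a c, and it fixes
    c. *)
Lemma principal_idem (c : A) : exists a, c * (a * c) = c.
Proof.
pose I := limg (amulr c).
have IP x : reflect (exists a, x = a * c) (x \in I).
  apply: (iffP memv_imgP) => [[a _ ->]|[a ->]]; exists a; rewrite ?memvf //.
    by rewrite lfunE.
  by rewrite lfunE.
have lI : ({:A} * I <= I)%VS.
  apply/prodvP => x y _ /IP[a ->]; apply/IP; exists (x * a); exact: mulrA.
have [e /IP[a ->] eI] := left_ideal_idem lI.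
by exists a; apply: eI; apply/IP; exists 1; rewrite mul1r.
Qed.

(** Iterating c = c a c with c central gives c = c a^m c^m for all m. *)
Lemma central_nilpotent_eq0 (c : A) k :
  (forall x, x * c = c * x) -> c ^+ k = 0 -> c = 0.
Proof.
move=> cC ck; have [a ca] := principal_idem c.
have H m : c * (a ^+ m * c ^+ m) = c.
  elim: m => [|m IH]; first by rewrite !mulr1.
  have cm : c ^+ m * (a * c) = a * c * c ^+ m.
    by apply/esym/commrX; exact: cC.
  by rewrite exprSr exprS -!mulrA [a * _]mulrA -cm !mulrA -(mulrA c) IH -mulrA.
by rewrite -(H k) ck !mulr0.
Qed.

Definition reg_trace (x : A) : K^o := ltrace (fun y => x * y).

Fact reg_trace_linear : linear reg_trace.
Proof. by apply: lin_ltrace => z; lin_tac. Qed.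

(* ltr, and lam below, are sealed: lin_sum would otherwise unfold them while
   lin_tac searches for linearity proofs. *)
Fact ltr_sig : {l : {linear A -> K^o} | forall x, l x = reg_trace x}.
Proof.
pose T : {linear A -> K^o} :=
  HB.pack reg_trace (GRing.isLinear.Build K A K^o _ _ reg_trace_linear).
by exists T.
Qed.

Definition ltr : {linear A -> K^o} := sval ltr_sig.

Lemma ltrE x : ltr x = ltrace (fun y => x * y).
Proof. exact: (svalP ltr_sig). Qed.

Lemma linear_lmul (x : A) : linear (fun y : A => x * y).
Proof. by move=> a y z; rewrite mulrDr -scalerAr. Qed.

Lemma ltrC x y : ltr (x * y) = ltr (y * x).
Proof.
rewrite !ltrE -(eq_ltrace (mulrA x y)) -(eq_ltrace (mulrA y x)).
by rewrite (ltraceC (linear_lmul x) (linear_lmul y)).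
Qed.

Lemma lmx_mul x y :
  lmx (fun z : A => (x * y) * z) = lmx (fun z : A => y * z) *m lmx (fun z :
    A => x * z).
Proof.
rewrite -(lmx_comp _ (linear_lmul x)); apply: eq_lmx => z; exact/esym/mulrA.
Qed.

Lemma lmx_mul_inj x y :
  lmx (fun z : A => x * z) = lmx (fun z : A => y * z) -> x = y.
Proof.
move/(lmx_inj (linear_lmul x) (linear_lmul y))/(_ 1); by rewrite !mulr1.
Qed.

(** Write x = x a x. The idempotent a x has trace equal to its rank, so in characteristic zero a
    vanishing trace makes it zero. *)
Lemma ltr_nondeg x : [pchar K] =i pred0 ->
  (forall y, ltr (y * x) = 0) -> x = 0.
Proof.
move=> ch0 Rx; have [a xa] := principal_idem x.
have ee : (a * x) * (a * x) = a * x by rewrite -mulrA xa.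
have := idempotent_mxtrace (esym (etrans (esym (congr1 (fun u => lmx (fun z :
  A => u * z)) ee)) (lmx_mul _ _))).
rewrite -/(ltrace _) -ltrE Rx => /esym/eqP.
rewrite ((pcharf0P K).1 ch0) mxrank_eq0 => /eqP l0.
have e0 : a * x = 0.
  apply: lmx_mul_inj; rewrite l0; apply/matrixP=> i j;
    by rewrite !mxE mul0r linear0.
by rewrite -xa e0 mulr0.
Qed.

End Semisimple.

(** * Integrals in a semisimple Hopf algebra *)

Section Integral.
Variables (K : fieldType) (H : hopfType K).
Hypothesis ssH : semisimple_alg H.

(** The defect y = L h - eps(h) L is a left integral with eps(y) = 0, so by regularity y = y a y =
    eps(a) eps(y) y = 0. *)
Lemma left_integral_right (L : H) : counit L = 1 ->
  (forall h, h * L = (counit h : K) *: L) ->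
  forall h, L * h = (counit h : K) *: L.
Proof.
move=> epsL lL h; apply/eqP; rewrite -subr_eq0; apply/eqP.
pose y := L * h - (counit h : K) *: L.
have ly a : a * y = (counit a : K) *: y.
  rewrite /y mulrBr mulrA -scalerAr !lL -scalerAl scalerBr !scalerA.
  by congr (_ - _ *: _); apply: mulrC.
have y0 : counit y = 0.
  by rewrite linearB linearZ /= counitM epsL mul1r [X in _ - X]mulr1 subrr.
have [a ya] := principal_idem ssH y.
by rewrite -/y -ya ly -scalerAr ly y0 scale0r scaler0.
Qed.

(** The kernel of the counit is a left ideal. If e is its right identity, then 1 - e is a left
    integral of counit 1. *)
Lemma integral_exists : exists L : H,
  [/\ counit L = 1, forall h, h * L = (counit h : K) *: L
    & forall h, L * h = (counit h : K) *: L].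
Proof.
pose ker := lker (linfun (@counit K H)).
have kerP x : (x \in ker) = (counit x == 0) by rewrite memv_ker lfunE.
have lk : ({:H} * ker <= ker)%VS.
  apply/prodvP=> x y _; rewrite !kerP counitM => /eqP ->; by rewrite mulr0.
have [e eker xe] := left_ideal_idem ssH lk.
move: eker; rewrite kerP => /eqP e0.
have eps1 k : counit (k *: (1 : H)) = k by rewrite linearZ /= counit1 [LHS]mulr1.
have epsL : counit (1 - e) = 1 :> K by rewrite linearB /= counit1 e0 subr0.
have lL h : h * (1 - e) = (counit h : K) *: (1 - e).
  have := xe (h - (counit h : K) *: 1);
    rewrite kerP linearB /= eps1 subrr eqxx => /(_ isT).
  have -> : (counit h : K) *: (1 - e) = ((counit h : K) *: 1) * (1 - e).
    by rewrite -scalerAl mul1r.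
  move=> he; apply/eqP; rewrite -subr_eq0 -mulrBl mulrBr mulr1.
  by rewrite he subrr.
by exists (1 - e); split=> // h; apply: left_integral_right.
Qed.

End Integral.

(** * The twisted trace *)

Section TwistedTrace.
Variables (K : fieldType) (H : hopfType K).
Local Notation S := (@antipode K H).
Implicit Types (U : lmodType K) (g h x y : H).

Definition twisted_trace (h : H) : K^o := ltrace (fun x => h * S (S x)).

Fact twisted_trace_linear : linear twisted_trace.
Proof. by apply: lin_ltrace => z; lin_tac. Qed.

Fact lam_sig : {l : {linear H -> K^o} | forall h, l h = twisted_trace h}.
Proof.
pose T : {linear H -> K^o} :=
  HB.pack twisted_trace (GRing.isLinear.Build K H K^o _ _ twisted_trace_linear).
by exists T.
Qed.

Definition lam : {linear H -> K^o} := sval lam_sig.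

Lemma lamE h : lam h = ltrace (fun x => h * S (S x)).
Proof. exact: (svalP lam_sig). Qed.

(** Trace the maps [f] and [g] below around a loop. With g after f the coefficient is h_1 S^2(b_2)
    S(b_1) = h_1 S(b_1 S(b_2)); with f after g it is b_1 S(b_2). Both collapse by the antipode
    axiom, and the S^2 in [lam] is what makes the first one do so. *)
Lemma lam_integral1 h :
  \tsum_(h1 \otimes h2 <- comul h) (lam h2 : K) *: h1 = (lam h : K) *: (1 : H).
Proof.
pose e := vbasis {:H}; pose n := \dim {:H}.
pose f (b : H) : tens H H :=
  \tsum_(b1 \otimes b2 <- comul b) ((h * S (S b2)) \otimes S b1).
pose g (x : H) : tens H H := \tsum_(x1 \otimes x2 <- comul x) (x2 \otimes x1).
pose m (k l : H) := l * k.
have lf : linear f by rewrite /f; lin_tac.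
have lg : linear g by rewrite /g; lin_tac.
have bm : is_bilinear m by rewrite /m; bil_tac.
have := ltrace_cyc lf lg bm; rewrite -/e -/n => cyc.
transitivity (\sum_(i < n) \tsum_(h1 \otimes h2 <- comul h)
   (coord e i (h2 * S (S e`_i)) : K) *: h1).
  rewrite [in RHS]/tsum exchange_big; apply: eq_bigr => p _ /=.
  by rewrite -scaler_suml lamE ltraceE.
transitivity (\sum_(i < n) \tsum_(x \otimes k <- f e`_i)
   \tsum_(y \otimes l <- g x) coord e i y *: m k l).
  apply: eq_bigr => i _; set b := e`_i.
  rewrite /f tsum_tsum; last by rewrite /g /m; bil_tac.
  transitivity (\tsum_(b1 \otimes b2 <- comul b) \tsum_(h1 \otimes h2 <- comul h)
     \tsum_(c1 \otimes c2 <- comul b2)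
     (coord e i (h2 * S (S c2)) : K) *: (h1 * S (b1 * S c1))); last first.
    apply: eq_tsum => b1 b2; rewrite tsum_tmul; last by rewrite /g /m; bil_tac.
    rewrite /g tsum_tsum; last by rewrite /m; bil_tac.
    transitivity (\tsum_(x1 \otimes x2 <- comul (h * S (S b2)))
       (coord e i x2 : K) *: (x1 * S b1)); last first.
      by apply: eq_tsum => x1 x2; rewrite tsum_tmul //; rewrite /m; bil_tac.
    rewrite tsum_comulM; last by bil_tac.
    apply: eq_tsum => h1 h2; rewrite tsum_comul_antipode2; last by bil_tac.
    by apply: eq_tsum => c1 c2; rewrite antipodeM mulrA.
  rewrite tsum_exchange; apply: eq_tsum => h1 h2.
  rewrite -(comul_assoc_sum (F := fun b1 c1 c2 =>
     (coord e i (h2 * S (S c2)) : K) *: (h1 * S (b1 * S c1)))); try by move=> *;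
       lin_tac.
  have l1 : linear (fun c => (coord e i (h2 * S (S c)) : K) *: h1) by lin_tac.
  rewrite -(comul_counitl b l1); apply: eq_tsum => b1 b2.
  have l2 : linear (fun c => (coord e i (h2 * S (S b2)) : K) *: (h1 * S c))
    by lin_tac.
  by rewrite (comul_antipoder b1 l2) antipode1 mulr1.
rewrite cyc lamE ltraceE scaler_suml; apply: eq_bigr => i _; set b := e`_i.
rewrite /g tsum_tsum; last by rewrite /f /m; bil_tac.
transitivity (\tsum_(b1 \otimes b2 <- comul b) \tsum_(c1 \otimes c2 <- comul b2)
   (coord e i (h * S (S c2)) : K) *: (b1 * S c1)).
  apply: eq_tsum => b1 b2; rewrite tsum_tmul; last by rewrite /f /m; bil_tac.
  rewrite /f tsum_tsum; last by rewrite /m; bil_tac.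
  by apply: eq_tsum => c1 c2; rewrite tsum_tmul //; rewrite /m; bil_tac.
rewrite -(comul_assoc_sum (F := fun b1 c1 c2 =>
     (coord e i (h * S (S c2)) : K) *: (b1 * S c1))); try by move=> *; lin_tac.
have l1 : linear (fun c => (coord e i (h * S (S c)) : K) *: (1 : H)) by lin_tac.
rewrite -(comul_counitl b l1); apply: eq_tsum => b1 b2.
have l2 : linear (fun c : H => (coord e i (h * S (S b2)) : K) *: c) by lin_tac.
by rewrite (comul_antipoder b1 l2).
Qed.

Lemma lam_integral U (f : H -> U) h : linear f ->
  \tsum_(h1 \otimes h2 <- comul h) (lam h2 : K) *: f h1 = (lam h : K) *: f 1.
Proof.
move=> lf; rewrite -(linear_of_scale lf) -lam_integral1 (lin_tsumE lf).
by apply: eq_tsum => h1 h2; rewrite (linear_of_scale lf).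
Qed.

(** Cyclicity of the trace carries left multiplication by x past S^2; thus S^2 is the Nakayama
    automorphism of [lam]. *)
Lemma lamC x y : lam (x * y) = lam (y * S (S x)).
Proof.
have l1 : linear (fun z => x * z) by lin_tac.
have l2 : linear (fun z => y * S (S z)) by lin_tac.
transitivity (ltrace (fun z : H => x * (y * S (S z)))).
  by rewrite lamE (eq_ltrace (g := fun z => x * (y * S (S z)))) // => z;
    rewrite mulrA.
rewrite (ltraceC l1 l2) lamE (eq_ltrace (g :=
  fun z => y * S (S x) * S (S z))) // => z.
by rewrite !antipodeM mulrA.
Qed.

(** Both sides equal the sum of lam(x_3 y_2) f(S(x_1) x_2 y_1): contracting S(x_1) x_2 gives the
    left one, and the integral property for x_2 y gives the right one. *)
Lemma lam_swap U (f : H -> U) x y : linear f ->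
  \tsum_(y1 \otimes y2 <- comul y) (lam (x * y2) : K) *: f y1 =
  \tsum_(x1 \otimes x2 <- comul x) (lam (x2 * y) : K) *: f (S x1).
Proof.
move=> lf.
have lfa (X : lmodType K) (k : X -> H) : linear k -> linear (fun a => f (k a))
  by move=> lk; exact: lin_comp.
pose F (a b c : H) := \tsum_(y1 \otimes y2 <- comul y)
  (lam (c * y2) : K) *: f (S a * (b * y1)).
have F1 b c : linear (fun a => F a b c).
  by apply: lin_tsum_r => ? ? /=; apply: lin_scale_r; apply: lfa; lin_tac.
have F2 a c : linear (fun b => F a b c).
  by apply: lin_tsum_r => ? ? /=; apply: lin_scale_r; apply: lfa; lin_tac.
have F3 a b : linear (fun c => F a b c).
  by apply: lin_tsum_r => ? ?; apply: lin_scale_l; lin_tac.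
transitivity (\tsum_(x1 \otimes x2 <- comul x) 
    \tsum_(x11 \otimes x12 <- comul x1) F x11 x12 x2).
  have l1 : linear (fun x => \tsum_(y1 \otimes y2 <- comul y) (lam (x * y2) :
    K) *: f y1).
    by apply: lin_tsum_r => ? ? /=; apply: lin_scale_l; lin_tac.
  rewrite -(comul_counitl x l1); apply: eq_tsum => a b.
  rewrite /F tsum_exchange tsum_scaler; apply: eq_tsum => y1 y2.
  have l2 : linear (fun u => (lam (b * y2) : K) *: f (u * y1)).
    by apply: lin_scale_r; apply: lfa; lin_tac.
  rewrite -[y1 in LHS]mul1r -(comul_antipodel a l2).
  by apply: eq_tsum => ? ?; rewrite mulrA.
rewrite comul_assoc_sum //; apply: eq_tsum => a b.
have l3 : linear (fun u => f (S a * u)) by apply: lfa; lin_tac.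
rewrite -[S a in RHS]mulr1 -(lam_integral (b * y) l3) tsum_comulM //.
split=> u; first by apply: lin_scale_r.
by apply: lin_scale_l; lin_tac.
Qed.

End TwistedTrace.

(** * Frobenius structure *)

Section Frobenius.
Variables (K : fieldType) (H : hopfType K) (L : H).
Local Notation S := (@antipode K H).
Local Notation lam := (@lam K H).
Hypotheses (epsL : counit L = 1) (intl : forall h, h * L = (counit h : K) *: L)
  (intr : forall h, L * h = (counit h : K) *: L).
Implicit Types (U : lmodType K) (g h x y : H).

Lemma lam_integral_eq1 : lam L = 1.
Proof.
rewrite lamE (eq_ltrace (g := fun x => (counit x : K) *: L)).
  by rewrite ltrace_rank1 //; lin_tac.
by move=> x; rewrite intr !counit_antipode.
Qed.

(** The legs of L provide dual bases for the form lam(a b). This is [lam_swap] at x = L, where lam(L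
    y_2) = eps(y_2). *)
Lemma frobenius_l U (f : H -> U) y : linear f ->
  \tsum_(l1 \otimes l2 <- comul L) (lam (l2 * y) : K) *: f (S l1) = f y.
Proof.
move=> lf; rewrite -lam_swap // -[RHS](comul_counitr _ lf).
apply: eq_tsum => y1 y2; rewrite intr linearZ lam_integral_eq1.
by congr (_ *: _); apply: mulr1.
Qed.

(** The expansion in [frobenius_l] shows that S is onto, hence injective by dimension. *)
Lemma antipode_inj : lker (linfun S) == 0%VS.
Proof.
have Sf : limg (linfun S) = fullv.
  apply/vspaceP => y; rewrite memvf.
  apply/memv_imgP; exists (\tsum_(l1 \otimes l2 <- comul L) (lam (l2 * y) :
    K) *: l1).
    exact: memvf.
  rewrite lfunE /= (lin_tsumE (f := S)); last by lin_tac.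
  rewrite -[LHS](frobenius_l _ (@lin_id _ _)); apply: eq_tsum => l1 l2.
  by rewrite linearZ.
by have := limg_ker_dim (linfun S) fullv;
  rewrite Sf capfv -dimv_eq0 addnC => /eqP; rewrite -{2}[\dim _]addn0 eqn_add2l.
Qed.

Local Notation T := (antipode_inv H).

Lemma antipodeK h : T (S h) = h.
Proof. by have := lker0_lfunK antipode_inj h; rewrite lfunE. Qed.

Lemma antipodeVK h : S (T h) = h.
Proof. by have := lker0_lfunVK antipode_inj h; rewrite lfunE. Qed.

Lemma antipodeVM g h : T (g * h) = T h * T g.
Proof. by rewrite -{1}[g]antipodeVK -{1}[h]antipodeVK -antipodeM antipodeK. Qed.

Lemma antipodeV1 : T 1 = 1.
Proof. by rewrite -{1}(antipode1 H) antipodeK. Qed.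

Lemma lam_nondeg_r y : (forall x, lam (x * y) = 0) -> y = 0.
Proof.
move=> h; rewrite -[y](frobenius_l _ (@lin_id _ _)) /tsum big1 // => p _.
by rewrite h scale0r.
Qed.

Lemma lam_nondeg_l x : (forall y, lam (x * y) = 0) -> x = 0.
Proof.
move=> h; rewrite -[x]antipodeK -[S x]antipodeK.
rewrite [S (S x)]lam_nondeg_r ?linear0 // => y; by rewrite -lamC.
Qed.

(** By nondegeneracy it suffices to pair with an arbitrary y, and then y may be expanded by
    [frobenius_l]. *)
Lemma frobenius_r U (f : H -> U) x : linear f ->
  \tsum_(l1 \otimes l2 <- comul L) (lam (x * S l1) : K) *: f l2 = f x.
Proof.
move=> lf; rewrite -[in RHS](_ :
  \tsum_(l1 \otimes l2 <- comul L) (lam (x * S l1) : K) *: l2 = x).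
  by rewrite (lin_tsumE lf); apply: eq_tsum => *; rewrite (linear_of_scale lf).
apply/eqP; rewrite -subr_eq0; apply/eqP/lam_nondeg_l => y.
rewrite mulrBl linearB; apply/eqP; rewrite subr_eq0; apply/eqP.
have l1 : linear (fun z : H => lam (z * y)) by lin_tac.
have l2 : linear (fun z : H => lam (x * z)) by lin_tac.
rewrite -(frobenius_l y l2) (lin_tsumE l1); apply: eq_tsum => a b.
rewrite -scalerAl linearZ; exact: mulrC.
Qed.

(** Expand S(h_1) (h_2 L)_1 (x) (h_2 L)_2 in two ways: the integral property of L gives S(h) L_1 (x)
    L_2, while contracting S(h_1) h_2 leaves L_1 (x) h L_2. *)
Lemma casimir_l U (G : H -> H -> U) h : is_bilinear G ->
  \tsum_(l1 \otimes l2 <- comul L) G l1 (h * l2) =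
  \tsum_(l1 \otimes l2 <- comul L) G (S h * l1) l2.
Proof.
move=> bG.
have G1 (k : H -> H) b : linear k -> linear (fun a => G (k a) b).
  by move=> lk; exact: (lin_comp (bG.1 b) lk).
have G2 (k : H -> H) a : linear k -> linear (fun b => G a (k b)).
  by move=> lk; exact: (lin_comp (bG.2 a) lk).
transitivity (\tsum_(h1 \otimes h2 <- comul h)
   \tsum_(x1 \otimes x2 <- comul (h2 * L)) G (S h1 * x1) x2); last first.
  have l1 : linear (fun a => \tsum_(l1 \otimes l2 <- comul L) G (S a * l1) l2).
    by apply: lin_tsum_r => *; apply: G1; lin_tac.
  rewrite -(comul_counitr h l1); apply: eq_tsum => h1 h2; rewrite intl linearZ.
  apply: (linear_of_scale (f := fun t :
    tens H H => \tsum_(x1 \otimes x2 <- t) G (S h1 * x1) x2)).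
  by apply: tsum_linear; split=> ?; [apply: G1 | apply: G2]; lin_tac.
transitivity (\tsum_(h1 \otimes h2 <- comul h) \tsum_(a \otimes b <- comul h2)
   \tsum_(l1 \otimes l2 <- comul L) G (S h1 * (a * l1)) (b * l2)); last first.
  apply: eq_tsum => h1 h2; have bG' : is_bilinear (fun x1 x2 => G (S h1 * x1) x2).
    by split=> ?; [apply: G1 | apply: G2]; lin_tac.
  by rewrite (tsum_comulM _ _ bG').
rewrite -(comul_assoc_sum (F := fun h1 a b =>
   \tsum_(l1 \otimes l2 <- comul L) G (S h1 * (a * l1)) (b * l2))); try by
  move=> *; apply: lin_tsum_r => *; (apply: G1 || apply: G2); lin_tac.
have l2 : linear (fun b => \tsum_(l1 \otimes l2 <- comul L) G l1 (b * l2)).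
  by apply: lin_tsum_r => *; apply: G2; lin_tac.
rewrite -(comul_counitl h l2); apply: eq_tsum => a b.
have l3 : linear (fun u => \tsum_(l1 \otimes l2 <- comul L) G (u * l1) (b * l2)).
  by apply: lin_tsum_r => *; apply: G1; lin_tac.
have := comul_antipodel a l3.
under [X in _ = _ *: X]eq_tsum do rewrite mul1r; move=> <-.
by apply: eq_tsum => h1 h2; apply: eq_tsum => *; rewrite mulrA.
Qed.

(** Mirror image of [casimir_l]: start from L h_1 and contract a factor h_2 S(h_3). *)
Lemma casimir_r U (G : H -> H -> U) h : is_bilinear G ->
  \tsum_(l1 \otimes l2 <- comul L) G (l1 * h) l2 =
  \tsum_(l1 \otimes l2 <- comul L) G l1 (l2 * S h).
Proof.
move=> bG.
have G1 (k : H -> H) b : linear k -> linear (fun a => G (k a) b).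
  by move=> lk; exact: (lin_comp (bG.1 b) lk).
have G2 (k : H -> H) a : linear k -> linear (fun b => G a (k b)).
  by move=> lk; exact: (lin_comp (bG.2 a) lk).
transitivity (\tsum_(h1 \otimes h2 <- comul h)
   \tsum_(x1 \otimes x2 <- comul (L * h1)) G x1 (x2 * S h2)); last first.
  have l1 : linear (fun a => \tsum_(l1 \otimes l2 <- comul L) G l1 (l2 * S a)).
    by apply: lin_tsum_r => *; apply: G2; lin_tac.
  rewrite -(comul_counitl h l1); apply: eq_tsum => h1 h2; rewrite intr linearZ.
  apply: (linear_of_scale (f := fun t :
    tens H H => \tsum_(x1 \otimes x2 <- t) G x1 (x2 * S h2))).
  by apply: tsum_linear; split=> ?; [apply: G1 | apply: G2]; lin_tac.
transitivity (\tsum_(h1 \otimes h2 <- comul h) \tsum_(a \otimes b <- comul h1)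
   \tsum_(l1 \otimes l2 <- comul L) G (l1 * a) (l2 * b * S h2)); last first.
  apply: eq_tsum => h1 h2; have bG' : is_bilinear (fun x1 x2 => G x1 (x2 * S h2)).
    by split=> ?; [apply: G1 | apply: G2]; lin_tac.
  by rewrite (tsum_comulM _ _ bG') [RHS]tsum_exchange.
rewrite (comul_assoc_sum (F := fun a b h2 =>
   \tsum_(l1 \otimes l2 <- comul L) G (l1 * a) (l2 * b * S h2))); try by
  move=> *; apply: lin_tsum_r => *; (apply: G1 || apply: G2); lin_tac.
have l2 : linear (fun a => \tsum_(l1 \otimes l2 <- comul L) G (l1 * a) l2).
  by apply: lin_tsum_r => *; apply: G1; lin_tac.
rewrite -(comul_counitr h l2); apply: eq_tsum => a b.
have l3 : linear (fun u => \tsum_(l1 \otimes l2 <- comul L) G (l1 * a) (l2 * u)).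
  by apply: lin_tsum_r => *; apply: G2; lin_tac.
have := comul_antipoder b l3.
under [X in _ = _ *: X]eq_tsum do rewrite mulr1; move=> <-.
by apply: eq_tsum => h1 h2; apply: eq_tsum => *; rewrite mulrA.
Qed.

(** The distinguished group-like element: by [lam_modular] it measures how far [lam] is from being
    an integral on the other side. *)
Definition modular : H := \tsum_(l1 \otimes l2 <- comul L) (lam l1 : K) *: l2.
Local Notation g := modular.

(** Expand h by [frobenius_r]. After regrouping, the integral property of [lam] applies to the first
    leg of L, and what remains is the definition of g scaled by lam(h). *)
Lemma lam_modular U (f : H -> U) h : linear f ->
  \tsum_(h1 \otimes h2 <- comul h) (lam h1 : K) *: f h2 = (lam h : K) *: f g.
Proof.
move=> lf.
have lfk (X : lmodType K) (k : X -> H) : linear k -> linear (fun a => f (k a)).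
  by move=> lk; exact: lin_comp.
have l1 : linear (fun h => \tsum_(h1 \otimes h2 <- comul h) (lam h1 : K) *: f h2).
  by apply: lin_tsum_l; [split=> ?; [lin_tac | apply: lin_scale_r] | lin_tac].
rewrite -(frobenius_r h l1).
transitivity (\tsum_(l1 \otimes l2 <- comul L) \tsum_(a \otimes b <- comul l1)
   ((lam b : K) *: ((lam (h * S a) : K) *: f l2))).
  rewrite (comul_assoc_sum (F := fun a b c => (lam b : K) *: ((lam (h * S a) :
    K) *: f c))).
  - apply: eq_tsum => a b; rewrite tsum_scaler; apply: eq_tsum => *.
    by rewrite !scalerA mulrC.
  - by move=> *; lin_tac.
  - by move=> *; lin_tac.
  - by move=> *; do 2!apply: lin_scale_r.
rewrite /modular (lin_tsumE lf) tsum_scaler; apply: eq_tsum => l1' l2.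
have l3 : linear (fun a => (lam (h * S a) : K) *: f l2) by lin_tac.
rewrite (lam_integral l1' l3) antipode1 mulr1 (linear_of_scale lf) !scalerA.
by rewrite mulrC.
Qed.

(** By [casimir_l], h g = lam(S(h) L_1) L_2. The Nakayama automorphism turns this into lam(L_1
    S^3(h)) L_2, and [casimir_r] moves S^3(h) to the second leg as S^4(h). *)
Lemma modular_antipode4 h : h * g = g * S (S (S (S h))).
Proof.
have lm u : linear (fun z : H => u * z) by lin_tac.
have lmr u : linear (fun z : H => z * u) by lin_tac.
have b1 : is_bilinear (fun a b : H => (lam a : K) *: b) by bil_tac.
transitivity (\tsum_(l1 \otimes l2 <- comul L) (lam (S h * l1) : K) *: l2).
  rewrite -(casimir_l _ b1) /modular (lin_tsumE (lm h)).
  by apply: eq_tsum => *; rewrite scalerAr.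
under eq_tsum do rewrite lamC.
rewrite (casimir_r _ b1) /modular (lin_tsumE (lmr _)).
by apply: eq_tsum => *; rewrite scalerAl.
Qed.

Lemma modular_grouplike : comul g = g \otimes g.
Proof.
rewrite {1}/modular (lin_tsumE (f := comul)); last by lin_tac.
transitivity (\tsum_(l1 \otimes l2 <- comul L) \tsum_(a \otimes b <- comul l2)
   (lam l1 : K) *: (a \otimes b)).
  by apply: eq_tsum => a b; rewrite linearZ -tsum_scaler -tens_span.
rewrite -(comul_assoc_sum (F := fun x a b => (lam x : K) *: (a \otimes b)));
  try by move=> *; lin_tac.
have lr : linear (fun z : H => g \otimes z) by lin_tac.
rewrite {2}/modular (lin_tsumE lr); apply: eq_tsum => a b.
have ll : linear (fun z : H => z \otimes b) by lin_tac.
by rewrite (lam_modular a ll) (linear_of_scale lr).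
Qed.

Lemma counit_modular : counit g = 1.
Proof.
rewrite /modular (lin_tsumE (f := counit)); last by lin_tac.
have ll : linear (lam : H -> K^o) by lin_tac.
rewrite -lam_integral_eq1 -(comul_counitr L ll).
by apply: eq_tsum => a b; rewrite linearZ; exact: mulrC.
Qed.

Lemma modularK : S g * g = 1.
Proof.
have := antipode_l g; rewrite modular_grouplike counit_modular scale1r => <-.
by rewrite tsum_tmul //; bil_tac.
Qed.

Lemma modularVK : g * S g = 1.
Proof.
have := antipode_r g; rewrite modular_grouplike counit_modular scale1r => <-.
by rewrite tsum_tmul //; bil_tac.
Qed.

(** Expanding the argument in dual bases writes f as a sum of maps of rank one. *)
Lemma ltrace_lam (f : H -> H) : linear f ->
  ltrace f = \tsum_(l1 \otimes l2 <- comul L) lam (l2 * f (S l1)).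
Proof.
move=> lf.
rewrite (eq_ltrace (g := fun y =>
  \tsum_(l1 \otimes l2 <- comul L) (lam (l2 * y) : K) *: f (S l1))).
  rewrite ltrace_tsum /tsum; apply: eq_bigr => -[a b] _ /=.
  by rewrite (ltrace_rank1 (p := fun y => lam (b * y))) //; lin_tac.
by move=> y; rewrite frobenius_l.
Qed.

End Frobenius.

(** * Cyclotomic positivity *)

Section Conjugate.
Local Notation ev p x := (map_poly intr p).[x].

(** An integer polynomial of least degree vanishing at x serves as minimal polynomial up to
    constants: the remainder of a pseudo-division by it vanishes at x too, hence is zero. *)
Lemma int_poly_minimal (F : fieldType) (x : F) (p : {poly int}) :
  [pchar F] =i pred0 -> p != 0 -> ev p x = 0 ->
  exists q : {poly int}, [/\ q != 0, ev q x = 0 &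
    forall r, ev r x = 0 -> exists c (k : {poly int}), c != 0 /\ c *: r = k * q].
Proof.
move=> ch0 p0 px.
pose P m := boolp.asbool (exists q : {poly int}, [/\ q != 0, ev q x =
  0 & size q = m]).
have exP : exists m, P m by exists (size p); apply/boolp.asboolP; exists p.
have [m /boolp.asboolP[q [q0 qx sq]] mmin] := ex_minnP exP.
exists q; split=> // r rx.
have := Pdiv.Idomain.divp_eq r q.
set c := (lead_coef q ^+ _) => e.
exists c, (Pdiv.Idomain.divp r q); split.
  by rewrite expf_neq0 // lead_coef_eq0.
rewrite e; suff -> : Pdiv.Idomain.modp r q = 0 by rewrite addr0.
apply/eqP; apply/negPn/negP => m0.
have : P (size (Pdiv.Idomain.modp r q)).
  apply/boolp.asboolP; exists (Pdiv.Idomain.modp r q); split=> //.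
  move/(congr1 (fun u => ev u x)): e.
  rewrite map_polyZ rmorphD rmorphM /= hornerZ hornerD hornerM rx qx !mulr0 add0r.
  by move=> <-.
by move/mmin; rewrite -sq leqNgt Pdiv.Idomain.ltn_modp q0.
Qed.

Lemma intr_eq0_char0 (F : fieldType) (c : int) :
  [pchar F] =i pred0 -> (c%:~R == 0 :> F) = (c == 0).
Proof.
move=> ch0; case: c => m.
  by rewrite -pmulrn; apply: ((pcharf0P F).1 ch0 m).
by rewrite NegzE rmorphN oppr_eq0 /= -pmulrn ((pcharf0P F).1 ch0).
Qed.

(** This carries integral relations over F to complex algebraic numbers, where absolute values are
    available. *)
Lemma algC_conjugate (F : fieldType) (x : F) (p : {poly int}) :
  [pchar F] =i pred0 -> p != 0 -> ev p x = 0 ->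
  exists y : algC, forall r : {poly int}, ev r x = 0 <-> ev r y = 0.
Proof.
move=> ch0 p0 px.
have chC : [pchar algC] =i pred0 by exact: pchar_num.
have evM (E : fieldType) (z : E) (a b : {poly int}) : ev (a * b) z =
  ev a z * ev b z.
  by rewrite rmorphM hornerM.
have evZ (E : fieldType) (z : E) (c : int) (b : {poly int}) : ev (c *: b) z =
  c%:~R * ev b z.
  by rewrite map_polyZ hornerZ.
have tr (E : fieldType) (z : E) (q r k : {poly int}) (c : int) :
    [pchar E] =i pred0 -> ev q z = 0 -> c != 0 -> c *: r = k * q -> ev r z = 0.
  move=> chE qz c0 /(congr1 (fun u => ev u z)); rewrite evZ evM qz mulr0 => /eqP.
  by rewrite mulf_eq0 intr_eq0_char0 // (negPf c0) /= => /eqP.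
have nonroot (E : fieldType) (z : E) q : [pchar E] =i pred0 -> q != 0 -> ev q z =
  0 -> (1 < size q)%N.
  move=> chE q0 qz; rewrite ltnNge; apply/negP=> /size1_polyC qc.
  move: q0 qz; rewrite qc polyC_eq0 map_polyC hornerC => q0 /eqP.
  by rewrite intr_eq0_char0 // (negPf q0).
have [q [q0 qx qmin]] := int_poly_minimal ch0 p0 px.
have [y qy] : exists y : algC, ev q y = 0.
  have /closed_rootP[y /eqP] : size (map_poly (intr : int -> algC) q) != 1%N.
    rewrite size_map_inj_poly ?rmorph0 //; last exact: intr_inj.
    by rewrite neq_ltn (nonroot _ _ _ ch0 q0 qx) orbT.
  by exists y.
exists y => r; split=> [/qmin[c [k [c0 e]]]|ry]; first exact: tr e.
have [q' [q'0 q'y q'min]] := int_poly_minimal chC q0 qy.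
suff q'x : ev q' x = 0 by have [c [k [c0 e]]] := q'min _ ry; exact: tr e.
(* Up to a constant, q is k q'. If k vanished at x, then q would divide k up to a constant, which
   degrees forbid because q' is not constant. So q' vanishes at x. *)
have [c [k [c0 e]]] := q'min _ qy.
have /eqP := congr1 (fun u => ev u x) e.
rewrite evZ qx mulr0 eq_sym evM mulf_eq0 => /orP[/eqP kx|/eqP //].
have k0 : k != 0.
  apply/eqP=> k0; move/eqP: e; rewrite k0 mul0r -mul_polyC mulf_eq0 polyC_eq0.
  by rewrite (negPf c0) (negPf q0).
have [d [l [d0 e']]] := qmin _ kx.
have l0 : l != 0.
  by apply/eqP=> l0; move/eqP: e';
    rewrite l0 mul0r -mul_polyC mulf_eq0 polyC_eq0 (negPf d0) (negPf k0).
have sk : size k = (size l + size q).-1 by rewrite -size_mul // -e' size_scale.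
have sq : size q = (size k + size q').-1 by rewrite -size_mul // -e size_scale.
have sq' : (1 < size q')%N by exact: nonroot q'y.
have sl : (0 < size l)%N by rewrite size_poly_gt0.
by exfalso; lia.
Qed.

(** At a conjugate y of x in [algC], again a root of unity, y^-1 is the complex conjugate of y and
    the sum consists of squared absolute values. *)
Lemma sum_conj_eq0 (F : fieldType) (x : F) M (I : finType) (b : I -> {poly int}) :
  [pchar F] =i pred0 -> (0 < M)%N -> x ^+ M = 1 ->
  \sum_i ev (b i) x * ev (b i) x^-1 = 0 -> forall i, ev (b i) x = 0.
Proof.
move=> ch0 M0 xM s0.
have inv (E : fieldType) (z : E) : z ^+ M = 1 -> z^-1 = z ^+ M.-1.
  move=> zM; have z0 : z != 0.
    by apply/eqP=> z0; move: zM; rewrite z0 expr0n gtn_eqF // => /esym/eqP;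
      rewrite oner_eq0.
  by apply: (mulfI z0); rewrite mulfV // -exprS prednK.
(* Since x^-1 = x^(M-1), the hypothesis is one integral polynomial relation, which passes to y. *)
pose Q : {poly int} := \sum_i b i * (b i \Po 'X^(M.-1)).
have evQ (E : fieldType) (z : E) : z ^+ M = 1 -> ev Q z =
  \sum_i ev (b i) z * ev (b i) z^-1.
  move=> zM; rewrite rmorph_sum horner_sum; apply: eq_bigr => i _.
  by rewrite rmorphM hornerM /= map_comp_poly horner_comp map_polyXn hornerXn inv.
have p0 : 'X^M - 1 != 0 :> {poly int} by rewrite monic_neq0 // monicXnsubC.
have evp (E : fieldType) (z : E) : ev ('X^M - 1) z = z ^+ M - 1.
  by rewrite rmorphB /= map_polyXn rmorph1 hornerD hornerN hornerC hornerXn.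
have px : ev ('X^M - 1) x = 0 by rewrite evp xM subrr.
have [y yP] := algC_conjugate ch0 p0 px.
have yM : y ^+ M = 1.
  by apply/eqP; rewrite -subr_eq0 -evp; apply/eqP/yP.
have : ev Q y = 0 by apply/yP; rewrite evQ.
rewrite evQ // => sy i; apply/yP.
have yc : y^-1 = y^*.
  have n1 : `|y| = 1.
    by apply/eqP; rewrite -(pexpr_eq1 M0) // -normrX yM normr1.
  by rewrite invC_norm n1 expr1n invr1 mul1r.
have ec j : ev (b j) y^-1 = (ev (b j) y)^*.
  rewrite yc -horner_map /= -map_poly_comp; congr (_.[_]).
  by apply: eq_map_poly => z /=; rewrite rmorph_int.
have := sy; under eq_bigr do rewrite ec -normCK.
move/eqP; rewrite psumr_eq0; last by move=> *; rewrite exprn_ge0.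
move/allP/(_ i); rewrite mem_index_enum => /(_ isT); rewrite sqrf_eq0 normr_eq0.
by move/eqP.
Qed.

End Conjugate.

Lemma prim_root_closed (F : closedFieldType) n : [pchar F] =i pred0 ->
  (0 < n)%N -> exists z : F, n.-primitive_root z.
Proof.
move=> ch0 n_gt0.
pose p : {poly F} := 'X^n - 1; have [r Dp] := closed_field_poly_normal p.
rewrite (monicP _) ?monicXnsubC // scale1r in Dp.
have rn1: all n.-unity_root r by apply/allP=> z; rewrite -root_prod_XsubC -Dp.
have sz_r: (n < (size r).+1)%N.
  by rewrite -(size_prod_XsubC r id) -Dp size_XnsubC.
have [|z] := hasP (has_prim_root n_gt0 rn1 _ sz_r); last by exists z.
rewrite -separable_prod_XsubC -Dp cyclotomic.separable_Xn_sub_1 //.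
by rewrite ((pcharf0P F).1 ch0) -lt0n.
Qed.

Lemma sqrt_closed (F : closedFieldType) (s : F) : exists r : F, r ^+ 2 == s.
Proof.
have /closed_rootP[r] : size ('X^2 - s%:P : {poly F}) != 1%N by rewrite size_XnsubC.
by rewrite rootE !hornerE subr_eq0 => rs; exists r.
Qed.

(** By linearity the powers in the hypothesis may be replaced by any polynomial, in particular one
    that isolates the value s i. *)
Lemma fiber_sum (F : fieldType) (I : finType) (s w : I -> F) :
  (forall k : nat, \sum_i w i * s i ^+ k = \sum_i s i ^+ k) ->
  forall i, \sum_(j | s j == s i) w j = #|[pred j | s j == s i]|%:R.
Proof.
move=> H i.
have Hp (p : {poly F}) : \sum_i w i * p.[s i] = \sum_i p.[s i].
  under eq_bigr do rewrite horner_coef mulr_sumr.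
  under [RHS]eq_bigr do rewrite horner_coef.
  rewrite exchange_big [RHS]exchange_big; apply: eq_bigr => k _.
  by rewrite -mulr_sumr -H mulr_sumr; apply: eq_bigr => j _; rewrite mulrCA.
pose p := \prod_(x <- undup [seq s j | j <- enum I] | x != s i) ('X - x%:P).
have p0 j : s j != s i -> p.[s j] = 0.
  move=> ji; apply/eqP; rewrite /p horner_prod prodf_seq_eq0; apply/hasP.
  exists (s j); first by rewrite mem_undup map_f // mem_enum.
  by rewrite ji !hornerE subrr /=.
have pi : p.[s i] != 0.
  rewrite /p horner_prod prodf_seq_neq0; apply/allP => x _; apply/implyP=> xi.
  by rewrite !hornerE subr_eq0 eq_sym.
have := Hp p.
rewrite (bigID (fun j => s j == s i)) /= [X in _ + X]big1 => [|j ji]; last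
  by rewrite p0 // mulr0.
rewrite [RHS](bigID (fun j => s j == s i)) /= [X in _ = _ + X]big1 => [|j ji];
  last by rewrite p0.
rewrite !addr0 => e; apply: (mulIf pi); rewrite mulr_suml.
rewrite (eq_bigr (fun j => w j * p.[s j])); last by move=> j /eqP ->.
rewrite e (eq_bigr (fun=> p.[s i])); last by move=> j /eqP ->.
by rewrite sumr_const mulr_natl.
Qed.

(** Write w_i = r_i zeta^(k_i) with r_i^2 = s_i. On a fibre of s with m elements the w_j add up to
    m, so m times the sum of the w_j^-1 is the product of the sums of zeta^(k_j) and of zeta^(-k_j).
    [sum_conj_eq0] then makes each sum of zeta^(k_j) vanish, although it equals m / r_i. *)
Lemma sum_inv_neq0 (F : closedFieldType) (I : finType) (N : nat) (s w : I -> F) :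
  [pchar F] =i pred0 -> (0 < N)%N -> (forall i, s i != 0) ->
  (forall i, w i ^+ (2 * N) = s i ^+ N) ->
  (forall k : nat, \sum_i w i * s i ^+ k = \sum_i s i ^+ k) ->
  \sum_i (w i)^-1 = 0 -> #|I| = 0%N.
Proof.
move=> ch0 N0 s0 ws H sum0; apply/eqP; rewrite -leqn0 leqNgt;
  apply/negP => /card_gt0P[i0 _].
have fib := fiber_sum H.
(* The root is a function of the value s i, hence constant on fibres. *)
pose sq x := xchoose (sqrt_closed (x : F)).
have sqE x : sq x ^+ 2 = x by exact/eqP/(xchooseP (sqrt_closed x)).
pose r i := sq (s i).
have r0 i : r i != 0 by apply: contra_neq (s0 i) => ri;
  rewrite -(sqE (s i)) -/(r i) ri expr0n.
have M0 : (0 < 2 * N)%N by rewrite muln_gt0.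
have [z zP] := prim_root_closed ch0 M0.
have kP i : exists k : 'I_(2 * N), w i == r i * z ^+ k.
  have : (w i / r i) ^+ (2 * N) = 1.
    by rewrite expr_div_n ws exprM sqE mulfV // expf_neq0.
  by move/(prim_rootP zP) => [k kE]; exists k; rewrite -kE mulrC divfK.
pose k i := xchoose (kP i).
have kE i : w i = r i * z ^+ k i by exact/eqP/(xchooseP (kP i)).
pose m i := #|[pred j | s j == s i]|.
have m0 i : (0 < m i)%N by apply/card_gt0P; exists i; rewrite inE.
(* An integral substitute for 1 / m_i. Its square compensates both for the factor m_i in the product
   of the two sums and for the m_i indices in each fibre. *)
pose n := #|I|; pose c i := (n`! %/ m i)%N.
have cm i : (c i * m i = n`!)%N by rewrite divnK // dvdn_fact // m0 max_card.
pose b i : {poly int} := (c i)%:R *: \sum_(j | s j == s i) 'X^(k j).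
have bE i x : (map_poly intr (b i)).[x] = (c i)%:R * \sum_(j | s j == s i) x ^+ k j.
  rewrite map_polyZ hornerZ rmorph_nat; congr (_ * _).
  by rewrite rmorph_sum horner_sum; apply: eq_bigr => j _;
    rewrite /= map_polyXn hornerXn.
have rr i j : s j == s i -> r j = r i by rewrite /r => /eqP ->.
have B i : (map_poly intr (b i)).[z] = n`!%:R / r i.
  rewrite bE -(cm i) natrM -mulrA; congr (_ * _); apply: (mulIf (r0 i)).
  rewrite divfK // -(fib i) mulr_suml; apply: eq_bigr => j /rr e.
  by rewrite kE e mulrC.
have Bb i : (map_poly intr (b i)).[z^-1] =
  (c i)%:R * (r i * \sum_(j | s j == s i) (w j)^-1).
  rewrite bE; congr (_ * _); rewrite mulr_sumr; apply: eq_bigr => j /rr e.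
  by rewrite kE e invfM mulrA mulfV // mul1r exprVn.
have nz : n`!%:R != 0 :> F by rewrite ((pcharf0P F).1 ch0) -lt0n fact_gt0.
have := sum_conj_eq0 ch0 M0 (prim_expr_order zP) (b := b).
rewrite (_ : \sum_i _ = 0).
  move/(_ erefl i0); rewrite B => /eqP; rewrite mulf_eq0 invr_eq0 (negPf nz).
  by rewrite (negPf (r0 i0)).
transitivity (n`!%:R * \sum_i \sum_(j | s j == s i) (c i)%:R * (w j)^-1).
  rewrite mulr_sumr; apply: eq_bigr => i _.
  by rewrite B Bb [_%:R * (r i * _)]mulrCA -mulrA mulKf // -mulr_sumr.
rewrite (exchange_big_dep predT) //=.
rewrite (eq_bigr (fun j => n`!%:R * (w j)^-1)); last first.
  move=> j _; rewrite -mulr_suml -(cm j) natrM; congr (_ * _).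
  rewrite (eq_bigr (fun=> (c j)%:R)); last first.
    by move=> i /eqP e; rewrite /c /m e.
  rewrite sumr_const mulr_natr; congr (_ *+ _).
  by apply: eq_card => i; rewrite !inE eq_sym.
by rewrite -mulr_sumr sum0 !mulr0.
Qed.

(** * Matrices *)

Section Matrices.
Variable F : closedFieldType.
Hypothesis ch0 : [pchar F] =i pred0.

Lemma diagonalizable_finite_order n (U : 'M[F]_n.+1) M :
  (0 < M)%N -> U ^+ M = 1 -> diagonalizable U.
Proof.
move=> M0 UM; apply/diagonalizableP.
have [r Dp] := closed_field_poly_normal ('X^M - 1 : {poly F}).
rewrite (monicP _) ?monicXnsubC // scale1r in Dp.
exists r.
  rewrite -separable_prod_XsubC -Dp cyclotomic.separable_Xn_sub_1 //.
  by rewrite ((pcharf0P F).1 ch0) -lt0n.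
rewrite -Dp; apply: mxminpoly_min.
by rewrite rmorphB rmorph1 rmorphXn /= horner_mx_X UM subrr.
Qed.

Lemma intertwineX n (P A B : 'M[F]_n.+1) k : P * A = B * P -> P * A ^+ k =
  B ^+ k * P.
Proof.
move=> PA; elim: k => [|k IH]; first by rewrite mul1r mulr1.
by rewrite exprSr mulrA IH -mulrA PA mulrA -exprSr.
Qed.

Lemma intertwine_comp n (P Q A B C : 'M[F]_n.+1) :
  P * A = B * P -> Q * B = C * Q -> Q * P * A = C * (Q * P).
Proof. by move=> PA QB; rewrite -mulrA PA mulrA QB mulrA. Qed.

Lemma intertwineM n (Q A B C D : 'M[F]_n.+1) :
  Q * A = C * Q -> Q * B = D * Q -> Q * (A * B) = C * D * Q.
Proof. by move=> QA QB; rewrite mulrA QA -mulrA QB mulrA. Qed.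

Lemma mxtrace_intertwine n (P A B : 'M[F]_n.+1) : P \in unitmx ->
  P * A = B * P -> \tr A = \tr B.
Proof.
move=> Pu PA; have -> : A = invmx P *m (B *m P) by rewrite -[B *m P]PA mulKmx.
by rewrite mxtrace_mulC mulmxK.
Qed.

(** In an eigenbasis of Z, A becomes U R with R a square root of Z and U of finite order. U and R
    commute and diagonalise together, and the joint eigenvalues of A and Z fall under
    [sum_inv_neq0]. *)
Lemma mxtrace_inverse_neq0 n (N : nat) (A Z B : 'M[F]_n.+1) :
  (0 < N)%N -> A * Z = Z * A -> A ^+ (2 * N) = Z ^+ N -> Z \in unitmx ->
  diagonalizable Z -> (forall k : nat, \tr (A * Z ^+ k) = \tr (Z ^+ k)) ->
  A * B = 1 -> \tr B != 0.
Proof.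
move=> N0 AZ AN Zu [P Pu /diagonalizable_forPex[d /(simmxP Pu) PZ]] trAZ AB.
have PZ' : P * Z = diag_mx d * P := PZ.
have d0 i : d 0 i != 0.
  have : \det (diag_mx d) != 0.
    have : P *m Z *m invmx P \in unitmx by rewrite !unitmx_mul unitmx_inv Pu Zu.
    by rewrite PZ mulmxK // unitmxE unitfE.
  by rewrite det_diag => /prodf_neq0/(_ i isT).
have [A1 PA] : exists A1, P * A = A1 * P.
  by exists (P *m A *m invmx P); rewrite -[RHS]mulmxA mulVmx // mulmx1.
pose sq x := xchoose (sqrt_closed (x : F)).
have sqE x : sq x ^+ 2 = x by exact/eqP/(xchooseP (sqrt_closed x)).
pose R := diag_mx (\row_i sq (d 0 i)); pose Ri := diag_mx (\row_i (sq (d 0 i))^-1).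
have sq0 i : sq (d 0 i) != 0 by apply: contra_neq (d0 i) => e;
  rewrite -(sqE (d 0 i)) e expr0n.
have RRi : R * Ri = 1.
  apply/matrixP=> i j; rewrite -[R * Ri]/(R *m Ri) mul_diag_mx !mxE.
  by case: eqP => _; rewrite ?mulr1n ?mulfV // mulr0n mulr0.
have RiR : Ri * R = 1 by exact: mulmx1C.
have R2 : R ^+ 2 = diag_mx d.
  apply/matrixP=> i j; rewrite expr2 -[R * R]/(R *m R) mul_diag_mx !mxE.
  by case: eqP => _; rewrite ?mulr1n -?expr2 ?sqE // mulr0n mulr0.
have Ad : A1 *m diag_mx d = diag_mx d *m A1.
  have AZm : A *m Z = Z *m A := AZ.
  have PAm : P *m A = A1 *m P := PA.
  have : A1 *m diag_mx d *m P = diag_mx d *m A1 *m P.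
    by rewrite -!mulmxA -PZ -PAm !mulmxA -PAm -PZ -!mulmxA AZm.
  by move/(can_inj (mulmxK Pu)).
(* An entry of A1 vanishes unless the two eigenvalues of Z agree, in which case the chosen square
   roots agree as well. *)
have A1R : A1 * R = R * A1.
  apply/matrixP=> i j; move/matrixP/(_ i j): Ad.
  rewrite -[A1 * R]/(A1 *m R) -[R * A1]/(R *m A1) /R !mul_mx_diag !mul_diag_mx !mxE.
  have [->|ne] := eqVneq (d 0 i) (d 0 j); first by move=> _; exact: mulrC.
  move/eqP; rewrite mulrC -subr_eq0 -mulrBl mulf_eq0 subr_eq0 eq_sym (negPf ne) /=.
  by move/eqP ->; rewrite mulr0 mul0r.
have A1Ri : A1 * Ri = Ri * A1.
  by rewrite -[LHS]mul1r -RiR -mulrA [R * _]mulrA -A1R -mulrA RRi mulr1.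
pose U := A1 * Ri.
have UR : U * R = A1 by rewrite /U -mulrA RiR mulr1.
have UcR : U * R = R * U by rewrite UR /U mulrA -A1R -mulrA RRi mulr1.
have UN : U ^+ (2 * N) = 1.
  have e1 : A1 ^+ (2 * N) * P = R ^+ (2 * N) * P.
    rewrite -(intertwineX _ PA) AN exprM R2.
    exact: intertwineX.
  have e2 : A1 ^+ (2 * N) = R ^+ (2 * N) by exact: (can_inj (mulmxK Pu) e1).
  rewrite /U exprMn_comm // e2 -exprMn_comm; last by rewrite /GRing.comm RRi RiR.
  by rewrite RRi expr1n.
have [Q Qu] : codiagonalizable [:: U; R].
  apply/codiagonalizableP; split=> [X Y|X]; rewrite !inE.
    by move=> /orP[] /eqP-> /orP[] /eqP->; rewrite /comm_mx //; symmetry.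
  move=> /orP[] /eqP->; last exact: diagonalizable_diag.
  by apply: diagonalizable_finite_order UN; rewrite muln_gt0.
rewrite /= andbT => /andP[/diagonalizable_forPex[u /(simmxP Qu) QU]].
move=> /diagonalizable_forPex[r /(simmxP Qu) QR].
pose s i := r 0 i ^+ 2; pose w i := u 0 i * r 0 i.
have dM (a b : 'rV[F]_n.+1) : diag_mx a * diag_mx b =
  diag_mx (\row_i (a 0 i * b 0 i)).
  apply/matrixP=> i j; rewrite -[_ * _]/(_ *m _) mul_diag_mx !mxE.
  by case: eqP => _; rewrite ?mulr1n // mulr0n mulr0.
have dX (a : 'rV[F]_n.+1) k : diag_mx a ^+ k = diag_mx (\row_i (a 0 i ^+ k)).
  elim: k => [|k IH].
    by apply/matrixP=> i j; rewrite !mxE expr0.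
  rewrite exprS IH dM; congr diag_mx; apply/rowP=> i; by rewrite !mxE exprS.
pose G := Q * P.
have Gu : G \in unitmx by rewrite unitmx_mul Qu Pu.
have GA : G * A = diag_mx (\row_i w i) * G.
  apply: intertwine_comp PA _; rewrite -UR (intertwineM QU QR) dM.
  by congr (diag_mx _ * _).
have GZ : G * Z = diag_mx (\row_i s i) * G.
  apply: intertwine_comp PZ' _; rewrite -R2 (intertwineX 2 QR) dX.
  by congr (diag_mx _ * _).
clearbody G.
have w0 i : w i != 0.
  have : \det (diag_mx (\row_i w i)) != 0.
    have Au : A \in unitmx by have [] := mulmx1_unit AB.
    have : G *m A *m invmx G \in unitmx by rewrite !unitmx_mul unitmx_inv Gu Au.
    by rewrite (GA : G *m A = _ *m G) mulmxK // unitmxE unitfE.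
  by rewrite det_diag => /prodf_neq0/(_ i isT); rewrite mxE.
have s0 i : s i != 0.
  by apply: contraNneq (w0 i) => /eqP; rewrite sqrf_eq0 /w => /eqP ->;
    rewrite mulr0.
have GB : G * B = diag_mx (\row_i (w i)^-1) * G.
  have e : diag_mx (\row_i (w i)^-1) * diag_mx (\row_i w i) = 1.
    rewrite dM; apply/matrixP=> i j; rewrite !mxE.
    by case: eqP => _ //; rewrite mulVf.
  by rewrite -[LHS]mul1r -e -mulrA [_ * (G * B)]mulrA -GA -[G * A * B]mulrA AB mulr1.
rewrite (mxtrace_intertwine Gu GB) mxtrace_diag; apply/eqP => t0.
have tZ k : \tr (Z ^+ k) = \sum_i s i ^+ k.
  rewrite (mxtrace_intertwine Gu (intertwineX k GZ)) dX mxtrace_diag.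
  by apply: eq_bigr => i _; rewrite !mxE.
have tAZ k : \tr (A * Z ^+ k) = \sum_i w i * s i ^+ k.
  have e : G * (A * Z ^+ k) = diag_mx (\row_i (w i * s i ^+ k)) * G.
    rewrite mulrA GA -mulrA (intertwineX k GZ) dX mulrA dM.
    by congr (diag_mx _ * _); apply/rowP=> i; rewrite !mxE.
  by rewrite (mxtrace_intertwine Gu e) mxtrace_diag; apply: eq_bigr => i _;
    rewrite mxE.
have wN i : w i ^+ (2 * N) = s i ^+ N.
  have e : (diag_mx (\row_i w i)) ^+ (2 * N) = diag_mx (\row_i s i) ^+ N.
    have := intertwineX (2 * N) GA; rewrite AN (intertwineX N GZ).
    by move/(can_inj (mulmxK Gu)).
  by move: e; rewrite !dX => /matrixP/(_ i i); rewrite !mxE eqxx !mulr1n.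
have := @sum_inv_neq0 F 'I_n.+1 N s w ch0 N0 s0 wN _ _.
rewrite card_ord => H; suff : n.+1 = 0%N by []. 
apply: H => [k|]; first by rewrite -tZ -tAZ trAZ.
by rewrite -[RHS]t0; apply: eq_bigr => i _; rewrite mxE.
Qed.

Local Notation prodXsub Z r := (foldr (fun a M => M *m (Z - a%:M)) 1%:M r).

Lemma horner_mx_prod n (Z : 'M[F]_n.+1) (r : seq F) :
  horner_mx Z (\prod_(a <- r) ('X - a%:P)) = prodXsub Z r.
Proof.
elim: r => [|a r IH] /=; first by rewrite big_nil rmorph1.
by rewrite big_cons mulrC rmorphM /= IH rmorphB /= horner_mx_X horner_mx_C.
Qed.

Lemma mx_annihilated n (Z : 'M[F]_n) : exists r : seq F, prodXsub Z r = 0.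
Proof.
case: n Z => [|n] Z; first by exists [::]; apply/matrixP=> [[]].
have [r Dp] := closed_field_poly_normal (char_poly Z).
rewrite (monicP _) ?char_poly_monic // scale1r in Dp.
by exists r; rewrite -horner_mx_prod -Dp Cayley_Hamilton.
Qed.

(** The size is a general n, to be used with the dimension of H. Powers are iterated matrix
    products, and [prodXsub] stands for the evaluation of a split polynomial. *)
Lemma mxtrace_inverse_neq0_gen n (N : nat) (A Z Zi B : 'M[F]_n) (r : seq F) :
  (0 < n)%N -> (0 < N)%N -> A *m Z = Z *m A ->
  iter (2 * N) (mulmx A) 1%:M = iter N (mulmx Z) 1%:M -> Z *m Zi = 1%:M ->
  uniq r -> prodXsub Z r = 0 ->
  (forall k : nat, \tr (A *m iter k (mulmx Z) 1%:M) =
    \tr (iter k (mulmx Z) 1%:M)) ->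
  A *m B = 1%:M -> \tr B != 0.
Proof.
case: n A Z Zi B => // n A Z Zi B _ N0 AZ AN ZZi ur rZ trZ AB.
have pE (X : 'M[F]_n.+1) k : iter k (mulmx X) 1%:M = X ^+ k.
  by elim: k => [|k IH] //=; rewrite IH exprS.
apply: (@mxtrace_inverse_neq0 _ N A Z) => //.
- by rewrite -!pE.
- by have [] := mulmx1_unit ZZi.
- apply/diagonalizableP; exists r => //; apply: mxminpoly_min.
  by rewrite horner_mx_prod.
- by move=> k; rewrite -pE -trZ.
Qed.

(** The projections P = (1 + T)/2 and Q = E P give tr T = 2 rk P - n and tr (E T) = 2 rk Q - rk E.
    Hence n divides the nonzero integer tr T, which lies between -n and n, so rk P is 0 or n. *)
Lemma involution_scalar n (T E : 'M[F]_n) :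
  T *m T = 1%:M -> E *m E = E -> E *m T = T *m E ->
  n%:R * \tr (E *m T) = \tr T -> \tr T != 0 -> T = 1%:M \/ T = - 1%:M.
Proof.
move=> TT EE ET trE trT.
have two0 : 2%:R != 0 :> F by rewrite ((pcharf0P F).1 ch0).
have half (X : 'M[F]_n) : 2%:R^-1 *: X + 2%:R^-1 *: X = X.
  by rewrite -scalerDl -mulr2n -[_^-1 *+ 2]mulr_natr mulVf // scale1r.
pose P := 2%:R^-1 *: (1%:M + T); pose Q := 2%:R^-1 *: (E + E *m T).
have PP : P *m P = P.
  rewrite /P -scalemxAl -scalemxAr; congr (_ *: _).
  rewrite mulmxDl !mulmxDr !mul1mx mulmx1 TT [T + _]addrC.
  by rewrite scalerDr half.
have QQ : Q *m Q = Q.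
  rewrite /Q -scalemxAl -scalemxAr; congr (_ *: _).
  have e1 : E *m (E *m T) = E *m T by rewrite mulmxA EE.
  have e2 : E *m T *m E = E *m T by rewrite -mulmxA -ET e1.
  have e3 : E *m T *m (E *m T) = E by rewrite mulmxA e2 -mulmxA TT mulmx1.
  by rewrite mulmxDl !mulmxDr EE e1 e2 e3 [E *m T + _]addrC scalerDr half.
have tP := idempotent_mxtrace PP; have tQ := idempotent_mxtrace QQ.
have tE := idempotent_mxtrace EE.
have trT' : \tr T = ((2 * \rank P)%:Z - n%:Z)%:~R.
  have : \tr (2%:R *: P) = \tr (1%:M + T) by rewrite /P scalerA mulfV // scale1r.
  rewrite mxtraceZ mxtraceD mxtrace1 tP => e.
  by rewrite rmorphB /= -!pmulrn natrM e addrC addKr.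
have trE' : \tr (E *m T) = ((2 * \rank Q)%:Z - (\rank E)%:Z)%:~R.
  have : \tr (2%:R *: Q) = \tr (E + E *m T) by rewrite /Q scalerA mulfV // scale1r.
  rewrite mxtraceZ mxtraceD tE tQ => e.
  by rewrite rmorphB /= -!pmulrn natrM e addrC addKr.
have eZ : n%:Z * ((2 * \rank Q)%:Z - (\rank E)%:Z) = (2 * \rank P)%:Z - n%:Z.
  apply/eqP; rewrite -subr_eq0 -(intr_eq0_char0 _ ch0) rmorphB rmorphM /=.
  by rewrite -trT' -trE' -pmulrn trE subrr.
have ne : (2 * \rank P)%:Z - n%:Z != 0 by rewrite -(intr_eq0_char0 _ ch0) -trT'.
have Pn := rank_leq_row P.
have [r0|rn] : (\rank P = 0 \/ \rank P = n)%N.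
  move: eZ ne Pn; move: (_ - (\rank E)%:Z) (\rank P) => k p.
  move=> eZ ne Pn; have [k0|[k1|k1]] : k = 0 \/ k <= -1 \/ 1 <= k by lia.
  - by move: eZ; rewrite k0 mulr0; lia.
  - left; have : n%:Z * k <= n%:Z * -1 by apply: ler_wpM2l.
    lia.
  - right; have : n%:Z * 1 <= n%:Z * k by apply: ler_wpM2l.
    lia.
- right; apply/eqP; rewrite -addr_eq0 addrC; apply/eqP.
  have /eqP : P == 0 by rewrite -mxrank_eq0 r0.
  by move=> P0; rewrite -[LHS](half) -scalerDr; move: P0; rewrite /P => /eqP;
    rewrite scaler_eq0 invr_eq0 (negPf two0) /= => /eqP ->; rewrite addr0 scaler0.
- left; have Pu : P \in unitmx by rewrite -row_free_unit /row_free rn.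
  have P1 : P = 1%:M by rewrite -[P](mulKmx Pu) PP mulVmx.
  have : 2%:R *: P = 1%:M + T by rewrite /P scalerA mulfV // scale1r.
  rewrite P1 -[2%:R]/(1 + 1 : F) scalerDl scale1r => /addrI; by move=> <-.
Qed.

End Matrices.

(** * Nonvanishing of the trace of the squared antipode *)

Lemma comul_grouplikeX (K : fieldType) (H : hopfType K) (g : H) k :
  comul g = g \otimes g -> comul (g ^+ k) = (g ^+ k) \otimes (g ^+ k).
Proof.
move=> cg; elim: k => [|k IH]; first by rewrite !expr0 comul1.
rewrite exprS comulM cg IH tsum_tmul; last by bil_tac.
by rewrite tsum_tmul; last by bil_tac.
Qed.

Lemma free_rcons (K : fieldType) (V : vectType K) (X : seq V) v :
  free (rcons X v) = (v \notin <<X>>%VS) && free X.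
Proof. by rewrite (perm_free (Y := v :: X)) ?free_cons // perm_rcons. Qed.

(** Take the first power g^m that depends linearly on the earlier ones. Group-likeness forces its
    coefficients to be orthogonal idempotents of the field, so g^m = g^i with i < m, and g^i
    cancels. *)
Lemma grouplike_finite_order (K : fieldType) (H : hopfType K) (g h : H) :
  comul g = g \otimes g -> h * g = 1 -> exists2 N, (0 < N)%N & g ^+ N = 1.
Proof.
move=> cg hg.
pose X m := [seq g ^+ i | i <- iota 0 m].
have szX m : size (X m) = m by rewrite size_map size_iota.
have XS m : X m.+1 = rcons (X m) (g ^+ m).
  by rewrite /X -addn1 iotaD map_cat cats1.
have exm : exists m, ~~ free (X m).
  exists (\dim {:H}).+1; apply/negP => fX.
  have := dimvS (subvf <<X (\dim {:H}).+1>>%VS).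
  by move/eqP: fX => ->; rewrite szX ltnn.
have [m nf mmin] := ex_minnP exm.
have m0 : (0 < m)%N by rewrite lt0n; apply/eqP => m0; move: nf; rewrite m0 nil_free.
case: m m0 nf mmin => // m _ nf mmin.
have fX : free (X m) by apply/negPn/negP => /mmin; rewrite ltnn.
have gin : g ^+ m \in <<X m>>%VS by apply/negPn; move: nf;
  rewrite XS free_rcons fX andbT.
pose Y := Tuple (introT eqP (szX m)).
have YE (i : 'I_m) : Y`_i = g ^+ i by rewrite (nth_map 0%N) ?size_iota // nth_iota.
have gE : g ^+ m = \sum_(i < m) coord Y i (g ^+ m) *: g ^+ i.
  by rewrite [LHS](coord_span (X := Y) gin); apply: eq_bigr => i _; rewrite YE.
have cY (i j : 'I_m) : coord Y i (g ^+ j) = (i == j)%:R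
  by rewrite -YE coord_free // eq_sym.
set c := fun i : 'I_m => coord Y i (g ^+ m).
(* Compare the coefficients of g^i (x) g^j in two expansions of comul(g^m). *)
have cc i j : c i * c j = c i * (i == j)%:R.
  pose P (t : tens H H) : K^o :=
    \tsum_(u \otimes v <- t) (coord Y i u * coord Y j v : K^o).
  have bP : is_bilinear (fun u v : H => coord Y i u * coord Y j v : K^o) by bil_tac.
  have lP : linear P by exact: tsum_linear.
  have P1 k : P (comul (g ^+ k)) = coord Y i (g ^+ k) * coord Y j (g ^+ k).
    by rewrite comul_grouplikeX // /P tsum_tmul.
  have lPc : linear (fun x : H => P (comul x)) by apply: lin_comp => //; lin_tac.
  rewrite -[LHS]P1 [in LHS]gE (linear_of_sum lPc) (bigD1 i) //= big1.
    by rewrite addr0 P1 !cY eqxx mul1r eq_sym.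
  by move=> k ki; rewrite P1 !cY eq_sym (negPf ki) mul0r scaler0.
have hk k : h ^+ k * g ^+ k = 1.
  elim: k => [|k IH]; first by rewrite mulr1.
  by rewrite exprSr exprS mulrA -(mulrA _ h) hg mulr1.
have gm0 : g ^+ m != 0.
  by apply/eqP=> gm; have /esym/eqP := hk m; rewrite gm mulr0 oner_eq0.
have [i ci|c0] := pickP (fun i => c i != 0); last first.
  case/eqP: gm0; rewrite gE big1 // => i _; have /negbFE := c0 i;
    rewrite /c => /eqP ->.
  by rewrite scale0r.
have ci1 : c i = 1 by apply: (mulfI ci); rewrite cc eqxx.
have gmi : g ^+ m = g ^+ i.
  rewrite gE (bigD1 i) //= big1 => [|j ji]; first
    by rewrite -/(c i) ci1 scale1r addr0.
  have := cc j i; rewrite (negPf ji) mulr0 ci1 mulr1 /c => ->; exact: scale0r.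
exists (m - i)%N; first by rewrite subn_gt0.
have : h ^+ i * (g ^+ i * g ^+ (m - i)) = h ^+ i * g ^+ i.
  by rewrite -exprD subnKC ?gmi // ltnW.
by rewrite mulrA hk mul1r.
Qed.

Section LarsonRadford.
Variables (K : closedFieldType) (H : hopfType K).
Hypotheses (ch0 : [pchar K] =i pred0) (ssH : semisimple_alg H).
Local Notation S := (@antipode K H).
Local Notation lam := (@lam K H).
Local Notation tr := (@ltr K H).

Section Integral.
Variable L : H.
Hypotheses (epsL : counit L = 1) (intl : forall h, h * L = (counit h : K) *: L)
  (intr : forall h, L * h = (counit h : K) *: L).
Local Notation g := (modular L).
Local Notation T := (antipode_inv H).

Let lnd_r := lam_nondeg_r epsL intr.
Let SVK := antipodeVK epsL intr.
Let SK := antipodeK epsL intr.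

(** The density of the regular trace with respect to [lam], see [ltr_lam]. *)
Definition casimir_trace : H := \tsum_(l1 \otimes l2 <- comul L) (tr l2 :
  K) *: S l1.
Local Notation w := casimir_trace.

Lemma ltr_lam h : tr h = lam (h * w).
Proof.
have l1 : linear (fun x => lam (h * x)) by lin_tac.
have l2 : linear tr by lin_tac.
rewrite -(frobenius_r epsL intr h l2) /casimir_trace (lin_tsumE l1).
by apply: eq_tsum => a b; rewrite -scalerAr linearZ; exact: mulrC.
Qed.

Lemma lam_eq_r x y : (forall z, lam (z * x) = lam (z * y)) -> x = y.
Proof.
move=> e; apply/eqP; rewrite -subr_eq0; apply/eqP/lnd_r => z.
by rewrite mulrBr linearB e /= subrr.
Qed.

(** The regular trace is symmetric while [lam] is symmetric only up to S^2; the density accounts for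
    the difference. *)
Lemma casimir_trace_comm x : x * w = w * S (S x).
Proof.
apply: lam_eq_r => z; rewrite [in RHS]mulrA -lamC !mulrA -!ltr_lam.
exact: ltrC.
Qed.

(** If y w = 0, then y is in the radical of the trace form, hence zero. So right multiplication by w
    is injective, and bijective by dimension. *)
Lemma casimir_trace_unit : exists2 v, v * w = 1 & w * v = 1.
Proof.
have inj y : y * w = 0 -> y = 0.
  move=> yw; apply: (ltr_nondeg ssH ch0) => x.
  by rewrite ltr_lam -mulrA yw mulr0 linear0.
have ker0 : lker (amulr w) == 0%VS.
  apply/lker0P => x y; rewrite !lfunE /= => e; apply/eqP; rewrite -subr_eq0.
  by apply/eqP/inj; rewrite mulrBl e subrr.
have [v vw] : exists v, v * w = 1.
  exists ((amulr w)^-1%VF 1).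
  by have := lker0_lfunVK ker0 1; rewrite lfunE.
exists v => //; apply/eqP; rewrite -subr_eq0; apply/eqP/inj.
by rewrite mulrBl mul1r -mulrA vw mulr1 subrr.
Qed.

(* Equivalently, w acts on each irreducible module with trace its dimension. *)
Lemma ltr_casimir_central x : (forall y, y * x = x * y) -> tr (w * x) = tr x.
Proof.
move=> xC; rewrite ltrE (ltrace_lam epsL intr); last exact: linear_lmul.
rewrite ltr_lam xC.
have l1 : linear (fun z => lam (T z * (w * x))) by lin_tac.
transitivity (\tsum_(l1 \otimes l2 <- comul L) lam (T (l1 * S l2) * (w * x))).
  apply: eq_tsum => a b.
  suff -> : T (a * S b) * (w * x) = b * (x * w * S a) by [].
  rewrite (antipodeVM epsL intr) SK -[LHS]mulrA -[x * w * _]mulrA -xC.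
  by rewrite -{1}[a in RHS]SVK -casimir_trace_comm !mulrA.
rewrite (comul_antipoder L l1) epsL (antipodeV1 epsL intr) mul1r xC.
exact: scale1r.
Qed.

Definition casimir_square : H := w * w * S g.
Local Notation z := casimir_square.

(** Both w^2 and g induce S^4 by conjugation, and S(g) = g^-1. *)
Lemma casimir_square_central x : x * z = z * x.
Proof.
have Kg := modularK epsL intr; have Vg := modularVK epsL intr.
have e : S (S (S (S x))) * S g = S g * x.
  by rewrite -[RHS]mulr1 -Vg !mulrA -(mulrA _ x) (modular_antipode4 intl intr) mulrA Kg mul1r.
rewrite /casimir_square !mulrA (casimir_trace_comm x) -(mulrA w) (casimir_trace_comm (S (S x))).
by rewrite -!mulrA e !mulrA.
Qed.

Lemma casimir_squareE : w * w = z * g.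
Proof. by rewrite /casimir_square -mulrA (modularK epsL intr) mulr1. Qed.

(** Here lam 1 = tr(v) with v = w^-1. The matrix criterion is applied to left multiplication by w, z
    and v; as g^N = 1, the relation w^2 = z g gives w^(2N) = z^N. *)
Lemma lam1_neq0 : lam 1 != 0.
Proof.
have Kg := modularK epsL intr; have Vg := modularVK epsL intr.
have [v vw wv] := casimir_trace_unit.
have -> : lam 1 = tr v by rewrite ltr_lam vw.
have [N N0 gN] := grouplike_finite_order (modular_grouplike epsL intr) Kg.
have zC := casimir_square_central.
have wN : w ^+ (2 * N) = z ^+ N.
  rewrite exprM expr2 casimir_squareE exprMn_comm; last exact/esym/zC.
  by rewrite gN mulr1.
have zu : (v * v * g) * z = 1.
  rewrite -mulrA zC -casimir_squareE -mulrA (mulrA v w) vw mul1r //.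
pose A := lmx (fun y => w * y); pose Z := lmx (fun y => z * y).
pose Zi := lmx (fun y => (v * v * g) * y); pose B := lmx (fun y => v * y).
have tX x : tr x = \tr (lmx (fun y => x * y)) by rewrite ltrE.
rewrite tX -/B.
have mulE (x y : H) := lmx_mul x y.
have oneE : lmx (fun y : H => 1 * y) = 1%:M.
  by rewrite -(lmx_id H); apply: eq_lmx => y; rewrite mul1r.
have AB : A *m B = 1%:M by rewrite -mulE vw oneE.
have ZiZ : Z *m Zi = 1%:M by rewrite -mulE zu oneE.
have AZ : A *m Z = Z *m A by rewrite -!mulE zC.
have pE x k : lmx (fun y : H => x ^+ k * y) = iter k (mulmx (lmx (fun y :
  H => x * y))) 1%:M.
  by elim: k => [|k IH] //=; rewrite -IH -mulE exprSr.
have wNm : iter (2 * N) (mulmx A) 1%:M = iter N (mulmx Z) 1%:M by rewrite -!pE wN.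
have trk k : \tr (A *m iter k (mulmx Z) 1%:M) = \tr (iter k (mulmx Z) 1%:M).
  rewrite -pE -mulE -!tX; transitivity (tr (w * z ^+ k)).
    by rewrite ltrC.
  apply: ltr_casimir_central => y.
  by apply: commrX; exact: zC.
(* z acts diagonalizably: evaluating the product of its distinct linear
   factors at z gives the central element c, which is nilpotent. *)
pose pz (r : seq K) := foldr (fun a M => M *m (Z - a%:M)) 1%:M r.
have pzE r : lmx (fun y => horner_alg z (\prod_(a <- r) ('X - a%:P)) * y) = pz r.
  elim: r => [|a r IH]; first by rewrite big_nil rmorph1 oneE.
  rewrite big_cons rmorphM mulE IH /=; congr (_ *m _).
  rewrite rmorphB /= horner_algX horner_algC.
  rewrite (eq_lmx (g := fun y => - a *: y + z * y)); last first.
    by move=> y; rewrite mulrBl -scalerAl mul1r scaleNr addrC.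
  by rewrite lmx_linear lmx_id scaleNr -[a%:M]scalemx1 addrC.
have [r0 r0z] := mx_annihilated Z.
pose r := undup r0; pose c := horner_alg z (\prod_(a <- r) ('X - a%:P)).
have cC y : y * c = c * y.
  rewrite /c; elim/poly_ind: (\prod_(a <- r) _) => [|p a IH]; first
    by rewrite rmorph0 mul0r mulr0.
  rewrite rmorphD rmorphM /= horner_algX horner_algC mulrDl mulrDr mulrA IH -(mulrA (horner_alg z p) y) (zC y) (mulrA (horner_alg z p)).
  by rewrite -scalerAl -scalerAr mul1r mulr1.
have c0 : c = 0.
  apply: (central_nilpotent_eq0 ssH (k := size r0) cC).
  rewrite /c -rmorphXn /=.
  have /dvdpP[q ->] :
    \prod_(a <- r0) ('X - a%:P) %| (\prod_(a <- r) ('X - a%:P)) ^+ size r0.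
    have : {subset r0 <= r} by move=> a; rewrite mem_undup.
    elim: (r0) => [|a s IH] sr; first by rewrite big_nil dvd1p.
    rewrite big_cons exprS dvdp_mul ?IH //.
      by rewrite dvdp_XsubCl root_prod_XsubC sr ?mem_head.
    by move=> b bs; rewrite sr // in_cons bs orbT.
  rewrite rmorphM /= (_ : horner_alg z (\prod_(a <- r0) _) = 0) ?mulr0 //.
  apply: lmx_mul_inj; rewrite pzE [pz _]r0z.
  by apply/matrixP=> i j; rewrite !mxE mul0r linear0.
apply: (mxtrace_inverse_neq0_gen ch0 _ N0 AZ wNm ZiZ (undup_uniq r0) _ trk AB).
  by rewrite adim_gt0.
rewrite -/(pz _) -pzE -/c c0.
by apply/matrixP=> i j; rewrite !mxE mul0r linear0.
Qed.

End Integral.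
End LarsonRadford.

(** * The Larson-Radford theorem *)

Section RegularCharacter.
Variables (K : fieldType) (H : hopfType K).
Local Notation S := (@antipode K H).
Local Notation lam := (@lam K H).
Local Notation n := (\dim {:H}).
Local Notation e := (vbasis {:H}).

(** Represents the functional phi |-> Tr (x |-> phi(x_2) u x_1) on the dual of H. *)
Definition coreg_twist (u : H) : H := \sum_(i < n)
  \tsum_(x \otimes y <- comul e`_i) (coord e i (u * x) : K) *: y.

(* The element of H that represents the regular character of H^*. *)
Definition coreg : H := coreg_twist 1.
Local Notation c := coreg.

Lemma coreg_twist_linear : linear coreg_twist.
Proof. by rewrite /coreg_twist; lin_tac. Qed.

Lemma coregE : c = \sum_(i < n)
  \tsum_(x \otimes y <- comul e`_i) (coord e i x : K) *: y.
Proof.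
by apply: eq_bigr => i _; apply: eq_tsum => x y; rewrite mul1r.
Qed.

Lemma linear_sumE (U V : lmodType K) (f : U -> V) I (r : seq I) (F : I -> U) :
  linear f -> f (\sum_(i <- r) F i) = \sum_(i <- r) f (F i).
Proof.
move=> lf; under eq_bigr do rewrite -[F _]scale1r.
by rewrite (linear_of_sum lf); apply: eq_bigr => i _; rewrite !scale1r.
Qed.

Lemma linear_coreg (U : lmodType K) (f : H -> U) : linear f ->
  f c = \sum_(i < n) \tsum_(x \otimes y <- comul e`_i) (coord e i x : K) *: f y.
Proof.
move=> lf; rewrite coregE (linear_sumE _ _ lf); apply: eq_bigr => i _.
by rewrite (lin_tsumE lf); apply: eq_tsum => x y; rewrite (linear_of_scale lf).
Qed.

(** The integral property reduces the i-th term to lam(e_i) times the i-th coordinate of 1. *)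
Lemma lam_coreg : lam c = lam 1.
Proof.
have ll : linear lam by lin_tac.
rewrite (linear_coreg ll) (linear_coordE 1 ll); apply: eq_bigr => i _.
have lc : linear (fun x : H => coord e i x : K^o) by lin_tac.
transitivity ((lam e`_i : K) *: (coord e i 1 : K^o)); last exact: mulrC.
by rewrite -(lam_integral _ lc); apply: eq_tsum => x y; exact: mulrC.
Qed.

Lemma counit_coreg : counit c = n%:R.
Proof.
have le : linear (@counit K H) by lin_tac.
rewrite (linear_coreg le) -[n in RHS]card_ord -sumr_const; apply: eq_bigr => i _.
have lc : linear (fun x : H => coord e i x : K^o) by lin_tac.
transitivity (coord e i e`_i : K^o); last first.
  by rewrite coord_free ?eqxx // (basis_free (vbasisP _)).
by rewrite -[RHS](comul_counitr _ lc); apply: eq_tsum => x y; exact: mulrC.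
Qed.

(** By coassociativity, comul(c) is a trace of two successive coactions, and [ltrace_cyc] exchanges
    them. *)
Lemma coreg_cocommutative (U : lmodType K) (m : H -> H -> U) : is_bilinear m ->
  \tsum_(x \otimes y <- comul c) m x y = \tsum_(x \otimes y <- comul c) m y x.
Proof.
move=> bm.
have lm1 y : linear (m^~ y) by exact: bm.1.
have lm2 x : linear (m x) by exact: bm.2.
have ex (m' : H -> H -> U) : (forall y, linear (m'^~ y)) ->
  (forall x, linear (m' x)) ->
   \tsum_(x \otimes y <- comul c) m' x y = \sum_(i < n)
   \tsum_(x \otimes z <- comul e`_i) \tsum_(x' \otimes y <- comul x)
     (coord e i x' : K) *: m' y z.
  move=> l1 l2.
  have bm' : is_bilinear m' by split=> ?; [exact: l1 | exact: l2].
  have l : linear (fun a : H => \tsum_(x \otimes y <- comul a) m' x y).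
    by apply: (lin_comp (f := fun t : tens H H => tsum t m'));
      [exact: tsum_linear | lin_tac].
  rewrite (linear_coreg l); apply: eq_bigr => i _.
  rewrite (comul_assoc_sum (F := fun x y z => (coord e i x : K) *: m' y z)).
  - by apply: eq_tsum => x y; rewrite tsum_scaler.
  - by move=> y z; lin_tac.
  - by move=> x z; apply: lin_scale_r; exact: l1.
  - by move=> x y; apply: lin_scale_r; exact: l2.
rewrite ex // (ex (fun x y => m y x)) //.
have lD : linear (@comul K H) by lin_tac.
by rewrite -(ltrace_cyc lD lD bm).
Qed.

(** Insert S(k_1) k_2 under the coordinate. The factors k_2 and k_3 then form the comultiplication
    of k_2 e_i, and cyclicity moves k_2 to the left of S(k_1). *)
Lemma mul_coreg k : k * c =
  \tsum_(k1 \otimes k2 <- comul k) coreg_twist (k2 * S k1).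
Proof.
have lk u : linear (fun x : H => u * x) by exact: linear_lmul.
rewrite (linear_coreg (lk k)).
pose f (u x : H) : tens H H := (u * x) \otimes 1.
pose h (v x : H) : tens H H := \tsum_(y \otimes z <- comul x) ((v * y) \otimes z).
have lf u : linear (f u) by rewrite /f; lin_tac.
have lh v : linear (h v) by rewrite /h; lin_tac.
have bm : is_bilinear (fun x y : H => x * y) by bil_tac.
transitivity (\tsum_(k1 \otimes k2 <- comul k) \sum_(i < n)
   \tsum_(x \otimes a <- f k2 e`_i) \tsum_(y \otimes l <- h (S k1) x)
    coord e i y *: (a * l)); last first.
  apply: eq_tsum => k1 k2; rewrite (ltrace_cyc (lf k2) (lh (S k1)) bm).
  apply: eq_bigr => i _; rewrite /h tsum_tsum; last by rewrite /f; bil_tac.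
  apply: eq_tsum => y l; rewrite tsum_tmul; last by rewrite /f; bil_tac.
  by rewrite /f tsum_tmul ?mul1r ?mulrA //; bil_tac.
rewrite [RHS]/tsum exchange_big; apply: eq_bigr => i _ /=.
transitivity (\tsum_(k1 \otimes k2 <- comul k) \tsum_(x \otimes y <- comul e`_i)
   \tsum_(a \otimes b <- comul k2) (coord e i (S k1 * (a * x)) : K) *: (b * y));
     last first.
  apply: eq_bigr => -[k1 k2] _ /=; rewrite /f tsum_tmul; last by rewrite /h;
    bil_tac.
  rewrite /h tsum_tsum; last by bil_tac.
  transitivity (\tsum_(y \otimes z <- comul (k2 * e`_i)) (coord e i (S k1 * y) :
    K) *: z); last first.
    by apply: eq_tsum => y z; rewrite tsum_tmul ?mul1r //; bil_tac.
  have bG : is_bilinear (fun y z : H => (coord e i (S k1 * y) : K) *: z) by bil_tac.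
  by rewrite (tsum_comulM _ _ bG) [RHS]tsum_exchange.
rewrite tsum_exchange; apply: eq_tsum => x y.
rewrite -(comul_assoc_sum (F := fun k1 a b => (coord e i (S k1 * (a * x)) :
  K) *: (b * y)));
  try by move=> *; lin_tac.
have l1 : linear (fun b : H => (coord e i x : K) *: (b * y)) by lin_tac.
rewrite -(comul_counitl k l1); apply: eq_tsum => a b.
have l2 : linear (fun u : H => (coord e i (u * x) : K) *: (b * y)) by lin_tac.
have := comul_antipodel a l2; rewrite mul1r => <-.
by apply: eq_tsum => k1 k2; rewrite mulrA.
Qed.

(** Cocommutativity turns c_2 S(c_1) in [mul_coreg] into c_1 S(c_2), which contracts to eps(c) =
    n. *)
Lemma coreg_square : c * c = (n%:R : K) *: c.
Proof.
rewrite mul_coreg.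
have bm : is_bilinear (fun x y : H => coreg_twist (y * S x)).
  by split=> ?; apply: (lin_comp coreg_twist_linear); lin_tac.
rewrite (coreg_cocommutative bm) (comul_antipoder _ coreg_twist_linear).
by rewrite counit_coreg.
Qed.

(** S^2 respects [comul], so S^2(c) is the same trace conjugated by S^2; S^4 = id lets S^2 serve as
    its own inverse. *)
Lemma antipode2_coreg : (forall h, S (S (S (S h))) = h) -> S (S c) = c.
Proof.
move=> S4.
have lS : linear (fun x : H => S (S x)) by lin_tac.
rewrite (linear_coreg lS).
pose f (x : H) : tens H H := S (S x) \otimes 1.
pose h (x : H) : tens H H := \tsum_(y \otimes z <- comul x) (S (S y) \otimes z).
have lf : linear f by rewrite /f; lin_tac.
have lh : linear h by rewrite /h; lin_tac.
have bm : is_bilinear (fun x y : H => x * y) by bil_tac.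
transitivity (\sum_(i < n) \tsum_(x \otimes a <- f e`_i) \tsum_(y \otimes l <- h x)
    coord e i y *: (a * l)).
  apply: eq_bigr => i _; rewrite /f tsum_tmul; last by rewrite /h; bil_tac.
  rewrite /h tsum_tsum; last by bil_tac.
  transitivity (\tsum_(y \otimes z <- comul (S (S e`_i))) (coord e i (S (S y)) :
    K) *: z); last first.
    by apply: eq_tsum => y z; rewrite tsum_tmul ?mul1r //; bil_tac.
  rewrite tsum_comul_antipode2; last by bil_tac.
  by apply: eq_tsum => y z; rewrite S4.
rewrite (ltrace_cyc lf lh bm) coregE; apply: eq_bigr => i _.
rewrite /h tsum_tsum; last by rewrite /f; bil_tac.
apply: eq_tsum => y l; rewrite tsum_tmul; last by rewrite /f; bil_tac.
by rewrite /f tsum_tmul ?mul1r ?S4 //; bil_tac.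
Qed.

End RegularCharacter.

Theorem semisimple_antipode2 (K : closedFieldType) (H : hopfType K) :
  [pchar K] =i pred0 -> semisimple_alg H ->
  forall h : H, antipode (antipode h) = h.
Proof.
move=> ch0 ssH.
have [L [epsL intl intr]] := integral_exists ssH.
have l1 := lam1_neq0 ch0 ssH epsL intl intr.
(* At h = 1, [lam_modular] reads lam(1) 1 = lam(1) g. *)
have g1 : modular L = 1.
  have := lam_modular epsL intr 1 (@lin_id K H).
  rewrite comul1 tsum_tmul; last by bil_tac.
  by move=> e;
    rewrite -[LHS]scale1r -[X in X *: _](mulVf l1) -scalerA -e scalerA mulVf // scale1r.
have S4 (h : H) : antipode (antipode (antipode (antipode h))) = h.
  by have := modular_antipode4 intl intr h; rewrite g1 mulr1 mul1r.
pose n := \dim {:H}.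
have n0 : n%:R != 0 :> K by rewrite ((pcharf0P K).1 ch0) -lt0n adim_gt0.
pose p : H := n%:R^-1 *: coreg H.
pose T := lmx (fun x : H => antipode (antipode x)).
pose E := lmx (fun x : H => p * x).
have lS : linear (fun x : H => antipode (antipode x)) by lin_tac.
have TT : T *m T = 1%:M.
  by rewrite -(lmx_comp _ lS) -(lmx_id H); apply: eq_lmx => x /=; rewrite S4.
have pp : p * p = p.
  by rewrite /p -scalerAl -scalerAr coreg_square !scalerA -mulrA mulVf // mulr1.
have Sp : antipode (antipode p) = p.
  by rewrite (linear_of_scale lS) antipode2_coreg.
have EE : E *m E = E by rewrite -lmx_mul pp.
have ETE : E *m T = lmx (fun x : H => p * antipode (antipode x)).
  by rewrite -(lmx_comp _ lS); apply: eq_lmx => x; rewrite !antipodeM Sp.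
have ET : E *m T = T *m E.
  by rewrite ETE -(lmx_comp _ (linear_lmul p)).
have trT : \tr T = lam H 1.
  rewrite lamE -[LHS]/(ltrace _) /ltrace; congr (\tr _).
  by apply: eq_lmx => x; rewrite mul1r.
(* Tr (p S^2) is lam(p) by definition of [lam], and n lam(p) = lam(c) = lam(1) = Tr (S^2). *)
have trE : n%:R * \tr (E *m T) = \tr T.
  rewrite ETE -[\tr (lmx _)]/(ltrace _) -lamE trT /p linearZ lam_coreg.
  by rewrite mulrA mulfV // mul1r.
have trT0 : \tr T != 0 by rewrite trT.
have [T1|TN] := involution_scalar ch0 TT EE ET trE trT0.
- move=> h; apply: (lmx_inj lS (@lin_id _ _)) => //.
  by rewrite -/T T1 lmx_id.
(* The sign -1 is excluded by S^2(1) = 1 and characteristic zero. *)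
- have e : lmx (fun x : H => antipode (antipode x)) = lmx (fun x : H => - 1 *: x).
    by rewrite lmxZ lmx_id scaleN1r.
  have lN : linear (fun x : H => - 1 *: x) by apply: lin_scale_r.
  have := lmx_inj lS lN e 1; rewrite !antipode1 scaleN1r => /eqP.
  rewrite -addr_eq0 -(natrD _ 1 1) -scaler_nat scaler_eq0 oner_eq0 orbF.
  by rewrite ((pcharf0P K).1 ch0).
Qed.

(** * Induced modules *)

Section Evaluation.
Variables (K : fieldType) (H : hopfType K) (X : lmodType K).
Local Notation dual := 'Hom(H, K^o).

(** Turns identities in the tensor product into identities of functions on H, where dual-basis sums
    and the coproduct of the dual become explicit. *)
Definition tev (x : tens dual X) (y : H) : X :=
  \tsum_(phi \otimes u <- x) (phi y : K) *: u.

Lemma tev_linear y : linear (tev^~ y).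
Proof. by rewrite /tev; lin_tac. Qed.

Lemma tev_lin x : linear (tev x).
Proof. by rewrite /tev; lin_tac. Qed.

Lemma tev_tmul (phi : dual) (u : X) y : tev (phi \otimes u) y = (phi y : K) *: u.
Proof. by rewrite /tev tsum_tmul //; bil_tac. Qed.

(** By finite dimension [G] rebuilds a tensor from its values on a basis. *)
Lemma tev_inj x x' : tev x =1 tev x' -> x = x'.
Proof.
set e := vbasis {:H}.
pose G (f : H -> X) : tens dual X :=
  \sum_(i < \dim {:H}) (dual_basis e i \otimes f e`_i).
have GE z : G (tev z) = z.
  move: z; apply: tens_eq_linear => [||f h]; [ | exact: lin_id | ].
    rewrite /G; apply: lin_sum => i; apply: lin_tmul_r; exact: (tev_linear e`_i).
  have fE : f = \sum_(i < \dim {:H}) (f e`_i : K) *: dual_basis e i.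
    apply/lfunP=> y; rewrite {1}(coord_vbasis (memvf y)) linear_sum sum_lfunE.
    apply: eq_bigr => i _; rewrite linearZ scale_lfunE dual_basisE.
    exact: mulrC.
  rewrite [in RHS]fE (linear_of_sum (lin_tmul_l _ (@lin_id _ _))).
  apply: eq_bigr => i _; rewrite tev_tmul.
  by rewrite (linear_of_scale (lin_tmul_r _ (@lin_id _ _))).
move=> xx'; rewrite -[x]GE -[x']GE; apply: eq_bigr => i _; by rewrite xx'.
Qed.

End Evaluation.

Section InducedAction.
Variables (K : fieldType) (H : hopfType K) (U : lmodType H).
Local Notation dual := 'Hom(H, K^o).
Local Notation S := (@antipode K H).

Lemma ind_act_linear_l (x : Ind U) : linear (fun d : Defs.double H => ind_act d x).
Proof. by rewrite /ind_act; lin_dual_tac. Qed.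

Lemma ind_act_linear_r (d : Defs.double H) : linear (ind_act d : Ind U -> Ind U).
Proof. by rewrite /ind_act; lin_dual_tac. Qed.

(** Evaluating the two coproducts of the dual by [dual_comulE] merges the three legs of phi' into
    one value at S(h_3) y_2 h_1. *)
Lemma tev_ind_act (phi : dual) (h : H) (x : Ind U) y :
  tev (ind_act (phi \otimes h : Defs.double H) x) y =
  \tsum_(y1 \otimes y2 <- comul y) \tsum_(h1 \otimes h23 <- comul h)
  \tsum_(h2 \otimes h3 <- comul h23)
    (phi y1 : K) *: hact h2 (tev x (S h3 * (y2 * h1))).
Proof.
have lev g : linear (fun x : Ind U => tev x g) by move=> a u v; exact: tev_linear.
move: x; apply: tens_eq_linear.
- exact: (lin_comp (lev y) (ind_act_linear_r _)).
- by do 3!(apply: lin_tsum_r => ? ?); apply: lin_scale_r; apply: lin_hact_r;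
  exact: lev.
move=> phi' u; rewrite ind_actE.
have ly : linear (fun x : Ind U => tev x y) by exact: lev.
rewrite (lin_tsumE ly) [RHS]tsum_exchange; apply: eq_tsum => h1 h23.
rewrite (lin_tsumE ly) [RHS]tsum_exchange; apply: eq_tsum => h2 h3.
rewrite (lin_tsumE ly).
transitivity (\tsum_(y1 \otimes y2 <- comul y) \tsum_(phi1 \otimes phi23 <- dual_comul phi')
   (phi y1 * (phi1 (S h3) * phi23 (y2 * h1)) : K) *: hact h2 u); last first.
  apply: eq_tsum => y1 y2; rewrite tev_tmul.
  have lc : linear (fun a : K^o => (phi y1 : K) *: ((a : K) *: hact h2 u)).
    by apply: lin_scale_r; apply: lin_scale_l; exact: lin_id.
  have lh := linear_of_scale (lin_hact_r h2 (@lin_id K (restr U))).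
  rewrite lh -dual_comulE (lin_tsumE lc); apply: eq_tsum => phi1 phi23.
  by rewrite scalerA.
rewrite tsum_exchange; apply: eq_tsum => phi1 phi23.
rewrite (lin_tsumE ly).
transitivity (\tsum_(y1 \otimes y2 <- comul y) \tsum_(phi2 \otimes phi3 <- dual_comul phi23)
   (phi y1 * (phi1 (S h3) * (phi2 y2 * phi3 h1)) : K) *: hact h2 u); last first.
  apply: eq_tsum => y1 y2; rewrite -dual_comulE.
  have lc : linear (fun a : K^o => (phi y1 * (phi1 (S h3) * (a : K)) :
    K) *: hact h2 u).
    by apply: lin_scale_l; apply: lin_kmul_r; apply: lin_kmul_r; exact: lin_id.
  by rewrite (lin_tsumE lc).
rewrite tsum_exchange; apply: eq_tsum => phi2 phi3.
rewrite (linear_of_scale ly) tev_tmul dual_mulE.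
have lc : linear (fun a : K^o => (phi1 (S h3) * phi3 h1) *: ((a : K) *: hact h2 u)).
  by apply: lin_scale_r; apply: lin_scale_l; exact: lin_id.
rewrite (lin_tsumE lc); apply: eq_tsum => y1 y2.
rewrite scalerA; congr (_ *: _).
by rewrite mulrCA -!mulrA [phi3 _ * _]mulrC !mulrA [phi y1 * _]mulrC.
Qed.

End InducedAction.

(** * Actions on tensor products, with and without the flip *)

Section TensorActions.
Variables (K : fieldType) (H : hopfType K).
Implicit Types (V W : lmodType H).

Definition keep_act V W (p k : H) (t : tens (restr V) (restr W)) :
    tens (restr V) (restr W) :=
  \tsum_(v \otimes w <- t) (hact p v \otimes hact k w).

Definition swap_act V W (p k : H) (t : tens (restr V) (restr W)) :
    tens (restr W) (restr V) :=
  \tsum_(v \otimes w <- t) (hact p w \otimes hact k v).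

Lemma keep_act_linear V W p k : linear (@keep_act V W p k).
Proof. by rewrite /keep_act; lin_tac. Qed.

Lemma swap_act_linear V W p k : linear (@swap_act V W p k).
Proof. by rewrite /swap_act; lin_tac. Qed.

Lemma keep_act_tmul V W p k v w :
  @keep_act V W p k (v \otimes w) = hact p v \otimes hact k w.
Proof. by rewrite /keep_act tsum_tmul //; bil_tac. Qed.

Lemma swap_act_tmul V W p k v w :
  @swap_act V W p k (v \otimes w) = hact p w \otimes hact k v.
Proof. by rewrite /swap_act tsum_tmul //; bil_tac. Qed.

Lemma hactA (U : lmodType H) p k (v : restr U) : hact p (hact k v) = hact (p * k) v.
Proof. by rewrite /hact scalerA. Qed.

Lemma swap_swap V W p k q l t :
  swap_act p k (@swap_act V W q l t) = keep_act (p * l) (k * q) t.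
Proof.
move: t; apply: tens_eq_linear.
- by apply: lin_comp; exact: swap_act_linear.
- exact: keep_act_linear.
by move=> v w; rewrite !swap_act_tmul keep_act_tmul !hactA.
Qed.

Lemma swap_keep V W p k q l t :
  swap_act p k (@keep_act V W q l t) = swap_act (p * l) (k * q) t.
Proof.
move: t; apply: tens_eq_linear.
- by apply: lin_comp; [exact: swap_act_linear | exact: keep_act_linear].
- exact: swap_act_linear.
by move=> v w; rewrite keep_act_tmul !swap_act_tmul !hactA.
Qed.

Lemma keep_swap V W p k q l t :
  keep_act p k (@swap_act V W q l t) = swap_act (p * q) (k * l) t.
Proof.
move: t; apply: tens_eq_linear.
- by apply: lin_comp; [exact: keep_act_linear | exact: swap_act_linear].
- exact: swap_act_linear.
by move=> v w; rewrite !swap_act_tmul keep_act_tmul !hactA.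
Qed.

Lemma keep1 V W t : @keep_act V W 1 1 t = t.
Proof.
move: t; apply: tens_eq_linear; [exact: keep_act_linear|exact: lin_id|].
by move=> v w; rewrite keep_act_tmul /hact !scale1r.
Qed.

Lemma hact_htens V W h (t : restr (htens V W)) :
  hact h t = \tsum_(p \otimes q <- comul h) keep_act p q t.
Proof. by []. Qed.

End TensorActions.

Section RestrLinear.
Variables (K : fieldType) (H : hopfType K) (V W V' W' : lmodType H).

(** On [restr (htens V W)] scalars act through the diagonal action, which is only provably equal to
    the scaling of the tensor product; linearity is therefore restated here. *)
Lemma lin_keep_act_l k t : linear (fun p => keep_act p k t : restr (htens V W)).
Proof. by apply: lin_to_restr_htens; rewrite /keep_act; lin_tac. Qed.

Lemma lin_keep_act_m p t : linear (fun k => keep_act p k t : restr (htens V W)).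
Proof. by apply: lin_to_restr_htens; rewrite /keep_act; lin_tac. Qed.

Lemma lin_keep_act_r p k :
  linear (@keep_act K H V W p k : restr (htens V W) -> restr (htens V W)).
Proof. move=> a x y; rewrite !restr_htens_scaleE; exact: keep_act_linear. Qed.

Lemma lin_swap_act_l k t : linear (fun p => @swap_act K H V W p k t :
  restr (htens W V)).
Proof. by apply: lin_to_restr_htens; rewrite /swap_act; lin_tac. Qed.

Lemma lin_swap_act_m p t : linear (fun k => @swap_act K H V W p k t :
  restr (htens W V)).
Proof. by apply: lin_to_restr_htens; rewrite /swap_act; lin_tac. Qed.

Lemma lin_swap_act_r p k :
  linear (@swap_act K H V W p k : restr (htens V W) -> restr (htens W V)).
Proof. move=> a x y; rewrite !restr_htens_scaleE; exact: swap_act_linear. Qed.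

End RestrLinear.

(** * The map beta on functions from H *)

Section BetaEvaluation.
Variables (K : fieldType) (H : hopfType K) (n : nat) (b : n.-tuple H).
Hypothesis basis_b : basis_of {:H} b.
Local Notation S := (@antipode K H).
Local Notation dual := 'Hom(H, K^o).

Lemma htens_ind_ext (V W : lmodType H) (X : lmodType K) (f g : Ind (htens V W) ->
  X) :
  linear f -> linear g ->
  (forall (phi : dual) (v : restr V) (w : restr W),
    f (phi \otimes (v \otimes w : restr (htens V W))) =
    g (phi \otimes (v \otimes w : restr (htens V W)))) -> f =1 g.
Proof.
move=> lf lg fg; apply: tens_eq_linear => // phi t.
have lt : linear (fun t : tens (restr V) (restr W) =>
    phi \otimes (t : restr (htens V W))).
  by apply: lin_tmul_r; apply: lin_to_restr_htens; exact: lin_id.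
exact: (tens_eq_linear (lin_comp lf lt) (lin_comp lg lt) (fg phi)).
Qed.

(** The sum over i is the expansion of the leg y_2 in the basis b. *)
Lemma sum_dual_basis (X : lmodType K) (phi : dual) (F : H -> X) y : linear F ->
  \sum_(i < n) (dual_mul phi (dual_basis b i) y : K) *: F b`_i =
  \tsum_(y1 \otimes y2 <- comul y) (phi y1 : K) *: F y2.
Proof.
move=> lF.
transitivity (\sum_(i < n) \tsum_(y1 \otimes y2 <- comul y)
   (phi y1 * coord b i y2 : K) *: F b`_i).
  apply: eq_bigr => i _; rewrite dual_mulE.
  have lc : linear (fun a : K^o => (a : K) *: F b`_i).
    by apply: lin_scale_l; exact: lin_id.
  by rewrite (lin_tsumE lc); apply: eq_tsum => y1 y2; rewrite dual_basisE.
rewrite /tsum exchange_big; apply: eq_bigr => p _ /=.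
rewrite [in RHS](coord_basis basis_b (memvf p.2)) (linear_of_sum lF) scaler_sumr.
by apply: eq_bigr => i _; rewrite scalerA.
Qed.

Section TwoModules.
Variables (V W : lmodType H).

Lemma beta_linear : linear (beta b V W).
Proof.
apply: lin_tsum_l; last exact: lin_id.
split=> [t|phi].
  by apply: lin_tsum_r => ? ?; apply: lin_sum => ?; apply: lin_tmul_l; lin_dual_tac.
move=> a x y; rewrite restr_htens_scaleE; apply: tsum_linear.
by split=> ?; apply: lin_sum => ?; apply: lin_tmul_r; apply: lin_to_restr_htens;
  lin_tac.
Qed.

Lemma beta_inv_linear : linear (beta_inv b V W).
Proof.
apply: lin_tsum_l; last exact: lin_id.
split=> [t|phi].
  by apply: lin_tsum_r => ? ?; apply: lin_sum => ?; apply: lin_tmul_l; lin_dual_tac.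
move=> a x y; rewrite restr_htens_scaleE; apply: tsum_linear.
by split=> ?; apply: lin_sum => ?; apply: lin_tmul_r; apply: lin_to_restr_htens;
  lin_tac.
Qed.

Lemma tev_beta x y : tev (beta b V W x) y =
  \tsum_(y1 \otimes y2 <- comul y)
    (swap_act 1 y2 (tev x y1) : restr (htens W V)).
Proof.
have lev Y (g : H) : linear (fun x : tens dual Y => tev x g) by move=> a u v;
  exact: tev_linear.
move: x; apply: htens_ind_ext.
- exact: (lin_comp (lev _ y) beta_linear).
- apply: lin_tsum_r => y1 y2; apply: (lin_comp (lin_swap_act_r 1 y2)); exact: lev.
move=> phi v w; rewrite betaE (linear_sumE _ _ (lev _ y)).
under eq_bigr do rewrite tev_tmul.
have lF : linear (fun k => w \otimes hact k v : restr (htens W V)).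
  by apply: lin_to_restr_htens; lin_tac.
rewrite (sum_dual_basis _ _ lF).
apply: eq_tsum => y1 y2; rewrite tev_tmul (linear_of_scale (lin_swap_act_r 1 y2)).
by rewrite swap_act_tmul {2}/hact scale1r.
Qed.

Lemma tev_beta_inv x y : tev (beta_inv b V W x) y =
  \tsum_(y1 \otimes y2 <- comul y)
    (swap_act (S y2) 1 (tev x y1) : restr (htens V W)).
Proof.
have lev Y (g : H) : linear (fun x : tens dual Y => tev x g) by move=> a u v;
  exact: tev_linear.
move: x; apply: htens_ind_ext.
- exact: (lin_comp (lev _ y) beta_inv_linear).
- apply: lin_tsum_r => y1 y2; apply: (lin_comp (lin_swap_act_r (S y2) 1));
  exact: lev.
move=> phi w v; rewrite beta_invE (linear_sumE _ _ (lev _ y)).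
under eq_bigr do rewrite tev_tmul.
have lF : linear (fun k => hact (S k) v \otimes w : restr (htens V W)).
  by apply: lin_to_restr_htens; lin_tac.
rewrite (sum_dual_basis _ _ lF).
apply: eq_tsum => y1 y2;
  rewrite tev_tmul (linear_of_scale (lin_swap_act_r (S y2) 1)).
by rewrite swap_act_tmul {3}/hact scale1r.
Qed.

End TwoModules.

(** After evaluation at y both sides have the form phi(y_1) times a term in y_2 and y_3; these
    terms, [Lh] and [Rh], are compared for arbitrary arguments. *)
Lemma beta_ind_act (V W : lmodType H) d x :
  beta b V W (ind_act d x) = ind_act d (beta b V W x).
Proof.
have lb := @beta_linear V W.
have lev Y (g : H) : linear (fun x : tens dual Y => tev x g) by move=> a u v;
  exact: tev_linear.
move: d; apply: tens_eq_linear.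
- by apply: (lin_comp lb); exact: ind_act_linear_l.
- exact: ind_act_linear_l.
move=> phi h; apply: tev_inj => y.
rewrite tev_beta tev_ind_act.
pose G (p k : H) (t : restr (htens V W)) : restr (htens W V) :=
  @swap_act K H V W p k t.
have G1 k t : linear (fun p => G p k t) by exact: lin_swap_act_l.
have G2 p t : linear (fun k => G p k t) by exact: lin_swap_act_m.
have G3 p k : linear (G p k) by exact: lin_swap_act_r.
have lX := tev_lin x.
have L1 k t (f : H -> H) : linear f -> linear (fun a => G (f a) k t).
  by move=> lf; exact: (lin_comp (G1 k t) lf).
have L2 p t (f : H -> H) : linear f -> linear (fun a => G p (f a) t).
  by move=> lf; exact: (lin_comp (G2 p t) lf).
have L3 p k (f : H -> H) : linear f -> linear (fun a => G p k (tev x (f a))).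
  by move=> lf; exact: (lin_comp (G3 p k) (lin_comp lX lf)).
pose Lh a c := \tsum_(h1 \otimes h23 <- comul h) \tsum_(h2 \otimes h3 <- comul h23)
   \tsum_(p \otimes q <- comul h2) G q (c * p) (tev x (S h3 * (a * h1))).
pose Rh a c := \tsum_(h1 \otimes h23 <- comul h) \tsum_(h2 \otimes h3 <- comul h23)
   \tsum_(p \otimes q <- comul h2) \tsum_(r \otimes s <- comul h3)
   \tsum_(u \otimes v <- comul h1) G p (q * (S r * (c * v))) (tev x (S s * (a * u))).
(* With the legs of h numbered consecutively, [Rh] acts by h_3 on w and by h_4 S(h_5) c h_2 on v,
   and evaluates x at S(h_6) a h_1. Contracting h_4 S(h_5) gives [Lh]. *)
have LR a c : Lh a c = Rh a c.
  transitivity (\tsum_(u \otimes z <- comul h) \tsum_(v \otimes h23 <- comul z)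
     \tsum_(q \otimes h3 <- comul h23) G q (c * v) (tev x (S h3 * (a * u)))).
    apply: eq_tsum => u z.
    apply: (comul_assoc_sum (F :=
      fun v q h3 => G q (c * v) (tev x (S h3 * (a * u))))).
    - by move=> *; apply: L2; lin_tac.
    - by move=> *; apply: L1; lin_tac.
    - by move=> *; apply: L3; lin_tac.
  transitivity (\tsum_(h1 \otimes h23 <- comul h) \tsum_(u \otimes v <- comul h1)
    \tsum_(h2 \otimes h3 <- comul h23) \tsum_(p \otimes q <- comul h2)
    \tsum_(r \otimes s <- comul h3) G p (q * (S r * (c * v))) (tev x (S s * (a * u)))); last first.
    apply: eq_tsum => h1 h23; rewrite tsum_exchange; apply: eq_tsum => h2 h3.
    rewrite tsum_exchange; apply: eq_tsum => p q.
    by rewrite tsum_exchange.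
  rewrite (comul_assoc_sum (F := fun u v h23 => \tsum_(h2 \otimes h3 <- comul h23)
      \tsum_(p \otimes q <- comul h2) \tsum_(r \otimes s <- comul h3)
      G p (q * (S r * (c * v))) (tev x (S s * (a * u))))).
  - apply: eq_tsum => u z; apply: eq_tsum => v m.
    rewrite (comul_assoc_sum (F := fun p q h3 => \tsum_(r \otimes s <- comul h3)
      G p (q * (S r * (c * v))) (tev x (S s * (a * u))))).
    + apply: eq_tsum => p m'.
      (* The legs q, r, s are now consecutive, so q S(r) contracts. *)
      rewrite -(comul_assoc_sum (F :=
        fun q r s => G p (q * (S r * (c * v))) (tev x (S s * (a * u))))).
      * have l1 : linear (fun t => G p (c * v) (tev x (S t * (a * u))))
        by apply: L3; lin_tac.
        rewrite -(comul_counitl m' l1); apply: eq_tsum => k s.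
        have l2 : linear (fun t => G p (t * (c * v)) (tev x (S s * (a * u))))
          by apply: L2; lin_tac.
        have := comul_antipoder k l2; rewrite mul1r => <-.
        by apply: eq_tsum => q r; rewrite mulrA.
      * by move=> *; apply: L2; lin_tac.
      * by move=> *; apply: L2; lin_tac.
      * by move=> *; apply: L3; lin_tac.
    + by move=> *; apply: lin_tsum_r => *; apply: L1; lin_tac.
    + by move=> *; apply: lin_tsum_r => *; apply: L2; lin_tac.
    + move=> p q; apply: lin_tsum_l; last by lin_tac.
      by split=> ?; [apply: L2 | apply: L3]; lin_tac.
  - by move=> *; do 3!(apply: lin_tsum_r => ? ?); apply: L3; lin_tac.
  - by move=> *; do 3!(apply: lin_tsum_r => ? ?); apply: L2; lin_tac.
  - move=> u v; apply: lin_tsum_l; last by lin_tac.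
    split=> ?.
      apply: lin_tsum_l; last by lin_tac.
      by split=> ?; apply: lin_tsum_r => ? ?; [apply: L1 | apply: L2]; lin_tac.
    apply: lin_tsum_r => ? ?; apply: lin_tsum_l; last by lin_tac.
    by split=> ?; [apply: L2 | apply: L3]; lin_tac.
transitivity (\tsum_(y1 \otimes y2 <- comul y) \tsum_(y11 \otimes y12 <- comul y1)
   (phi y11 : K) *: Lh y12 y2).
  apply: eq_tsum => y1 y2; rewrite tev_ind_act -/(G 1 y2 _).
  rewrite (lin_tsumE (G3 1 y2)); apply: eq_tsum => y11 y12.
  rewrite (lin_tsumE (G3 1 y2)) tsum_scaler; apply: eq_tsum => h1 h23.
  rewrite (lin_tsumE (G3 1 y2)) tsum_scaler; apply: eq_tsum => h2 h3.
  rewrite (linear_of_scale (G3 1 y2)) hact_htens (lin_tsumE (f := G 1 y2));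
    last first.
    exact: (lin_swap_act_r 1 y2).
  congr (_ *: _); apply: eq_tsum => p q.
  by rewrite /G swap_keep mul1r.
transitivity (\tsum_(y1 \otimes y2 <- comul y) \tsum_(y21 \otimes y22 <- comul y2)
   (phi y1 : K) *: Rh y21 y22); last first.
  apply: eq_tsum => y1 y2; rewrite -tsum_scaler.
  rewrite /Rh tsum_exchange tsum_scaler; apply: eq_tsum => h1 h23.
  rewrite tsum_exchange tsum_scaler; apply: eq_tsum => h2 h3; congr (_ *: _).
  rewrite tsum_exchange hact_htens; apply: eq_tsum => p q.
  have lk := @lin_keep_act_r _ _ W V p q.
  rewrite tev_beta (lin_tsumE lk).
  transitivity (\tsum_(a \otimes c <- comul (S h3 * (y2 * h1))) G p (q * c) (tev x a)); last first.
    by apply: eq_tsum => a c; rewrite keep_swap mulr1.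
  have bG : is_bilinear (fun a c => G p (q * c) (tev x a)).
    by split=> ?; [apply: (L3 _ _ id) | apply: L2]; lin_tac.
  have bG' g1 g2 : is_bilinear (fun a c => G p (q * (g2 * c)) (tev x (g1 * a))).
    by split=> ?; [apply: L3 | apply: L2]; lin_tac.
  rewrite (tsum_comulM _ _ bG) tsum_comul_antipode; last first.
    split=> ?; apply: lin_tsum_r => ? ?; [apply: L3 | apply: L2]; lin_tac.
  rewrite tsum_exchange; apply: eq_tsum => r s.
  by rewrite (tsum_comulM _ _ (bG' _ _)).
rewrite -(comul_assoc_sum (F := fun y1 a c => (phi y1 : K) *: Rh a c)).
- by apply: eq_tsum => y1 y2; apply: eq_tsum => *; rewrite LR.
- by move=> a c; apply: lin_scale_l => k u v; rewrite linearP.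
- move=> *; apply: lin_scale_r; do 5!(apply: lin_tsum_r => ? ?); apply: L3; lin_tac.
- move=> *; apply: lin_scale_r; do 5!(apply: lin_tsum_r => ? ?); apply: L2; lin_tac.
Qed.

Hypothesis S2 : forall h, S (S h) = h.

(** The two flips cancel and v is acted on by S(y_3) y_2, which is S(S(y_2) y_3) because S^2 =
    id. *)
Lemma betaK (V W : lmodType H) : cancel (beta b V W) (beta_inv b V W).
Proof.
move=> x; apply: tev_inj => y; rewrite tev_beta_inv.
pose F (a c d : H) : restr (htens V W) := keep_act (S d * c) (1 * 1) (tev x a).
have F1 c d : linear (fun a => F a c d)
  by exact: (lin_comp (lin_keep_act_r _ _) (tev_lin x)).
have Fl (f : H -> H) a : linear f ->
  linear (fun u => keep_act (f u) (1 * 1) (tev x a) : restr (htens V W)).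
  by move=> lf; exact: (lin_comp (lin_keep_act_l _ _) lf).
transitivity (\tsum_(y1 \otimes y2 <- comul y) \tsum_(a \otimes c <- comul y1) F a c y2).
  apply: eq_tsum => y1 y2; rewrite tev_beta.
  rewrite (lin_tsumE (f := swap_act (S y2) 1 : restr (htens W V) ->
    restr (htens V W))); last exact: lin_swap_act_r.
  by apply: eq_tsum => a c; rewrite swap_swap.
rewrite (comul_assoc_sum (F := F)) //; try by move=> *; apply: Fl; lin_tac.
rewrite -[RHS](comul_counitr y (tev_lin x)); apply: eq_tsum => y1 y2.
have l1 : linear (fun u => keep_act (S u) (1 * 1) (tev x y1) :
  restr (htens V W)) by apply: Fl; lin_tac.
have := comul_antipodel y2 l1; rewrite antipode1 mul1r keep1 => <-.
by apply: eq_tsum => c d; rewrite /F antipodeM S2 mul1r.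
Qed.

(** Likewise v is acted on by y_3 S(y_2) = S(y_2 S(y_3)). *)
Lemma beta_invK (V W : lmodType H) : cancel (beta_inv b V W) (beta b V W).
Proof.
move=> x; apply: tev_inj => y; rewrite tev_beta.
pose F (a c d : H) : restr (htens W V) := keep_act (1 * 1) (d * S c) (tev x a).
have F1 c d : linear (fun a => F a c d)
  by exact: (lin_comp (lin_keep_act_r _ _) (tev_lin x)).
have Fl (f : H -> H) a : linear f ->
  linear (fun u => keep_act (1 * 1) (f u) (tev x a) : restr (htens W V)).
  by move=> lf; exact: (lin_comp (lin_keep_act_m _ _) lf).
transitivity (\tsum_(y1 \otimes y2 <- comul y) \tsum_(a \otimes c <- comul y1) F a c y2).
  apply: eq_tsum => y1 y2; rewrite tev_beta_inv.
  rewrite (lin_tsumE (f := swap_act 1 y2 : restr (htens V W) ->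
    restr (htens W V))); last exact: lin_swap_act_r.
  by apply: eq_tsum => a c; rewrite swap_swap.
rewrite (comul_assoc_sum (F := F)) //; try by move=> *; apply: Fl; lin_tac.
rewrite -[RHS](comul_counitr y (tev_lin x)); apply: eq_tsum => y1 y2.
have l1 : linear (fun u => keep_act (1 * 1) (S u) (tev x y1) :
  restr (htens W V)) by apply: Fl; lin_tac.
have := comul_antipoder y2 l1; rewrite antipode1 mul1r keep1 => <-.
by apply: eq_tsum => c d; rewrite /F antipodeM S2 mul1r.
Qed.

(** As S^2 = id, the sum over i expands a leg of y in the basis b. The value is y_2 . x(S(y_3) y_4
    y_1), where S(y_3) y_4 contracts. *)
Lemma tev_drinfeld_inv (U : lmodType H) (x : Ind U) y :
  tev (ind_act (drinfeld_inv b) x) y =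
  \tsum_(y1 \otimes y2 <- comul y) hact y2 (tev x y1).
Proof.
have lX := tev_lin x.
have Lh a (f : H -> H) : linear f -> linear (fun u => hact (f u) (tev x a)).
  by move=> lf; apply: lin_hact_l.
have LX a (f : H -> H) : linear f -> linear (fun u => hact a (tev x (f u))).
  by move=> lf; apply: lin_hact_r; exact: lin_comp.
have ld : linear (fun d : Defs.double H => tev (ind_act d x) y).
  by move=> a u v; rewrite ind_act_linear_l tev_linear.
rewrite /drinfeld_inv (linear_sumE _ _ ld).
transitivity (\tsum_(y1 \otimes y2 <- comul y) \tsum_(h1 \otimes h23 <- comul y1)
  \tsum_(h2 \otimes h3 <- comul h23) hact h2 (tev x (S h3 * (y2 * h1)))).
  under eq_bigr do rewrite tev_ind_act.
  rewrite /tsum exchange_big; apply: eq_bigr => -[y1 y2] _ /=.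
  pose F k := \tsum_(h1 \otimes h23 <- comul k) \tsum_(h2 \otimes h3 <- comul h23)
     hact h2 (tev x (S h3 * (y2 * h1))).
  have lF : linear F.
    apply: lin_tsum_l; last by lin_tac.
    split=> ?; first by apply: lin_tsum_r => ? ?; apply: LX; lin_tac.
    apply: lin_tsum_l; last by lin_tac.
    by split=> ?; [apply: Lh | apply: LX]; lin_tac.
  rewrite -[RHS]/(F y1) [in RHS](coord_basis basis_b (memvf y1)) (linear_of_sum lF).
  apply: eq_bigr => i _.
  rewrite comp_lfunE dual_basisE comp_lfunE !lfunE /= S2.
  rewrite /F /tsum [RHS]scaler_sumr; apply: eq_bigr => p _; by rewrite scaler_sumr.
rewrite (comul_assoc_sum (F := fun h1 h23 y2 =>
   \tsum_(h2 \otimes h3 <- comul h23) hact h2 (tev x (S h3 * (y2 * h1))))).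
- apply: eq_tsum => h1 r.
  rewrite (comul_assoc_sum (F :=
    fun h2 h3 y2 => hact h2 (tev x (S h3 * (y2 * h1))))).
  + have l1 : linear (fun u => hact u (tev x h1)) by apply: Lh; lin_tac.
    rewrite -(comul_counitr r l1); apply: eq_tsum => h2 q.
    have l2 : linear (fun u => hact h2 (tev x (u * h1))) by apply: LX; lin_tac.
    have := comul_antipodel q l2; rewrite mul1r => <-.
    by apply: eq_tsum => *; rewrite mulrA.
  + by move=> *; apply: Lh; lin_tac.
  + by move=> *; apply: LX; lin_tac.
  + by move=> *; apply: LX; lin_tac.
- by move=> *; apply: lin_tsum_r => *; apply: LX; lin_tac.
- move=> *; apply: lin_tsum_l; last by lin_tac.
  by split=> ?; [apply: Lh | apply: LX]; lin_tac.
- by move=> *; apply: lin_tsum_r => *; apply: LX; lin_tac.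
Qed.

(** The flips cancel; y_2 acts on v and y_3 on w, which by coassociativity is the diagonal action of
    y_2 in [tev_drinfeld_inv]. *)
Lemma beta_beta (V W : lmodType H) (x : Ind (htens V W)) :
  beta b W V (beta b V W x) = ind_act (drinfeld_inv b) x.
Proof.
apply: tev_inj => y; rewrite tev_drinfeld_inv tev_beta.
pose F (a c d : H) : restr (htens V W) := keep_act c d (tev x a).
have F1 c d : linear (fun a => F a c d)
  by exact: (lin_comp (lin_keep_act_r _ _) (tev_lin x)).
have F2 a d : linear (fun c => F a c d) by exact: lin_keep_act_l.
have F3 a c : linear (fun d => F a c d) by exact: lin_keep_act_m.
transitivity (\tsum_(y1 \otimes y2 <- comul y) \tsum_(a \otimes c <- comul y1) F a c y2).
  apply: eq_tsum => y1 y2; rewrite tev_beta.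
  rewrite (lin_tsumE (f := swap_act 1 y2 : restr (htens W V) ->
    restr (htens V W))); last exact: lin_swap_act_r.
  by apply: eq_tsum => a c; rewrite swap_swap mul1r mulr1.
by rewrite (comul_assoc_sum (F := F)).
Qed.

End BetaEvaluation.

Theorem lemma7p1 (K : closedFieldType) (H : hopfType K) (n : nat)
    (b : n.-tuple H) (V W : lmodType H) :
  [pchar K] =i pred0 ->
  semisimple_alg H ->
  basis_of {:H}%VS b ->
  [/\ dbl_linear (beta b V W),
      cancel (beta b V W) (beta_inv b V W),
      cancel (beta_inv b V W) (beta b V W)
    & forall x : Ind (htens V W),
        beta b W V (beta b V W x) = ind_act (drinfeld_inv b) x].
Proof.
move=> ch0 ssH basis_b; have S2 := semisimple_antipode2 ch0 ssH; split.
- by split; [exact: beta_linear | move=> d x; exact: beta_ind_act].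
- exact: betaK.
- exact: beta_invK.
- exact: beta_beta.
Qed.
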